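(* Let $\epsilon>0$, let $X$ be a finite set and let $\circ$ be a partially defined binary operation on $X$ that is injective in each variable separately. Let $E\subset X^2$ be the set of pairs on which $\circ$ is defined. Suppose that there are at least $\epsilon|X|^3$ triples $(x,y,z)\in X^3$ such that $x\circ(y\circ z)=(x\circ y)\circ z$ (where this means in particular that all expressions and subexpressions are defined). Then for every positive integer $b$ there exist $\delta=\delta(\epsilon,b)\geq \epsilon^{b^{26b}}$, a subset $A\subset E$ with $|A|\geq \delta|X|^2$, a metric group $G$, and maps $\phi,\psi,\omega:X\to G$ such that each of the images $\phi(X),\psi(X),\omega(X)$ is $1$-separated, and $d(\phi(x)\psi(y),\omega(z))\leq b^{-1}$ for every $(x,y,z)\in X^3$ with $(x,y)\in A$ and $x\circ y=z$.
   Context: A partially defined binary operation $\circ$ on $X$ is injective in each variable separately if whenever $x\circ y$ and $x\circ y'$ are both defined and equal then $y=y'$, and whenever $x\circ y$ and $x'\circ y$ are both defined and equal then $x=x'$. A metric group is a group $G$ equipped with a bi-invariant metric $d$ (i.e. $d(gx,gy)=d(xg,yg)=d(x,y)$ for all $g,x,y$), which is allowed to take the value $+\infty$. A subset $S$ of a metric space is $1$-separated if $d(s,s')\geq 1$ for all distinct $s,s'\in S$. *)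

(* Defs.v *)
From HB Require Import structures.
From mathcomp Require Export all_boot all_order all_algebra all_fingroup.
From mathcomp Require Export classical_sets reals constructive_ereal.

#[export] Set Implicit Arguments.
#[export] Unset Strict Implicit.
#[export] Unset Printing Implicit Defensive.

Local Open Scope ring_scope.

(* A partially defined binary operation on X is a map X -> X -> option X,
   with None meaning "undefined". *)
Section PartialOperation.
Variables (X : finType) (op : X -> X -> option X).

Definition injective_in_each_variable : Prop :=
  (forall x y y' z, op x y = Some z -> op x y' = Some z -> y = y') /\
  (forall x x' y z, op x y = Some z -> op x' y = Some z -> x = x').

Definition op_domain : {set X * X} := [set p | isSome (op p.1 p.2)].

Definition associative_triples : {set X * X * X} :=
  [set t | let: (x, y, z) := t in
    let l := obind (fun yz => op x yz) (op y z) in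
    let r := obind (fun xy => op xy z) (op x y) in
    isSome l && (l == r)].

End PartialOperation.

Section MetricGroup.
Variable R : realType.

Record is_extended_metric (T : Type) (d : T -> T -> \bar R) : Prop := {
  ext_dist_ge0 : forall x y, (0 <= d x y)%E;
  ext_dist_eq0 : forall x y, d x y = 0%E <-> x = y;
  ext_dist_sym : forall x y, d x y = d y x;
  ext_dist_triangle : forall x y z, (d x z <= d x y + d y z)%E
}.

(* The underlying group is not assumed finite, hence groupType. *)
Record metricGroup := MetricGroup {
  mg_group :> groupType;
  mg_dist : mg_group -> mg_group -> \bar R;
  mg_distP : is_extended_metric mg_dist;
  mg_dist_mull : forall g x y : mg_group,
    mg_dist (g * x)%g (g * y)%g = mg_dist x y;
  mg_dist_mulr : forall g x y : mg_group,
    mg_dist (x * g)%g (y * g)%g = mg_dist x y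
}.

Definition one_separated (T : Type) (d : T -> T -> \bar R) (S : set T) : Prop :=
  forall s s', S s -> S s' -> s <> s' -> (1 <= d s s')%E.

(* "The image f(X) is 1-separated", the image being understood as the family
   (f x) indexed by X: d (f x) (f x') >= 1 whenever x <> x'.  Without
   injectivity, constant maps to a trivial group would qualify. *)
Definition one_separated_image (X : Type) (G : metricGroup) (f : X -> G) :
    Prop :=
  injective f /\ one_separated (@mg_dist G) (range f)%classic.

End MetricGroup.

(* Main.v *)
From HB Require Import structures.
Require Import Defs.
From mathcomp Require Import boolp generic_quotient.
From mathcomp Require Import zify ring lra.
From mathcomp Require Import fintype finset bigop.
Import Order.TTheory GRing.Theory Num.Theory.

(** A product [x o y = z] is seen as a triangle with edge labels [x], [y], [z],
    and an associative triple as a tetrahedron: a triangle together with a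
    choice of three positions, consecutive ones being related by the labels.
    For a set [A] of triangles, let [G] be the group generated by three copies
    of [X] with the triangles of [A] as approximate relators; the distance of
    two words is [1/b] times the least number of triangles in a van Kampen
    diagram between them.  Each [(x, y)] in [A] then costs at most [1/b], and the
    theorem asks for a dense [A] that is rigid: no diagram with fewer than [b]
    triangles has two distinct labels of the same kind as its boundary.

    If [eps > 1 - 1/(8b)], keep the triangles lying in at least
    [(1 - 1/(4b)) |X|] tetrahedra: a diagram with fewer than [b] triangles can be
    developed from some starting position, which forces the two labels to agree.

    Otherwise put [h = eps^(8b) <= 1/2] and count decorated diagrams.  Decorate
    each triangle of a diagram by a tetrahedron over it, each edge by a second
    triangle through it and each vertex by a pair of labels, all of these being
    compatible with the tetrahedra around.  Choosing the acceptance conditions by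
    a random sample (dependent random choice, the average over samples being a
    count of complete tripartite patterns with four vertices in each part),
    every diagram over a suitable dense [A1] gets at least a constant proportion
    of all [|X|^(4Q)] decorations.  Conversely the images of the edges and
    vertices under the decoration determine, going up the diagram from its
    innermost edges and then down again, both boundary labels and the
    decoration, up to [C |X|^(4Q + 1)] possibilities by Euler's formula.  Hence
    only [O(|X|)] pairs of labels bound a small diagram; discarding the labels
    of high degree and colouring the others greedily, a popular colour class of
    [A1] is rigid. *)

(** * Words bounding diagrams *)

Section Null.
Variables (L : Type) (inv : L -> L) (tri : L -> L -> L -> Prop).

(* [null k w]: the cyclic word [w] bounds a planar diagram with at most [k] triangles. *)
Inductive null : nat -> seq L -> Prop :=
| null_nil k : null k [::]
| null_pair k1 k2 a w1 w2 : null k1 w1 -> null k2 w2 ->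
    null (k1 + k2) (a :: w1 ++ inv a :: w2)
| null_face k a b c w : tri a b c -> null k [:: b, c & w] ->
    null k.+1 (a :: w).

Lemma null_leq k k' w : null k w -> k <= k' -> null k' w.
Proof.
move=> H; elim: H k' => {k w} [k|k1 k2 a w1 w2 H1 IH1 H2 IH2|k a b c w ab H IH] k'.
- by move=> _; apply: null_nil.
- move=> le; rewrite -(subnKC (leq_trans (leq_addr _ _) le)).
  by apply: null_pair => //; apply: IH2; lia.
- by case: k' => // k' /IH; apply: null_face ab.
Qed.

Lemma null_cat k1 k2 w1 w2 : null k1 w1 -> null k2 w2 -> null (k1 + k2) (w1 ++ w2).
Proof.
move=> H; elim: H k2 w2 => {k1 w1} [k|k1 k2 a w1 w2 H1 IH1 H2 IH2|k a b c w ab H IH] k3 w3 H3.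
- by apply: null_leq H3 _; rewrite leq_addl.
- by rewrite /= -catA cat_cons -addnA; apply: null_pair => //; apply: IH2.
- by rewrite addSn; apply: null_face ab _; apply: IH.
Qed.

Lemma cat_cons_split (u v p q : seq L) a : u ++ v = p ++ a :: q ->
  (exists2 q1, u = p ++ a :: q1 & q = q1 ++ v) \/
  (exists2 p2, v = p2 ++ a :: q & p = u ++ p2).
Proof.
elim: u p => [|x u IH] p /=; first by move=> ->; right; exists p.
case: p => [|y p] /= [-> E]; first by left; exists u.
case: (IH _ E) => [[q1 -> ->]|[p2 -> ->]]; first by left; exists q1.
by right; exists p2.
Qed.

(** The diagram of [s] is attached at one boundary corner of the other diagram, so the triangle
    counts add. *)
Lemma null_insert k1 k2 p q s :
  null k1 (p ++ q) -> null k2 s -> null (k1 + k2) (p ++ s ++ q).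
Proof.
move Ew: (p ++ q) => w H; elim: H p q Ew => {k1 w}
  [k|k1 k1' a w1 w2 H1 IH1 H2 IH2|k a b c w ab H IH] p q Ew Hs.
- by case: p q Ew => // -[] // _ /=; rewrite cats0; apply: null_leq Hs _; rewrite leq_addl.
- case: p Ew => [|x p] /= Ew.
    by rewrite Ew addnC; apply: null_cat Hs _; apply: null_pair.
  case: Ew => -> /cat_cons_split [[q1 -> Ew2]|[p2 -> Ew1]].
  + by rewrite -catA cat_cons -addnA; apply: null_pair => //; apply: IH2.
  + by have := null_pair a (IH1 p p2 (esym Ew1) Hs) H2; rewrite addnAC -!catA.
- case: p Ew => [|x p] /= Ew.
    by rewrite Ew addnC; apply: null_cat Hs _; apply: null_face ab H.
  case: Ew => -> Ew; rewrite addSn; apply: null_face ab _.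
  by apply: (IH [:: b, c & p]) => //=; rewrite Ew.
Qed.

Lemma null_conj k a w : null k w -> null k (a :: rcons w (inv a)).
Proof. by move=> H; have := null_pair a H (null_nil 0); rewrite addn0 cats1. Qed.

Hypothesis invK : involutive inv.
(** Reading [tri a b c] as [a = b c], these hypotheses invert the relation and solve it for [b] and
    for [c]. *)
Hypothesis tri_inv : forall a b c, tri a b c -> tri (inv a) (inv c) (inv b).
Hypothesis tri_rotl : forall a b c, tri a b c -> tri b a (inv c).
Hypothesis tri_rotr : forall a b c, tri a b c -> tri c (inv b) a.

Lemma null_rot1_iter k w :
  (forall a w, null k (a :: w) -> null k (rcons w a)) ->
  forall u, null k (u ++ w) -> null k (w ++ u).
Proof.
move=> H; move=> u; elim: u w => [|a u IH] w; first by rewrite cats0.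
by move=> /= /H; rewrite -cats1 -catA cats1 => /IH; rewrite cat_rcons.
Qed.

(** [null_face] glues a triangle to the first letter only. Here the triangle is pushed into the
    diagram; if the first letter cancels [b] or [c], the triangle is glued to that letter instead.
    Rotation is assumed for at most [k] triangles because [null_rcons] is derived from this lemma by
    induction on [k]. *)
Lemma null_face_any k a b c u v :
  (forall k' w, k' <= k -> forall a, null k' (a :: w) -> null k' (rcons w a)) ->
  tri a b c -> null k (u ++ [:: b, c & v]) -> null k.+1 (u ++ a :: v).
Proof.
move=> Hrot abc; move Ew: (_ ++ _) => w H; elim: H u v Ew Hrot => {k w}
  [k|k1 k2 d w1 w2 H1 IH1 H2 IH2|k d b1 c1 w tr H IH] u v Ew Hrot.
- by case: u Ew.
- case: u Ew => [|x u] Ew; first by apply: null_face abc _; move: Ew => /= ->; apply: null_pair.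
  case: Ew => -> /cat_cons_split [[q1 Eu Ew2]|[p2 Ev Eu]].
  + rewrite Eu /= -catA cat_cons -addnS; apply: null_pair => //.
    by apply: IH2 => // k' w' le; apply: Hrot; lia.
  + case: p2 Ev Eu => [|x' [|x'' p2]] /=.
    * case=> Eb Ew2; rewrite cats0 => Eu.
      have tb : tri d c (inv a) by have := tri_inv (tri_rotl abc); rewrite Eb !invK.
      apply: null_face tb _; rewrite -Eu -[_ :: _]/([:: c] ++ (inv a :: w1 ++ a :: v)).
      have -> : inv a :: w1 ++ a :: v = (inv a :: w1 ++ inv (inv a) :: [::]) ++ v.
        by rewrite invK /= -catA.
      rewrite addnC; apply: null_insert; first by rewrite -Ew2 in H2.
      by rewrite -[k1]addn0; apply: null_pair => //; apply: null_nil.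
    * case=> <- Ec Ew2 Eu.
      have tc : tri d (inv a) b by have := tri_inv (tri_rotr abc); rewrite Ec !invK.
      apply: null_face tc _.
      have H1' : null k1 (b :: u).
        have := @null_rot1_iter k1 [:: b] _ u; rewrite -Eu; apply => // a' w'.
        by apply: Hrot; lia.
      have -> : [:: inv a, b & u ++ a :: v] = (inv a :: (b :: u) ++ inv (inv a) :: v).
        by rewrite invK.
      by apply: null_pair => //; rewrite Ew2.
    * case=> <- <- Ev Eu.
      rewrite Ev Eu in H1 H2 IH1 IH2 *.
      have := null_pair d (IH1 u p2 erefl _) H2; rewrite addSn -catA /=; apply.
      by move=> k' w' le; apply: Hrot; lia.
- case: u Ew => [|x u] Ew.
    by apply: null_face abc _; move: Ew => /= ->; apply: null_face tr _.
  case: Ew => -> Ew; apply: null_face tr _.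
  apply: (IH [:: b1, c1 & u]) => [|k' w' le]; first by rewrite -Ew.
  by apply: Hrot; lia.
Qed.

(** Remove the triangle at the first letter, rotate its two other sides one after the other with one
    triangle less, and glue it back at the end by [null_face_any]. *)
Lemma null_rcons k a w : null k (a :: w) -> null k (rcons w a).
Proof.
elim/ltn_ind: k a w => k IH a w H; inversion H as [|k1 k2 a' w1 w2 H1 H2|k' a' b c w' abc H1]; subst.
  have := null_cat H1 (null_pair (inv a) H2 (null_nil 0)).
  by rewrite invK addn0 -cats1 -catA.
have Hr k'' w'' : k'' <= k' -> forall a, null k'' (a :: w'') -> null k'' (rcons w'' a).
  by move=> le b' H'; apply: IH H'; lia.
have := IH _ _ _ _ H1; rewrite ltnS leqnn => /(_ isT) /= /(Hr _ _ (leqnn _)).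
rewrite -!cats1 -catA /= => H2.
exact: null_face_any abc H2.
Qed.

Lemma null_rot k u w : null k (u ++ w) -> null k (w ++ u).
Proof. by apply: null_rot1_iter => a w'; apply: null_rcons. Qed.

Lemma null_triangle k a b c u v :
  tri a b c -> null k (u ++ [:: b, c & v]) -> null k.+1 (u ++ a :: v).
Proof. by apply: null_face_any => k' w' _ a'; apply: null_rcons. Qed.

(* The diagram is explored from the first letter of [v], so that the two faces
   adjacent to the cancelled edge need not be looked at. *)
Lemma null_cancel_end k a v : null k (v ++ [:: a; inv a]) -> null k v.
Proof.
elim/ltn_ind: k a v => k IHk a v.
have [m] := ubnP (size v); elim: m v k IHk => // m IHm v k IHk.
case: v => [|d v] sv; first by move=> _; apply: null_nil.
move Ew: (_ ++ _) => w H; case: k w / H IHk Ew => // [k1 k2 d' w1 w2 H1 H2|k' d' b c w' tr H1] IHk [Ed']; subst d'.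
  case/cat_cons_split => [[q1 Ev Ew2]|[p2 Ev Ew1]].
    rewrite Ev; apply: null_pair => //; apply: IHm; last by rewrite -Ew2.
      by move=> k' lt a' v' H'; apply: (IHk k') H'; lia.
    by move: sv; rewrite Ev /= size_cat /=; lia.
  case: p2 Ev Ew1 => [|x [|y [|z p2]]] //=.
    case=> Ed Ew2; rewrite cats0 => Ew1; rewrite Ew1 -Ew2 in H1 H2 *.
    by have := null_cat H2 H1; rewrite addnC /= Ed invK.
  case=> <- Ed Ew2 Ew1; rewrite Ew1 -Ew2 in H1 H2 *.
  have Ead : a = d by apply: (can_inj invK).
  by rewrite -Ead in H1 *; apply: (@null_leq k1); [have := null_rot H1; rewrite ?cats0|lia].
move=> Ew; apply: null_face tr _; apply: (IHk k' _ a) => //.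
by move: H1; rewrite -Ew.
Qed.

Lemma null_cancel k u a v : null k (u ++ [:: a, inv a & v]) -> null k (u ++ v).
Proof.
move=> H; apply: null_rot; apply: (@null_cancel_end _ a).
by rewrite -catA; apply: null_rot; rewrite -catA.
Qed.

Definition winv (w : seq L) := rev (map inv w).

Lemma winv_cat u v : winv (u ++ v) = winv v ++ winv u.
Proof. by rewrite /winv map_cat rev_cat. Qed.
Lemma winvK : involutive winv.
Proof. by move=> w; rewrite /winv map_rev revK mapK. Qed.
Lemma winv_cons a w : winv (a :: w) = rcons (winv w) (inv a).
Proof. by rewrite /winv /= rev_cons. Qed.

Lemma null_winv k w : null k w -> null k (winv w).
Proof.
elim=> {k w} [k|k1 k2 a w1 w2 _ H1 _ H2|k a b c w tr _ H]; first exact: null_nil.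
  rewrite winv_cons winv_cat winv_cons -cats1 -!catA cat_rcons addnC.
  apply: null_cat => //; rewrite invK /=; have := null_conj a H1.
  by rewrite -cats1.
rewrite winv_cons -cats1; apply: null_triangle (tri_inv tr) _.
by move: H; rewrite !winv_cons -!cats1 -catA.
Qed.

Lemma null_cancelw k u w v : null k (u ++ w ++ winv w ++ v) -> null k (u ++ v).
Proof.
elim: w u v => [|a w IH] u v //; rewrite winv_cons cat_cons -cats1 -!catA -cat_rcons.
by move/IH => /=; rewrite cat_rcons => /null_cancel.
Qed.

Lemma null_mulV w : null 0 (w ++ winv w).
Proof.
elim: w => [|a w IH]; first exact: null_nil.
by rewrite winv_cons /= -rcons_cat; apply: null_conj.
Qed.

Lemma null_conjw k u w : null k (u ++ w ++ winv u) <-> null k w.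
Proof.
split=> [H|H]; last first.
  by have := null_insert (null_mulV u) H; rewrite add0n.
move: H; rewrite catA => /null_rot; rewrite -{2}[u]winvK => H.
by have := @null_cancelw _ [::] (winv u) w; apply; rewrite winvK in H *.
Qed.

End Null.

Definition nx (i : 'I_3) : 'I_3 := (i + 1)%R.
Definition pv (i : 'I_3) : 'I_3 := (i + 1 + 1)%R.

Lemma nxpv i : nx (pv i) = i. Proof. by apply/val_inj; case: i => [[|[|[|]]]]. Qed.
Lemma pvnx i : pv (nx i) = i. Proof. by apply/val_inj; case: i => [[|[|[|]]]]. Qed.
Lemma nxnx i : nx (nx i) = pv i. Proof. by []. Qed.
Lemma pvpv i : pv (pv i) = nx i. Proof. by apply/val_inj; case: i => [[|[|[|]]]]. Qed.
Definition I3E := (nxpv, pvnx, nxnx, pvpv).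

(** * The metric group of a set of triangles *)

Section Letters.
Local Open Scope ring_scope.
Variable X : finType.

Definition letter := ('I_3 * X * bool)%type.
Definition linv (a : letter) : letter := (a.1, ~~ a.2).
Lemma linvK : involutive linv. Proof. by case=> [[i l] s]; rewrite /linv /= negbK. Qed.

Variable A : {set {ffun 'I_3 -> X}}.

(* The letter [(i, l, true)] runs along the side opposite to the vertex [i] of
   a triangle, so that the three sides of [t] in cyclic order multiply to 1. *)
Definition ltri (a b c : letter) : Prop := exists2 t, t \in A &
  let i := a.1.1 in a.1.2 = t i /\
  if a.2 then b = (pv i, t (pv i), false) /\ c = (nx i, t (nx i), false)
  else b = (nx i, t (nx i), true) /\ c = (pv i, t (pv i), true).

Lemma ltri_inv a b c : ltri a b c -> ltri (linv a) (linv c) (linv b).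
Proof.
case: a => [[i l] s] [t At /= [-> H]]; exists t => //=; split=> //.
by case: s H => -[-> ->].
Qed.
Lemma ltri_rotl a b c : ltri a b c -> ltri b a (linv c).
Proof.
case: a => [[i l] s] [t At /= [-> H]]; exists t => //=.
by case: s H => -[-> ->] /=; rewrite !I3E.
Qed.
Lemma ltri_rotr a b c : ltri a b c -> ltri c (linv b) a.
Proof.
case: a => [[i l] s] [t At /= [-> H]]; exists t => //=.
by case: s H => -[-> ->] /=; rewrite !I3E.
Qed.

Definition lnull := null linv ltri.
Definition lwinv := winv linv.

(** Without triangles only free cancellation remains, so the quotient is the free group on
    ['I_3 * X]; the triangles of [A] enter through the metric alone. *)
Definition weq (u v : seq letter) : bool := `[< lnull 0 (u ++ lwinv v) >].
Lemma weqP u v : reflect (lnull 0 (u ++ lwinv v)) (weq u v).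
Proof. exact: asboolP. Qed.

Lemma lnull_trans k1 k2 u v w : lnull k1 (u ++ lwinv v) -> lnull k2 (v ++ lwinv w) ->
  lnull (k1 + k2) (u ++ lwinv w).
Proof.
move=> H1 H2; have := null_cat H1 H2; rewrite -catA /lwinv -{2}[v](winvK linvK).
exact: null_cancelw linvK ltri_inv ltri_rotl ltri_rotr _ _ _ _.
Qed.
Lemma lnull_sym k u v : lnull k (u ++ lwinv v) -> lnull k (v ++ lwinv u).
Proof.
move/(null_winv linvK ltri_inv ltri_rotl ltri_rotr).
by rewrite winv_cat (winvK linvK).
Qed.

Lemma weq_equiv : equiv_class_of weq.
Proof.
split=> [u|u v|v u w]; first by apply/weqP; apply: null_mulV.
  by apply/weqP/weqP; apply: lnull_sym.
move=> /weqP H1 /weqP H2; apply/weqP; exact: (lnull_trans H1 H2).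
Qed.
Canonical weq_equiv_rel := EquivRelPack weq_equiv.

Definition wgroup := {eq_quot weq}%qT.
HB.instance Definition _ := Choice.on wgroup.

Definition wclass (u : seq letter) : wgroup := (\pi_wgroup u)%qT.
Lemma wclass_eq u v : wclass u = wclass v <-> lnull 0 (u ++ lwinv v).
Proof. by split=> [/eqmodP/weqP|/weqP H] //; apply/eqmodP. Qed.
Lemma wclass_repr g : wclass (repr g) = g. Proof. exact: reprK. Qed.
Lemma repr_wclass u : lnull 0 (repr (wclass u) ++ lwinv u).
Proof. by apply/wclass_eq; rewrite wclass_repr. Qed.

Definition wmul (g h : wgroup) : wgroup := wclass (repr g ++ repr h).
Definition winvg (g : wgroup) : wgroup := wclass (lwinv (repr g)).
Definition wone : wgroup := wclass [::].

Lemma wclass_cat u v : wmul (wclass u) (wclass v) = wclass (u ++ v).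
Proof.
apply/wclass_eq; rewrite /lwinv winv_cat -catA.
have := null_insert (repr_wclass u) (repr_wclass v).
by rewrite addn0 -!catA.
Qed.

Lemma wclass_winv u : winvg (wclass u) = wclass (lwinv u).
Proof.
apply/wclass_eq; rewrite /lwinv (winvK linvK).
apply: null_rot linvK ltri_inv ltri_rotl ltri_rotr _ _ _ _.
exact: (lnull_sym (repr_wclass u)).
Qed.

Lemma wmulA : associative wmul.
Proof.
by move=> f g h; rewrite -(wclass_repr f) -(wclass_repr g) -(wclass_repr h) !wclass_cat catA.
Qed.
Lemma wmul1 : left_id wone wmul.
Proof. by move=> g; rewrite -(wclass_repr g) wclass_cat. Qed.
Lemma wmulr1 : right_id wone wmul.
Proof. by move=> g; rewrite -(wclass_repr g) wclass_cat cats0. Qed.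
Lemma wmulV : left_inverse wone winvg wmul.
Proof.
move=> g; rewrite -(wclass_repr g) wclass_winv wclass_cat; apply/wclass_eq.
by rewrite cats0 -{2}[repr g](winvK linvK); apply: null_mulV.
Qed.
Lemma wmulrV : right_inverse wone winvg wmul.
Proof.
move=> g; rewrite -(wclass_repr g) wclass_winv wclass_cat; apply/wclass_eq.
by rewrite cats0; apply: null_mulV.
Qed.
HB.instance Definition _ := isGroup.Build wgroup wmulA wmul1 wmulr1 wmulV wmulrV.

Lemma wclassM u v : (wclass u * wclass v)%g = wclass (u ++ v).
Proof. exact: wclass_cat. Qed.

(** * The bi-invariant metric counting triangles *)

Variables (R : realType) (b : nat).
Hypothesis b_gt0 : (0 < b)%N.

(** The value [+oo] stands for a word bounding no diagram; the division by [b] gives norm 1 to a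
    minimal diagram of [b] triangles. *)
Definition wnorm (w : seq letter) : \bar R :=
  if pselect (exists k, `[< lnull k w >]) is left e
  then ((ex_minn e)%:R / b%:R)%:E else +oo%E.

Let b0 : (0 : R) < b%:R. Proof. by rewrite ltr0n. Qed.

Lemma wnorm_le k w : (wnorm w <= (k%:R / b%:R)%:E)%E <-> lnull k w.
Proof.
rewrite /wnorm; case: pselect => [e|ne]; last first.
  by rewrite leye_eq; split=> // H; case: ne; exists k; apply/asboolP.
rewrite lee_fin ler_pM2r ?invr_gt0 // ler_nat.
case: ex_minnP => m /asboolP Hm min; split=> [|H]; first exact: null_leq.
by apply: min; apply/asboolP.
Qed.

Lemma wnormP w : wnorm w = +oo%E \/ exists2 k, wnorm w = (k%:R / b%:R)%:E & lnull k w.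
Proof.
rewrite /wnorm; case: pselect => [e|ne]; last by left.
by right; case: ex_minnP => m /asboolP Hm min; exists m.
Qed.

Lemma wnorm_mono w w' : (forall k, lnull k w -> lnull k w') -> (wnorm w' <= wnorm w)%E.
Proof.
by move=> H; case: (wnormP w) => [->|[k -> /H /wnorm_le]] //; rewrite leey.
Qed.

Definition wdist (g h : wgroup) : \bar R := wnorm (repr g ++ lwinv (repr h)).

(** Passing to another representative is a diagram without triangles, which leaves the minimum
    unchanged. *)
Lemma wdist_class u v : wdist (wclass u) (wclass v) = wnorm (u ++ lwinv v).
Proof.
apply/le_anti/andP; split; apply: wnorm_mono => k H.
  have := lnull_trans (lnull_trans (repr_wclass u) H) (lnull_sym (repr_wclass v)).
  by rewrite addn0 add0n.
have := lnull_trans (lnull_trans (lnull_sym (repr_wclass u)) H) (repr_wclass v).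
by rewrite addn0 add0n.
Qed.

Lemma wnorm_ge0 w : (0 <= wnorm w)%E.
Proof.
case: (wnormP w) => [->|[k -> _]]; first exact: le0y.
by rewrite lee_fin divr_ge0 ?ler0n.
Qed.

Lemma wdist_metric : is_extended_metric wdist.
Proof.
split=> [g h|g h|g h|f g h].
- exact: wnorm_ge0.
- rewrite -(wclass_repr g) -(wclass_repr h) wdist_class wclass_eq.
  rewrite -wnorm_le mul0r; split=> [->|H] //.
  by apply/le_anti; rewrite H wnorm_ge0.
- by rewrite /wdist; apply/le_anti/andP; split; apply: wnorm_mono => k H; exact: (lnull_sym H).
- rewrite /wdist; case: (wnormP (repr f ++ lwinv (repr g))) => [->|[k1 -> H1]].
    by rewrite addye ?leey // gt_eqF // (lt_le_trans _ (wnorm_ge0 _)) // ltNy0.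
  case: (wnormP (repr g ++ lwinv (repr h))) => [->|[k2 -> H2]]; first by rewrite addey ?leey.
  by rewrite -EFinD -mulrDl -natrD; apply/wnorm_le; exact: (lnull_trans H1 H2).
Qed.

Lemma wdist_mull (g x y : wgroup) : wdist (g * x)%g (g * y)%g = wdist x y.
Proof.
rewrite -(wclass_repr g) -(wclass_repr x) -(wclass_repr y) !wclassM !wdist_class.
have -> : (repr g ++ repr x) ++ lwinv (repr g ++ repr y) =
    repr g ++ (repr x ++ lwinv (repr y)) ++ lwinv (repr g).
  by rewrite /lwinv winv_cat !catA.
by apply/le_anti/andP; split; apply: wnorm_mono => k H;
   apply/(null_conjw linvK ltri_inv ltri_rotl ltri_rotr k (repr g)).
Qed.

Lemma wdist_mulr (g x y : wgroup) : wdist (x * g)%g (y * g)%g = wdist x y.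
Proof.
rewrite -(wclass_repr g) -(wclass_repr x) -(wclass_repr y) !wclassM !wdist_class.
rewrite /lwinv winv_cat -catA.
apply/le_anti/andP; split; apply: wnorm_mono => k H.
  by have := null_insert H (null_mulV linv ltri (repr g)); rewrite addn0 -!catA.
exact: (null_cancelw linvK ltri_inv ltri_rotl ltri_rotr H).
Qed.

Definition word_metricGroup : metricGroup R :=
  MetricGroup wdist_metric wdist_mull wdist_mulr.

Definition rigid := forall i l l' k, (k < b)%N ->
  lnull k [:: (i, l, true); (i, l', false)] -> l = l'.

(** Labels at distance [k / b] bound a diagram with [k] triangles, so rigidity forces [b <= k] when
    they differ. Injectivity is the case [k = 0], where [0 < b] is needed. *)
Lemma rigid_separated i (s : bool) : rigid ->
  one_separated_image (fun l => wclass [:: (i, l, s)] : word_metricGroup).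
Proof.
move=> rg.
have sep l l' k : (k < b)%N ->
    lnull k ([:: (i, l, s)] ++ lwinv [:: (i, l', s)]) -> l = l'.
  case: s => kb H; first exact: (rg i _ _ k).
  apply: esym; apply: (rg i _ _ k) => //.
  exact: (null_rot linvK ltri_inv ltri_rotl ltri_rotr (u := [:: _]) H).
split=> [l l' /wclass_eq /(sep _ _ 0 b_gt0)|_ _ [l _ <-] [l' _ <-] ne] //.
rewrite /= wdist_class; case: (wnormP ([:: (i, l, s)] ++ lwinv [:: (i, l', s)])) => [->|[k -> H]].
  by rewrite leey.
rewrite lee_fin ler_pdivlMr // mul1r ler_nat leqNgt; apply/negP => kb.
by apply: ne; rewrite (sep _ _ _ kb H).
Qed.

Lemma word_triangle t i : t \in A ->
  (mg_dist (wclass [:: (i, t i, true)] * wclass [:: (nx i, t (nx i), true)] : word_metricGroup)%g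
     (wclass [:: (pv i, t (pv i), false)]) <= (b%:R^-1)%:E)%E.
Proof.
move=> At; rewrite -[X in X%:E]mul1r /= wclassM wdist_class; apply/(wnorm_le 1).
apply: (@null_face _ _ _ 0 _ (pv i, t (pv i), false) (nx i, t (nx i), false)).
  by exists t.
by have := null_mulV linv ltri [:: (pv i, t (pv i), false); (nx i, t (nx i), false)]; apply.
Qed.
End Letters.

(** * Tetrahedra *)

(* [Fc t] says that [t] is a triangle, [t i] labelling the side opposite to the
   vertex [i]; [Lat i l a b] says that the label [l] of kind [i] carries the
   position [a] of kind [i + 1] to the position [b] of kind [i + 2]. *)
Record latin (X : finType) := Latin {
  Fc : {ffun 'I_3 -> X} -> bool;
  Lat : 'I_3 -> X -> X -> X -> bool;
  FcI : forall i t t', Fc t -> Fc t' ->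
    t (nx i) = t' (nx i) -> t (pv i) = t' (pv i) -> t = t';
  LatI1 : forall i l l' a b, Lat i l a b -> Lat i l' a b -> l = l';
  LatI2 : forall i l a a' b, Lat i l a b -> Lat i l a' b -> a = a';
  LatI3 : forall i l a b b', Lat i l a b -> Lat i l a b' -> b = b' }.

Lemma I3_cases (P : 'I_3 -> Prop) i : P i -> P (nx i) -> P (pv i) -> forall j, P j.
Proof.
move=> P0 P1 P2 j.
have : [|| j == i, j == nx i | j == pv i].
  by case: i {P0 P1 P2} => [[|[|[|]]]] //= ?; case: j => [[|[|[|]]]].
by case/or3P=> /eqP->.
Qed.

Section Tetra.
Variables (X : finType) (S : latin X).
Implicit Types t p : {ffun 'I_3 -> X}.

Definition tet (t a : {ffun 'I_3 -> X}) := Fc S t && [forall i, Lat S i (t i) (a (nx i)) (a (pv i))].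

Lemma tetF t a : tet t a -> Fc S t. Proof. by case/andP. Qed.
Lemma tetL t a i : tet t a -> Lat S i (t i) (a (nx i)) (a (pv i)).
Proof. by case/andP=> _ /forallP/(_ i). Qed.
Lemma tetLnx t a i : tet t a -> Lat S (nx i) (t (nx i)) (a (pv i)) (a i).
Proof. by move/(tetL (nx i)); rewrite !I3E. Qed.
Lemma tetLpv t a i : tet t a -> Lat S (pv i) (t (pv i)) (a i) (a (nx i)).
Proof. by move/(tetL (pv i)); rewrite !I3E. Qed.

Lemma tet_inj_pos i t a a' : tet t a -> tet t a' -> a i = a' i -> a = a'.
Proof.
move=> H H' E; apply/ffunP; apply: (I3_cases (i := i)) => //.
  by have := tetLpv i H; rewrite E; move/LatI3; apply; apply: tetLpv H'.
by have := tetLnx i H; rewrite E; move/LatI2; apply; apply: tetLnx H'.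
Qed.

Lemma tet_inj_lab t t' a : tet t a -> tet t' a -> t = t'.
Proof. by move=> H H'; apply/ffunP => i; apply: LatI1 (tetL i H) (tetL i H'). Qed.

Lemma tet_card t : #|[set a | tet t a]| <= #|X|.
Proof.
rewrite -(card_in_imset (f := fun a : {ffun 'I_3 -> X} => a ord0)) ?max_card //.
by move=> a a'; rewrite !inE; apply: tet_inj_pos.
Qed.

Section Words.
Variable A : {set {ffun 'I_3 -> X}}.

Definition used i l := exists2 t, t \in A & t i = l.
Definition usedw (w : seq (letter X)) := forall a, List.In a w -> used a.1.1 a.1.2.

(** The first letter is either cancelled by the only other letter or is a side of a triangle of [A];
    a rotation treats the second letter in the same way. *)
Lemma lnull_digon k i l l' : lnull A k [:: (i, l, true); (i, l', false)] ->
  l = l' \/ used i l /\ used i l'.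
Proof.
have aux k' s m m' : lnull A k' [:: (i, m, s); (i, m', ~~ s)] -> m = m' \/ used i m.
  move Ew: [:: _; _] => w H; case: H Ew => // [k1 k2 a w1 w2 _ _|k1 a b c w0 [t At [Et _]] _].
    case=> <-; case: w1 => [|x [|y w1]] //= [<- _]; by left.
  by case=> Ea _; right; exists t => //; rewrite -Ea in Et.
move=> H; case: (aux _ _ _ _ H) => [->|u]; first by left.
have H' := null_rot (@linvK X) (@ltri_inv _ A) (@ltri_rotl _ A) (@ltri_rotr _ A)
   (u := [:: (i, l, true)]) (w := [:: (i, l', false)]) H.
by case: (aux _ false _ _ H') => [->|u']; [left|right].
Qed.

End Words.

(** * Developing a diagram over triangles with few missing tetrahedra *)

Section Dense.
Variables (A : {set {ffun 'I_3 -> X}}) (b m : nat).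
Hypothesis A_dense : forall t, t \in A -> #|X| - #|[set a | tet t a]| <= m.
Hypothesis m_small : 4 * b * m <= #|X|.

(** A letter acts on positions as a partial injection, backwards if its sign is [false]; [run]
    composes these actions along a word. *)
Definition stp (a : letter X) x y :=
  if a.2 then Lat S a.1.1 a.1.2 x y else Lat S a.1.1 a.1.2 y x.

Fixpoint run (w : seq (letter X)) x y : bool :=
  if w is a :: w then [exists z, stp a x z && run w z y] else x == y.

Lemma stp_inj a x x' y : stp a x y -> stp a x' y -> x = x'.
Proof. by rewrite /stp; case: a.2; [apply: LatI2|apply: LatI3]. Qed.
Lemma stp_fun a x y y' : stp a x y -> stp a x y' -> y = y'.
Proof. by rewrite /stp; case: a.2; [apply: LatI3|apply: LatI2]. Qed.
Lemma stp_linv a x y : stp (linv a) x y = stp a y x.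
Proof. by rewrite /stp /linv /=; case: a.2. Qed.

Lemma missing_card t i : t \in A ->
  #|[set x | ~~ [exists p, tet t p && (p i == x)]]| <= m.
Proof.
move=> At; apply: leq_trans (A_dense At).
rewrite -cardsT -(card_in_imset (f := fun a : {ffun 'I_3 -> X} => a i)); last first.
  by move=> a a'; rewrite !inE; apply: tet_inj_pos.
rewrite -(cardsDS (subsetT _)); apply: subset_leq_card; apply/subsetP => x.
rewrite !inE andbT => /existsP H; apply/imsetP => -[p]; rewrite inE => tp Ex.
by apply: H; exists p; rewrite tp Ex eqxx.
Qed.

Lemma run_cat w1 w2 x y z : run w1 x y -> run w2 y z -> run (w1 ++ w2) x z.
Proof.
elim: w1 x => [|a w1 IH] x /=; first by move/eqP->.
case/existsP=> x' /andP[s r] r2; apply/existsP; exists x'.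
by rewrite s (IH _ r r2).
Qed.

Definition src (a : letter X) := if a.2 then nx a.1.1 else pv a.1.1.
Definition tgt (a : letter X) := if a.2 then pv a.1.1 else nx a.1.1.

Lemma tet_stp t p a : tet t p -> a.1.2 = t a.1.1 -> stp a (p (src a)) (p (tgt a)).
Proof. by rewrite /stp /src /tgt => tp ->; case: a.2; apply: tetL. Qed.

(** Each construction step of the diagram spoils at most [m] further starting positions. The weights
    3 per triangle and 1 per letter fit both kinds of step exactly: a cancellation removes two
    letters, and removing a triangle lengthens the word by one. *)
Lemma run_fail k w : lnull A k w -> usedw A w ->
  2 * #|[set x | ~~ run w x x]| <= (3 * k + size w) * m.
Proof.
elim=> {k w} [k|k1 k2 a w1 w2 _ IH1 _ IH2|k a b' c w [t At] [Ea Ebc] _ IH] uw.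
- have -> : [set x | ~~ run [::] x x] = set0 by apply/setP => x; rewrite !inE /= eqxx.
  by rewrite cards0 muln0.
- have u1 : usedw A w1 by move=> d Hd; apply: uw; right; apply/List.in_or_app; left.
  have u2 : usedw A w2.
    by move=> d Hd; apply: uw; right; apply/List.in_or_app; right; right.
  have [t At Et] : used A a.1.1 a.1.2 by apply: uw; left.
  have sub : [set x | ~~ run (a :: w1 ++ linv a :: w2) x x] \subset
    [set x | ~~ [exists p, tet t p && (p (src a) == x)]] :|:
    ([set x | [exists z, stp a x z && ~~ run w1 z z]] :|: [set x | ~~ run w2 x x]).
    apply/subsetP => x; rewrite !inE; apply: contraR; rewrite !negb_or.
    case/and3P=> /negPn/existsP[p /andP[tp /eqP Ex]] nz /negPn r2.
    have s := tet_stp tp (esym Et); rewrite Ex in s.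
    apply/existsP; exists (p (tgt a)); rewrite s /=.
    have r1 : run w1 (p (tgt a)) (p (tgt a)).
      case: (boolP (run _ _ _)) => // nr; case/negP: nz; apply/existsP.
      by exists (p (tgt a)); rewrite s.
    apply: run_cat r1 _; apply/existsP; exists x; rewrite stp_linv s; exact: r2.
  (* The partial injection of [a] transports the failures of [w1] back to the start without
     multiplying them. *)
  have c2 : #|[set x | [exists z, stp a x z && ~~ run w1 z z]]| <= #|[set x | ~~ run w1 x x]|.
    pose f x := odflt x [pick z | stp a x z].
    have fE x z : stp a x z -> f x = z.
      by rewrite /f; case: pickP => [z' s'|->] // s; apply: stp_fun s' s.
    rewrite -(card_in_imset (f := f)).
      apply: subset_leq_card; apply/subsetP => _ /imsetP[x + ->]; rewrite !inE.
      by case/existsP=> z /andP[s nr]; rewrite (fE _ _ s).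
    move=> x y; rewrite !inE => /existsP[z /andP[s _]] /existsP[z' /andP[s' _]].
    by rewrite (fE _ _ s) (fE _ _ s') => E; subst z'; apply: stp_inj s s'.
  have := leq_trans (subset_leq_card sub) (leq_trans (leq_card_setU _ _).1
    (leq_add (missing_card (src a) At) (leq_trans (leq_card_setU _ _).1 (leq_add c2 (leqnn _))))).
  by move: (IH1 u1) (IH2 u2); rewrite [size (_ :: _)]/= size_cat /=; lia.
- have [Hb [Hc [Hba Hca]]] : b'.1.2 = t b'.1.1 /\ (c.1.2 = t c.1.1 /\
      ((src b' = src a /\ tgt b' = src c) /\ tgt c = tgt a)).
    by rewrite /src /tgt; case: (a.2) Ebc => -[-> ->] /=; rewrite !I3E.
  have uw' : usedw A [:: b', c & w].
    move=> d [<-|[<-|Hd]]; [by exists t|by exists t|].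
    by apply: uw; right.
  have sub : [set x | ~~ run (a :: w) x x] \subset
    [set x | ~~ [exists p, tet t p && (p (src a) == x)]] :|: [set x | ~~ run [:: b', c & w] x x].
    apply/subsetP => x; rewrite !inE; apply: contraR; rewrite !negb_or !negbK.
    case/andP=> /existsP[p /andP[tp /eqP Ex]] /existsP[z /andP[s /existsP[y /andP[s' r]]]].
    have sb := tet_stp tp Hb; have sc := tet_stp tp Hc.
    case: Hba Hca sb sc => -> -> -> ; rewrite Ex => sb sc.
    have Ez := stp_fun s sb; subst z; have Ey := stp_fun s' sc; subst y.
    by apply/existsP; exists (p (tgt a)); rewrite r -Ex (tet_stp tp Ea).
  have := leq_trans (subset_leq_card sub) (leq_trans (leq_card_setU _ _).1
    (leq_add (missing_card (src a) At) (leqnn _))).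
  by move: (IH uw'); rewrite ![size (_ :: _)]/=; lia.
Qed.

Lemma rigid_dense : rigid A b.
Proof.
move=> i l l' k kb H; case: (lnull_digon H) => // -[ul ul'].
have uw : usedw A [:: (i, l, true); (i, l', false)].
  by move=> d [<-|[<-|[]]].
have := run_fail H uw => /= fail.
have n0 : 0 < #|X| by apply/card_gt0P; exists l.
(* At most [(3 * b - 1) * m / 2] starts fail, fewer than [#|X|] by [m_small]. From any other start
   both labels join the same two positions. *)
have : [set x | run [:: (i, l, true); (i, l', false)] x x] != set0.
  apply: contraTneq (n0) => E; move: fail.
  have -> : [set x | ~~ run [:: (i, l, true); (i, l', false)] x x] = setT.
    apply/setP => x; rewrite !inE; move/setP: E => /(_ x); rewrite !inE.
    by move=> /= ->.
  by rewrite cardsT -leqNgt; nia.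
case/set0Pn=> x; rewrite inE /= => /existsP[z /andP[s /existsP[y /andP[s' /eqP Exy]]]].
by subst y; apply: LatI1 s s'.
Qed.
End Dense.
End Tetra.

(** * Diagrams with named edges and vertices *)

Section Diagram.
Variables (X : finType) (I : finType) (A : {set {ffun 'I_3 -> X}}).
Notation EV := (I * 'I_3)%type.

(** An element of [EV] is an identifier with a kind, and names edges, vertices and triangles alike.
    The fields [fe] and [fv] list the edges and vertices of a triangle, and matter only at an edge
    that names one. *)
Record einfo := EInfo { lab : X; ep1 : I; ep2 : I;
  fe : {ffun 'I_3 -> I}; fv : {ffun 'I_3 -> I} }.
Implicit Types (D : EV -> einfo) (F M U : seq EV).

Definition fedge D (f : EV) k : EV := (fe (D f) k, k).
Definition fvert D (f : EV) k : EV := (fv (D f) k, k).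
Definition oth D (f : EV) : seq EV := [:: fedge D f (nx f.2); fedge D f (pv f.2)].
Definition flab D (f : EV) : {ffun 'I_3 -> X} := [ffun k => lab (D (fedge D f k))].

Definition face_ok D f := [/\ fe (D f) f.2 = f.1,
  forall k, ep1 (D (fedge D f k)) = fv (D f) (nx k) /\ ep2 (D (fedge D f k)) = fv (D f) (pv k)
  & flab D f \in A].

Notation token := (letter X * I * I)%type.
Definition tedge (s : token) : EV := (s.1.2, s.1.1.1.1).
Definition tvert (s : token) : EV := (s.2, src s.1.1).

Fixpoint tok_ok D z (P : seq token) : Prop :=
  if P is s :: P' then
    [/\ lab (D (tedge s)) = s.1.1.1.2,
      let y := head z [seq s.2 | s <- P'] in
      if s.1.1.2 then ep1 (D (tedge s)) = s.2 /\ ep2 (D (tedge s)) = y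
      else ep2 (D (tedge s)) = s.2 /\ ep1 (D (tedge s)) = y
    & tok_ok D z P']
  else True.

Fixpoint typed z (y : 'I_3) (w : seq (letter X)) : bool :=
  if w is a :: w then (src a == y) && typed z (tgt a) w else y == z.

(* [P] is the boundary, [F] lists the triangles, each named by its first edge to
   be met, from the innermost outwards; [M] are the edges closed by a
   cancellation and [U] as many vertices, which bounds the number of edges. *)
Record diag D (v0 : I) (P : seq token) F M U (fr : seq I) : Prop := Diag {
  dg_tok : tok_ok D v0 P;
  dg_head : head v0 [seq s.2 | s <- P] = v0;
  dg_face : forall f, f \in F -> face_ok D f;
  dg_up : forall F1 f F2, F = F1 ++ f :: F2 -> {subset oth D f <= M ++ F1};
  dg_down : forall F1 f F2, F = F1 ++ f :: F2 ->
    f \in [seq tedge s | s <- P] ++ flatten [seq oth D f | f <- F2];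
  dg_uniq : uniq (M ++ F);
  dg_ids : {subset [seq e.1 | e <- M ++ F] <= fr};
  dg_twice : forall e, e \in M ->
    1 < count_mem e ([seq tedge s | s <- P] ++ flatten [seq oth D f | f <- F]);
  dg_bound : {subset [seq tedge s | s <- P] <= M ++ F};
  dg_Uuniq : uniq U;
  dg_Usize : size U = size M;
  dg_Uids : {subset [seq e.1 | e <- U] <= fr};
  dg_Ureach : forall u, u \in U -> u \in [seq tvert s | s <- P] \/
    exists2 f, f \in F & u = fvert D f f.2 }.

Lemma typed_cat z y u v : typed z y (u ++ v) -> exists2 x, typed x y u & typed z x v.
Proof.
elim: u y => [|a u IH] y /=; first by exists y.
by case/andP=> sa /IH[x tu tv]; exists x => //; rewrite sa.
Qed.

Lemma null_typed_closed k w x y : lnull A k w -> typed x y w -> x = y.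
Proof.
move=> H; elim: H x y => {k w} [k|k1 k2 a w1 w2 _ IH1 _ IH2|k a b c w [t At [_ E]] _ IH] x y /=.
- by move/eqP.
- case/andP=> /eqP<- /typed_cat[z /IH1 -> /= /andP[_ /IH2 ->]].
  by rewrite /tgt /src /linv /=; case: a.2.
- case/andP=> /eqP<- tw; apply: (IH x (src a)).
  move: E tw; rewrite /= /src /tgt; case: a.2 => -[-> ->] /=.
    by rewrite !I3E !eqxx.
  by rewrite !I3E !eqxx.
Qed.

Lemma tok_ok_cat D z P Q :
  tok_ok D (head z [seq s.2 | s <- Q]) P -> tok_ok D z Q -> tok_ok D z (P ++ Q).
Proof.
elim: P => [|s P IH] //= [H1 H2 H3] HQ; split=> //; last exact: IH.
by case: P H2 {IH H3}.
Qed.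

Lemma tok_ok_ext D D' z P :
  (forall e, e \in [seq tedge s | s <- P] -> D e = D' e) -> tok_ok D z P -> tok_ok D' z P.
Proof.
elim: P => [|s P IH] //= E [H1 H2 H3].
rewrite -(E _ (mem_head _ _)); split=> //.
by apply: IH => // e He; apply: E; rewrite inE He orbT.
Qed.

Lemma diag_sub D v0 P F M U fr f k : diag D v0 P F M U fr -> f \in F ->
  fedge D f k \in M ++ F.
Proof.
move=> dg Hf; have [E _ _] := dg_face dg Hf.
have [F1 [F2 EF]] : exists F1 F2, F = F1 ++ f :: F2.
  by case/splitPr: Hf => F1 F2; exists F1, F2.
have H := dg_up dg EF.
move: k; apply: (I3_cases (i := f.2)).
- by rewrite /fedge E -surjective_pairing mem_cat Hf orbT.
- have /H : fedge D f (nx f.2) \in oth D f by rewrite mem_head.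
  by rewrite EF !mem_cat => /orP[->|->]; rewrite ?orbT.
- have /H : fedge D f (pv f.2) \in oth D f by rewrite !inE eqxx orbT.
  by rewrite EF !mem_cat => /orP[->|->]; rewrite ?orbT.
Qed.

(** [D] is read only at names in [M ++ F], so diagrams with disjoint sets of identifiers can be
    merged into one function. *)
Lemma diag_ext D D' v0 P F M U fr : (forall e, e \in M ++ F -> D e = D' e) ->
  diag D v0 P F M U fr -> diag D' v0 P F M U fr.
Proof.
move=> E dg.
have EF f : f \in F -> D f = D' f by move=> Hf; apply: E; rewrite mem_cat Hf orbT.
have Eo f : f \in F -> oth D' f = oth D f by move=> /EF; rewrite /oth /fedge => ->.
have Eoo (G : seq EV) : {subset G <= F} -> [seq oth D' f | f <- G] = [seq oth D f | f <- G].
  by move=> sG; apply/eq_in_map => f /sG /Eo.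
split.
- by apply: tok_ok_ext (dg_tok dg) => e He; apply: E; apply: (dg_bound dg).
- exact: dg_head dg.
- move=> f Hf; have [H1 H2 H3] := dg_face dg Hf.
  have Ee k : fedge D' f k = fedge D f k by rewrite /fedge EF.
  have Ee' k : D' (fedge D f k) = D (fedge D f k) by apply/esym/E/(diag_sub _ dg).
  split; [by rewrite -EF|by move=> k; rewrite Ee Ee' -(EF f Hf); apply: H2|].
  by have -> : flab D' f = flab D f by apply/ffunP => k; rewrite !ffunE Ee Ee'.
- move=> F1 f F2 EqF; rewrite Eo; first exact: dg_up dg _ _ _ EqF.
  by rewrite EqF mem_cat mem_head orbT.
- move=> F1 f F2 EqF; rewrite Eoo; first exact: dg_down dg _ _ _ EqF.
  by move=> g Hg; rewrite EqF mem_cat inE Hg !orbT.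
- exact: dg_uniq dg.
- exact: dg_ids dg.
- by move=> e He; rewrite Eoo //; apply: dg_twice dg _ He.
- exact: dg_bound dg.
- exact: dg_Uuniq dg.
- exact: dg_Usize dg.
- exact: dg_Uids dg.
- move=> u Hu; case: (dg_Ureach dg Hu) => [|[f Hf ->]]; first by left.
  by right; exists f => //; rewrite /fvert EF.
Qed.

Lemma cat_cons_split_eq (T : eqType) (u v p q : seq T) a : u ++ v = p ++ a :: q ->
  (exists2 q1, u = p ++ a :: q1 & q = q1 ++ v) \/
  (exists2 p2, v = p2 ++ a :: q & p = u ++ p2).
Proof. exact: cat_cons_split. Qed.

Let ar1 (x y c1 c2 p d : nat) : c1 + c2 <= x + (c1 + (y + p) + (c2 + d)).
Proof. lia. Qed.
Let ar2 (x y c1 c2 p d : nat) : p + d <= x + (c1 + (y + p) + (c2 + d)).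
Proof. lia. Qed.
Let ar3 (x y z p f : nat) : x + (y + p) + f <= z + p + (f + (x + (y + 0))).
Proof. lia. Qed.

(** Induction on [null], with [fr] a pool of fresh identifiers. A cancellation uses one, shared by
    the closed edge and its new end. A triangle uses one for its outer edge and leaves an inner word
    longer by one letter, hence the cost 2 per triangle. *)
Lemma null_diag (D0 : EV -> einfo) k w z v0 (fr : seq I) :
  lnull A k w -> typed z z w -> uniq fr -> v0 \notin fr ->
  2 * k + size w <= size fr ->
  exists D P F M U, [seq s.1.1 | s <- P] = w /\ diag D v0 P F M U fr.
Proof.
move=> H; elim: H z v0 fr => {k w}
  [k|k1 k2 a w1 w2 N1 IH1 N2 IH2|k a b c w [t At [Ea Ebc]] N IH] z v0 fr tw ufr nfr sfr.
- exists D0, [::], [::], [::], [::]; split=> //; split=> //.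
  + by case.
  + by case.
- case: fr ufr nfr sfr => [|o fr] /=; first by rewrite addnS.
  rewrite inE negb_or size_cat /=.
  move=> /andP[no ufr] /andP[v0o nfr] sfr.
  case/andP: tw => /eqP sa /typed_cat[x tw1 /= /andP[/eqP Ex tw2]].
  have Ex' : x = tgt a by apply: null_typed_closed N1 tw1.
  rewrite Ex' in tw1; have tw2' : typed z z w2.
    by move: tw2; rewrite -sa /tgt /src /linv /=; case: a.2.
  set n1 := (2 * k1 + size w1)%N.
  have ufr1 : uniq (take n1 fr) by apply: take_uniq.
  have ufr2 : uniq (drop n1 fr) by apply: drop_uniq.
  have no1 : o \notin take n1 fr by apply: contra no; apply: mem_take.
  have no2 : o \notin drop n1 fr by apply: contra no; apply: mem_drop.
  have nv2 : v0 \notin drop n1 fr by apply: contra nfr; apply: mem_drop.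
  have dis e : e \in take n1 fr -> e \in drop n1 fr -> False.
    move: ufr; rewrite -{1}(cat_take_drop n1 fr) cat_uniq => /and3P[_ /hasPn d _] H1 /d.
    by rewrite /= H1.
  have sz1 : 2 * k1 + size w1 <= size (take n1 fr) by rewrite size_take; case: ifP => _ //; move: sfr; rewrite /n1; clear; lia.
  have sz2 : 2 * k2 + size w2 <= size (drop n1 fr) by move: sfr; rewrite size_drop /n1; clear; lia.
  have [D1 [P1 [F1 [M1 [U1 [EP1 dg1]]]]]] := IH1 _ o _ tw1 ufr1 no1 sz1.
  have [D2 [P2 [F2 [M2 [U2 [EP2 dg2]]]]]] := IH2 _ v0 _ tw2' ufr2 nv2 sz2.
  pose i := a.1.1.
  (* The closed edge joins [v0] to a new vertex [o], the base point of the first subdiagram. It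
     names no triangle, so its last two fields are dummies. *)
  pose D e := if e.1 == o then EInfo a.1.2 (if a.2 then v0 else o) (if a.2 then o else v0)
     [ffun _ => o] [ffun _ => o] else if e.1 \in take n1 fr then D1 e else D2 e.
  have in1 e : e \in M1 ++ F1 -> e.1 \in take n1 fr by move=> He; apply: (dg_ids dg1); apply: map_f.
  have in2 e : e \in M2 ++ F2 -> e.1 \in drop n1 fr by move=> He; apply: (dg_ids dg2); apply: map_f.
  have ED1 e : e \in M1 ++ F1 -> D1 e = D e.
    move/in1 => He; rewrite /D He; case: eqP => // Eo.
    by rewrite Eo (negPf no1) in He.
  have ED2 e : e \in M2 ++ F2 -> D2 e = D e.
    move/in2 => He; rewrite /D; case: eqP => [Eo|_]; first by rewrite Eo (negPf no2) in He.
    by case: ifP => // /dis /(_ He).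
  have {dg1} dg1 := diag_ext ED1 dg1; have {dg2} dg2 := diag_ext ED2 dg2.
  have Doi : D (o, i) = EInfo a.1.2 (if a.2 then v0 else o) (if a.2 then o else v0)
     [ffun _ => o] [ffun _ => o] by rewrite /D eqxx.
  (* The closed edge enters [M] together with its new end in [U], which keeps both lists of the same
     length. *)
  exists D, ((a, o, v0) :: P1 ++ (linv a, o, o) :: P2), (F1 ++ F2), ((o, i) :: M1 ++ M2),
    ((o, tgt a) :: U1 ++ U2).
  split; first by rewrite /= map_cat /= EP1 EP2.
  have M1F f : f \in M1 ++ F1 -> f \in ((o, i) :: M1 ++ M2) ++ F1 ++ F2.
    by rewrite !(mem_cat, inE) => /orP[->|->]; rewrite ?orbT.
  have M2F f : f \in M2 ++ F2 -> f \in ((o, i) :: M1 ++ M2) ++ F1 ++ F2.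
    by rewrite !(mem_cat, inE) => /orP[->|->]; rewrite ?orbT.
  have dM1 e : e \in M1 ++ F1 -> e \in M2 ++ F2 -> False by move/in1 => H1 /in2; apply: dis.
  have dMo : (o, i) \notin (M1 ++ M2) ++ F1 ++ F2.
    apply/negP => He; have: (o, i) \in M1 ++ F1 \/ (o, i) \in M2 ++ F2.
      by move: He; rewrite !mem_cat -!orbA => /or4P[]->; rewrite ?orbT; auto.
    by case=> [/in1|/in2] /=; rewrite ?(negPf no1) ?(negPf no2).
  split.
  + split; first by rewrite /tedge /= Doi.
      rewrite /tedge /= Doi /=.
      have -> : head v0 [seq s.2 | s <- P1 ++ (linv a, o, o) :: P2] = o.
        by have := dg_head dg1; case: (P1).
      by case: a.2.
    apply: tok_ok_cat; first exact: dg_tok dg1.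
    split; rewrite /tedge /= ?Doi //=; last exact: dg_tok dg2.
    by rewrite (dg_head dg2); case: a.2.
  + by [].
  + by move=> f; rewrite mem_cat => /orP[]; [apply: (dg_face dg1)|apply: (dg_face dg2)].
  + move=> G1 f G2 /cat_cons_split_eq[[H EF1 _]|[H EF2 ->]] e.
      by move/(dg_up dg1 EF1); rewrite !(mem_cat, inE) => /orP[->|->]; rewrite ?orbT.
    by move/(dg_up dg2 EF2); rewrite !(mem_cat, inE) => /orP[->|->]; rewrite ?orbT.
  + move=> G1 f G2 /cat_cons_split_eq[[H EF1 ->]|[H EF2 _]].
      have := dg_down dg1 EF1; rewrite /= map_cat map_cat flatten_cat !(mem_cat, inE).
      by case/orP=> ->; rewrite ?orbT.
    have := dg_down dg2 EF2; rewrite /= map_cat !(mem_cat, inE).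
    by case/orP=> ->; rewrite ?orbT.
  + have u1 := dg_uniq dg1; have u2 := dg_uniq dg2.
    rewrite cat_cons cons_uniq dMo /=.
    have /perm_uniq -> : perm_eq ((M1 ++ M2) ++ F1 ++ F2) ((M1 ++ F1) ++ (M2 ++ F2)).
      by apply/seq.permP => q; rewrite !count_cat; clear; lia.
    rewrite cat_uniq u1 u2 andbT; apply/hasPn => e He; apply/negP => He1.
    exact: dM1 He1 He.
  + move=> _ /mapP[e He ->]; have {He} : [\/ e = (o, i), e \in M1 ++ F1 | e \in M2 ++ F2].
      move: He; rewrite cat_cons inE !mem_cat => /orP[/eqP->|]; first by constructor 1.
      by rewrite -!orbA => /or4P[]->; rewrite ?orbT; [constructor 2|constructor 3|constructor 2|constructor 3].
    case=> [->|/in1/mem_take ?|/in2/mem_drop ?]; rewrite inE ?eqxx //; apply/orP; by right.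
  + move=> e; rewrite inE /= !map_cat flatten_cat /= !count_cat /= => /orP[/eqP->|].
      by rewrite /tedge /= !eqxx; clear; lia.
    rewrite mem_cat => /orP[/(dg_twice dg1)|/(dg_twice dg2)] /leq_trans; rewrite count_cat; apply.
      exact: ar1.
    exact: ar2.
  + move=> e; rewrite /= map_cat /= inE mem_cat inE => /or4P[/eqP->|/(dg_bound dg1)/M1F|/eqP->|/(dg_bound dg2)/M2F] //;
      by rewrite mem_head.
  + rewrite cons_uniq cat_uniq (dg_Uuniq dg1) (dg_Uuniq dg2) andbT mem_cat negb_or.
    have iU1 e : e \in U1 -> e.1 \in take n1 fr by move=> He; apply: (dg_Uids dg1); apply: map_f.
    have iU2 e : e \in U2 -> e.1 \in drop n1 fr by move=> He; apply: (dg_Uids dg2); apply: map_f.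
    apply/andP; split; last by apply/hasPn => e /iU2 He; apply/negP => /iU1 /dis; apply.
    apply/andP; split; first by apply/negP => /iU1 /=; rewrite (negPf no1).
    by apply/negP => /iU2 /=; rewrite (negPf no2).
  + by rewrite /= !size_cat (dg_Usize dg1) (dg_Usize dg2).
  + move=> _ /mapP[e He ->]; move: He; rewrite inE mem_cat => /or3P[/eqP->|He|He].
    * by rewrite mem_head.
    * by rewrite inE (mem_take (dg_Uids dg1 (map_f _ He))) orbT.
    * by rewrite inE (mem_drop (dg_Uids dg2 (map_f _ He))) orbT.
  + move=> u; rewrite inE mem_cat => /or3P[/eqP->|/(dg_Ureach dg1)|/(dg_Ureach dg2)].
    * left; rewrite /= map_cat /= /tvert /=.
      have -> : src (linv a) = tgt a by rewrite /src /tgt /linv /=; case: a.2.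
      by rewrite inE mem_cat mem_head !orbT.
    * case=> [Hu|[f Hf ->]]; first by left; rewrite /= map_cat !(inE, mem_cat) Hu ?orbT.
      by right; exists f => //; rewrite mem_cat Hf.
    * case=> [Hu|[f Hf ->]]; first by left; rewrite /= map_cat /= !(inE, mem_cat) Hu !orbT.
      by right; exists f => //; rewrite mem_cat Hf orbT.
- case: fr ufr nfr sfr => [|o fr] /=; first by rewrite addnS.
  rewrite inE negb_or.
  move=> /andP[no ufr] /andP[v0o nfr] sfr.
  case/andP: tw => /eqP sa tw.
  have [Eb [Ec [[sb tb] tc]]] : b.1.2 = t b.1.1 /\ (c.1.2 = t c.1.1 /\
      ((src b = src a /\ tgt b = src c) /\ tgt c = tgt a)).
    by rewrite /src /tgt; case: (a.2) Ebc => -[-> ->] /=; rewrite !I3E.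
  have tw' : typed z z [:: b, c & w] by rewrite /= sb sa eqxx tb eqxx tc.
  have sz : 2 * k + size [:: b, c & w] <= size fr by move: sfr => /=; clear; lia.
  have [D1 [P1 [F1 [M [U [EP1 dg1]]]]]] := IH _ v0 _ tw' ufr nfr sz.
  case: P1 EP1 dg1 => [|[[b0 e1] vb] [|[[c0 e2] u] P]] // [Eb0 Ec0 EP] dg1.
  subst b0 c0; have Evb : vb = v0 by have := dg_head dg1.
  subst vb.
  pose i := a.1.1; pose y := head v0 [seq s.2 | s <- P].
  (* The vertex [u] between [b] and [c] leaves the boundary; it becomes the vertex opposite to the
     outer edge of the new triangle, as [dg_Ureach] allows. *)
  pose fe0 := [ffun j => if j == i then o else if j == b.1.1 then e1 else e2].
  pose fv0 := [ffun j => if j == i then u else if j == src a then v0 else y].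
  pose Do := EInfo a.1.2 (if a.2 then v0 else y) (if a.2 then y else v0) fe0 fv0.
  pose D e := if e.1 == o then Do else D1 e.
  have in1 e : e \in M ++ F1 -> e.1 \in fr by move=> He; apply: (dg_ids dg1); apply: map_f.
  have ED1 e : e \in M ++ F1 -> D1 e = D e.
    move/in1 => He; rewrite /D; case: eqP => // Eo.
    by rewrite Eo (negPf no) in He.
  have {dg1} dg1 := diag_ext ED1 dg1.
  have Doi : D (o, i) = Do by rewrite /D eqxx.
  have ne j : (nx j == j = false) /\ (pv j == j = false).
    by case: j => [[|[|[|]]]].
  have ne2 j : (nx j == pv j = false) /\ (pv j == nx j = false).
    by case: j => [[|[|[|]]]].
  have oE : perm_eq (oth D (o, i)) [:: tedge (b, e1, v0); tedge (c, e2, u)].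
    rewrite /oth /fedge Doi /= !ffunE !(ne i).1 !(ne i).2 /tedge /=.
    case: (a.2) Ebc => -[-> ->] /=; rewrite ?eqxx ?(ne2 _).1 ?(ne2 _).2 //.
    by apply/seq.permP => q /=; rewrite -/i addnCA.
  have oM : {subset oth D (o, i) <= M ++ F1}.
    move=> e; rewrite (perm_mem oE) => He; apply: (dg_bound dg1).
    by rewrite /=; move: He; rewrite !inE => /orP[->|->]; rewrite ?orbT.
  have oiN : (o, i) \notin M ++ F1 by apply/negP => /in1 /=; rewrite (negPf no).
  have [[lb eb [lc ec tP]]] := dg_tok dg1.
  exists D, ((a, o, v0) :: P), (rcons F1 (o, i)), M, U.
  split; first by rewrite /= EP.
  split.
  + by split=> //; rewrite /tedge /= Doi /=; case: (a.2).
  + by [].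
  + move=> f; rewrite mem_rcons inE => /orP[/eqP->|]; last exact: (dg_face dg1).
    have Elab : flab D (o, i) = t.
      apply/ffunP => j; rewrite ffunE /fedge Doi /= ffunE.
      move: lb lc; rewrite /tedge /= => lb lc.
      case: (a.2) Ebc lb lc => -[-> ->] /= lb lc;
      move: j; apply: (I3_cases (i := i)); rewrite ?eqxx ?(ne _).1 ?(ne _).2 ?(ne2 _).1 ?(ne2 _).2 ?Doi //=.
    split; [by rewrite Doi /= ffunE eqxx| |by rewrite Elab] => j.
    rewrite /fedge Doi /=; move: eb ec Doi; rewrite /Do /fe0 /fv0 /src /tedge /= -/y.
    case: (a.2) Ebc => -[-> ->] /= [eb1 eb2] [ec1 ec2] Doi;
    move: j; apply: (I3_cases (i := i)); rewrite ?I3E !ffunE ?I3E -/i ?eqxx ?(ne _).1 ?(ne _).2 ?(ne2 _).1 ?(ne2 _).2 ?Doi //=.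
  + move=> G1 f G2; rewrite -cats1 => /cat_cons_split_eq[[H EF1 _]|[H EF2 ->]].
      exact: (dg_up dg1 EF1).
    case: H EF2 => [|h [|h' H]] //= [<- _]; rewrite cats0; exact: oM.
  + move=> G1 f G2; rewrite -cats1 => /cat_cons_split_eq[[H EF1 ->]|[H EF2 _]].
      have -> : flatten [seq oth D f | f <- H ++ [:: (o, i)]] =
          flatten [seq oth D f | f <- H] ++ oth D (o, i).
        by rewrite map_cat flatten_cat [flatten [seq _ | _ <- [:: _]]]cats0.
      have := dg_down dg1 EF1; rewrite !mem_cat (perm_mem oE) map_cons map_cons !inE -!orbA.
      by case/or4P=> ->; rewrite ?orbT.
    by case: H EF2 => [|h [|h' H]] //= [<- _]; rewrite mem_head.
  + by rewrite -cats1 catA cats1 rcons_uniq oiN (dg_uniq dg1).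
  + move=> _ /mapP[e He ->]; move: He; rewrite -cats1 catA mem_cat => /orP[/in1 He|].
      by rewrite inE He orbT.
    by rewrite inE => /eqP->; rewrite mem_head.
  + move=> e /(dg_twice dg1) /leq_trans; apply.
    rewrite map_rcons flatten_rcons !count_cat.
    have -> : count_mem e (oth D (o, i)) = count_mem e [:: tedge (b, e1, v0); tedge (c, e2, u)].
      by move/seq.permP: oE.
    by rewrite /=; apply: ar3.
  + move=> e; rewrite /= inE => /orP[/eqP->|He].
      by rewrite /tedge /= -cats1 !mem_cat mem_head !orbT.
    rewrite -cats1 catA mem_cat (dg_bound dg1) //= !inE He ?orbT //.
  + exact: dg_Uuniq dg1.
  + exact: dg_Usize dg1.
  + by move=> e He; rewrite inE (dg_Uids dg1 He) orbT.
  + move=> x /(dg_Ureach dg1) [|[f Hf ->]]; last first.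
      by right; exists f => //; rewrite mem_rcons inE Hf orbT.
    rewrite /= !inE => /or3P[/eqP->|/eqP->|Hx]; last by left; rewrite Hx orbT.
      by left; rewrite /tvert /= sb eqxx.
    right; exists (o, i); first by rewrite mem_rcons mem_head.
    rewrite /fvert Doi /= ffunE eqxx /tvert /=; congr pair.
    by rewrite -tb /tgt; case: (a.2) Ebc => -[-> _] /=; rewrite I3E.
Qed.
End Diagram.

(** * Decorated diagrams *)

Section Cone.
Variables (X : finType) (S : latin X).

(** The sides meeting at the vertex [i] have the kinds [nx i] and [pv i]: this asks for a
    tetrahedron with prescribed position and sides at one corner. *)
Definition cone i a u v :=
  [exists t, exists p, [&& tet S t p, p i == a, t (nx i) == u & t (pv i) == v]].

Lemma coneP i a u v : reflect (exists t p, [/\ tet S t p, p i = a, t (nx i) = u & t (pv i) = v])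
  (cone i a u v).
Proof.
apply: (iffP existsP) => [[t /existsP[p /and4P[H /eqP<- /eqP<- /eqP<-]]]|[t [p [H <- <- <-]]]].
  by exists t, p.
by exists t; apply/existsP; exists p; rewrite H !eqxx.
Qed.

(** This and the next definitions make partial maps total by arbitrary defaults; each lemma with
    suffix [E] gives the value when the object exists. A tetrahedron over [t] is encoded by its
    position of kind 0. *)
Definition posn (t : {ffun 'I_3 -> X}) w : {ffun 'I_3 -> X} :=
  odflt [ffun _ => w] [pick a | tet S t a && (a ord0 == w)].
Lemma posnE t a : tet S t a -> posn t (a ord0) = a.
Proof.
rewrite /posn => H; case: pickP => [a' /andP[H' /eqP E]|/(_ a)]; last by rewrite H eqxx.
exact: tet_inj_pos H' H E.
Qed.

Definition third i u v : X :=
  oapp (fun t : {ffun 'I_3 -> X} => t i) u [pick t | [&& Fc S t, t (nx i) == u & t (pv i) == v]].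
Lemma thirdE i t : Fc S t -> third i (t (nx i)) (t (pv i)) = t i.
Proof.
rewrite /third => H; case: pickP => [t' /and3P[H' /eqP E1 /eqP E2]|/(_ t)].
  by rewrite /= (FcI H' H E1 E2).
by rewrite H !eqxx.
Qed.

Definition ofedge k l g : {ffun 'I_3 -> X} :=
  odflt [ffun _ => l] [pick t | [&& Fc S t, t k == l & t (nx k) == g]].
Lemma ofedgeE k t : Fc S t -> ofedge k (t k) (t (nx k)) = t.
Proof.
rewrite /ofedge => H; case: pickP => [t' /and3P[H' /eqP E1 /eqP E2]|/(_ t)].
  by apply: (@FcI _ S (pv k)) => //; rewrite !I3E.
by rewrite H !eqxx.
Qed.

Definition lat2 i l b := odflt b [pick a | Lat S i l a b].
Definition lat3 i l a := odflt a [pick b | Lat S i l a b].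
Lemma lat2E i l a b : Lat S i l a b -> lat2 i l b = a.
Proof.
rewrite /lat2 => H; case: pickP => [a' H'|/(_ a)]; last by rewrite H.
exact: LatI2 H' H.
Qed.
Lemma lat3E i l a b : Lat S i l a b -> lat3 i l a = b.
Proof.
rewrite /lat3 => H; case: pickP => [b' H'|/(_ b)]; last by rewrite H.
exact: LatI3 H' H.
Qed.
End Cone.

Section Shape.
Variables (X : finType) (S : latin X) (I : finType).
Notation EV := (I * 'I_3)%type.

(* The combinatorial type of a diagram: its triangles (named by one of their
   edges), the edges matched in pairs, the vertices to be replaced, the edges
   and vertices of each triangle, the end points of each edge, and the two
   boundary edges. *)
Definition shape := ({set EV} * {set EV} * {set EV} * {ffun EV -> {ffun 'I_3 -> I}} *
  {ffun EV -> {ffun 'I_3 -> I}} * {ffun EV -> I * I} * (EV * EV))%type.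
Definition sF (s : shape) := s.1.1.1.1.1.1.
Definition sM (s : shape) := s.1.1.1.1.1.2.
Definition sU (s : shape) := s.1.1.1.1.2.
Definition sfe (s : shape) := s.1.1.1.2.
Definition sfv (s : shape) := s.1.1.2.
Definition sep (s : shape) := s.1.2.
Definition sb (s : shape) := s.2.

Definition sedge s f k : EV := (sfe s f k, k).
Definition svert s f k : EV := (sfv s f k, k).
Definition soth s f : seq EV := [:: sedge s f (nx f.2); sedge s f (pv f.2)].
Definition bnd s : seq EV := [:: (sb s).1; (sb s).2].

(** What is kept of [diag] for a boundary of two edges. The two end points of the boundary must stay
    outside [sU], which removes at most one of its elements and accounts for the extra 1 in
    [wf_euler]. *)
Record wfshape s : Prop := WF {
  wf_euler : #|sM s| <= #|sU s|.+1;
  wf_disj : forall e, e \in sF s -> e \in sM s -> False;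
  wf_order : exists F : seq EV, [/\ F =i sF s,
    forall F1 f F2, F = F1 ++ f :: F2 ->
      forall e, e \in soth s f -> e \in sM s \/ e \in F1
    & forall F1 f F2, F = F1 ++ f :: F2 ->
      f \in bnd s ++ flatten [seq soth s f | f <- F2]];
  wf_M : forall e, e \in sM s -> e \in bnd s \/ exists2 f, f \in sF s & e \in soth s f;
  wf_U : forall v, v \in sU s -> exists2 f, f \in sF s & v = svert s f f.2;
  wf_edge : forall f, f \in sF s -> sedge s f f.2 = f /\
    forall k, sep s (sedge s f k) = (sfv s f (nx k), sfv s f (pv k));
  wf_bnd : forall e, e \in bnd s -> [/\ e \in sM s \/ e \in sF s,
    exists2 f, f \in sF s & sedge s f e.2 = e,
    ((sep s e).1, nx e.2) \notin sU s & ((sep s e).2, pv e.2) \notin sU s] }.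

(* A decoration: the first position of the tetrahedron over each triangle, a label
   [ge e] such that [lb e] and [ge e] are two sides of a triangle, and a pair of
   labels at each vertex. *)
Definition config := ({ffun EV -> X} * {ffun EV -> X} * {ffun EV -> X * X})%type.

Section Config.
Variables (s : shape) (lb : EV -> X) (w : config).
Let wf := w.1.1. Let ge := w.1.2. Let cv := w.2.

Definition slab f : {ffun 'I_3 -> X} := [ffun k => lb (sedge s f k)].
Definition spos f : {ffun 'I_3 -> X} := posn S (slab f) (wf f).
Definition elab e : {ffun 'I_3 -> X} := ofedge S e.2 (lb e) (ge e).

Record goodc : Prop := GoodC {
  good_face : forall f, f \in sF s -> tet S (slab f) (spos f) /\ spos f ord0 = wf f;
  good_edge : forall f k, f \in sF s -> exists t p, [/\ tet S t p, t k = slab f k,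
    t (nx k) = ge (sedge s f k) & p (nx k) = spos f (nx k)];
  good_vert : forall f i, f \in sF s -> svert s f i \in sU s ->
    [/\ cone S i (spos f i) (elab (sedge s f (pv i)) (nx i)) (cv (svert s f i)).2,
        cone S i (spos f i) (cv (svert s f i)).1 (ge (sedge s f (nx i)))
      & cone S i (spos f i) (cv (svert s f i)).1 (cv (svert s f i)).2] }.

(** Images under the decoration: a corner in [sU] becomes two positions [dl1], [dl2] joined by the
    label [rr], and a side becomes two labels [lam1], [lam2] meeting at the position [bp]. A
    triangle thus turns into a closed path of up to nine labels. Since [rr] depends only on the
    vertex and [lam1], [lam2] only on the edge, neighbouring triangles share them. *)
Definition rr v := third S v.2 (cv v).1 (cv v).2.
Definition lam1 e := let v := ((sep s e).1, nx e.2) in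
  let m := elab e (pv e.2) in if v \in sU s then third S v.2 m (cv v).2 else m.
Definition lam2 e := let v := ((sep s e).2, pv e.2) in
  if v \in sU s then third S v.2 (cv v).1 (ge e) else ge e.
Definition dl1 f i :=
  if svert s f i \in sU s then lat3 S (pv i) (cv (svert s f i)).2 (spos f i) else spos f i.
Definition dl2 f i :=
  if svert s f i \in sU s then lat2 S (nx i) (cv (svert s f i)).1 (spos f i) else spos f i.
Definition bp f k := lat3 S (nx k) (ge (sedge s f k)) (spos f (pv k)).

Hypothesis gd : goodc.
Hypothesis ws : wfshape s.

Lemma edge_facts f k : f \in sF s ->
  [/\ Fc S (elab (sedge s f k)), elab (sedge s f k) k = lb (sedge s f k),
      elab (sedge s f k) (nx k) = ge (sedge s f k),
      Lat S (nx k) (ge (sedge s f k)) (spos f (pv k)) (bp f k)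
    & Lat S (pv k) (elab (sedge s f k) (pv k)) (bp f k) (spos f (nx k))].
Proof.
move=> Hf; have [t [p [tp Et1 Et2 Ep]]] := good_edge gd k Hf.
have [tf _] := good_face gd Hf.
have Ep2 : p (pv k) = spos f (pv k).
  have := tetL k tp; rewrite Et1 Ep => L1; exact: LatI3 L1 (tetL k tf).
have Ee : elab (sedge s f k) = t.
  rewrite -(ofedgeE k (tetF tp)) Et1 Et2 /elab; congr ofedge; by rewrite ffunE.
have Lb := tetLnx k tp; rewrite Et2 Ep2 in Lb.
have Eb : bp f k = p k by apply: lat3E.
rewrite Ee; split=> //; [exact: tetF tp|by rewrite Et1 ffunE|by rewrite Eb|].
by rewrite Eb -Ep; apply: tetLpv tp.
Qed.

Lemma vert_facts f i : f \in sF s -> svert s f i \in sU s ->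
  [/\ Lat S (pv i) (cv (svert s f i)).2 (spos f i) (dl1 f i),
      Lat S (nx i) (cv (svert s f i)).1 (dl2 f i) (spos f i)
    & Lat S i (rr (svert s f i)) (dl1 f i) (dl2 f i)].
Proof.
move=> Hf Hv; have [_ _ /coneP[t [p [tp Ep E1 E2]]]] := good_vert gd Hf Hv.
have L1 := tetLpv i tp; have L2 := tetLnx i tp; rewrite E2 Ep in L1; rewrite E1 Ep in L2.
have D1 : dl1 f i = p (nx i) by rewrite /dl1 Hv; apply: lat3E.
have D2 : dl2 f i = p (pv i) by rewrite /dl2 Hv; apply: lat2E.
rewrite D1 D2; split=> //; rewrite /rr /= -E1 -E2 thirdE ?(tetF tp) //.
exact: tetL tp.
Qed.

(** [relR], [relA] and [relB] are the steps of this closed path: across a corner, and from either of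
    its positions to that of the adjacent side. *)
Lemma relR f i : f \in sF s ->
  if svert s f i \in sU s then Lat S i (rr (svert s f i)) (dl1 f i) (dl2 f i)
  else dl1 f i == dl2 f i.
Proof.
move=> Hf; case: ifP => Hv; first by case: (vert_facts Hf Hv).
by rewrite /dl1 /dl2 Hv.
Qed.

Lemma relA f i : f \in sF s ->
  if svert s f i \in sU s then Lat S i (lam1 (sedge s f (pv i))) (dl1 f i) (bp f (pv i))
  else Lat S (nx i) (lam1 (sedge s f (pv i))) (bp f (pv i)) (dl1 f i).
Proof.
move=> Hf; have [_ _ _ _ Lb] := edge_facts (pv i) Hf; rewrite !I3E in Lb.
have [_ /(_ (pv i)) Eep] := wf_edge ws Hf.
rewrite /lam1 Eep /= !I3E -/(svert s f i); case: ifP => Hv; last by rewrite /dl1 Hv.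
have [/coneP[t [p [tp Ep E1 E2]]] _ _] := good_vert gd Hf Hv.
have [L1 _ _] := vert_facts Hf Hv.
have Ed : p (nx i) = dl1 f i.
  by have := tetLpv i tp; rewrite E2 Ep => L; apply: LatI3 L L1.
have Eb : p (pv i) = bp f (pv i).
  by have := tetLnx i tp; rewrite E1 Ep => L; apply: LatI2 L Lb.
by rewrite ?Hv -E1 -E2 thirdE ?(tetF tp) // -Ed -Eb; apply: tetL tp.
Qed.

Lemma relB f i : f \in sF s ->
  if svert s f i \in sU s then Lat S i (lam2 (sedge s f (nx i))) (bp f (nx i)) (dl2 f i)
  else Lat S (pv i) (lam2 (sedge s f (nx i))) (dl2 f i) (bp f (nx i)).
Proof.
move=> Hf; have [_ _ _ Lb _] := edge_facts (nx i) Hf; rewrite !I3E in Lb.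
have [_ /(_ (nx i)) Eep] := wf_edge ws Hf.
rewrite /lam2 Eep /= !I3E -/(svert s f i); case: ifP => Hv; last by rewrite /dl2 Hv.
have [_ /coneP[t [p [tp Ep E1 E2]]] _] := good_vert gd Hf Hv.
have [_ L2 _] := vert_facts Hf Hv.
have Ed : p (pv i) = dl2 f i.
  by have := tetLnx i tp; rewrite E1 Ep => L; apply: LatI2 L L2.
have Eb : p (nx i) = bp f (nx i).
  by have := tetLpv i tp; rewrite E2 Ep => L; apply: LatI3 L Lb.
by rewrite ?Hv -E1 -E2 thirdE ?(tetF tp) // -Ed -Eb; apply: tetL tp.
Qed.
End Config.

Variable x0 : X.

Definition params := ({ffun EV -> X * X} * {ffun EV -> X * X} * {ffun EV -> X * X})%type.
(** Compared with a decoration, a triangle carries two entries instead of one, an edge of [sM] two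
    instead of one, an edge naming a triangle none, and a vertex of [sU] one instead of two.
    Coordinates off the shape are copied, and [x0] is padding. *)
Definition param s lb (w : config) : params :=
  ([ffun f => if f \in sF s then (dl1 s lb w f f.2, bp s lb w f f.2) else (w.1.1 f, x0)],
   [ffun e => if e \in sM s then (lam1 s lb w e, lam2 s w e)
              else if e \in sF s then (x0, x0) else (w.1.2 e, x0)],
   [ffun v => if v \in sU s then (rr w v, x0) else w.2 v]).

(** * Recovering a decoration from its parameters *)

Section Inj.
Variables (s : shape) (lb lb' : EV -> X) (w w' : config).
Hypotheses (gd : goodc s lb w) (gd' : goodc s lb' w') (ws : wfshape s).
Hypothesis Ep : param s lb w = param s lb' w'.

Let Ef f : f \in sF s -> dl1 s lb w f f.2 = dl1 s lb' w' f f.2 /\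
  bp s lb w f f.2 = bp s lb' w' f f.2.
Proof.
move=> Hf; have := congr1 (fun q : params => q.1.1 f) Ep; rewrite !ffunE Hf.
by case.
Qed.
Let Ee e : e \in sM s -> lam1 s lb w e = lam1 s lb' w' e /\ lam2 s w e = lam2 s w' e.
Proof.
move=> He; have := congr1 (fun q : params => q.1.2 e) Ep; rewrite !ffunE He.
by case.
Qed.
Let Er v : v \in sU s -> rr w v = rr w' v.
Proof.
move=> Hv; have := congr1 (fun q : params => q.2 v) Ep; rewrite !ffunE Hv.
by case.
Qed.

Let same f i := dl1 s lb w f i = dl1 s lb' w' f i /\ dl2 s lb w f i = dl2 s lb' w' f i.

Let R12 f i : f \in sF s -> dl1 s lb w f i = dl1 s lb' w' f i -> same f i.
Proof.
move=> Hf E; split=> //; have := relR gd i Hf; have := relR gd' i Hf.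
case: ifP => Hv; last by move=> /eqP <- /eqP <-.
by rewrite E Er // => L' L; apply: LatI3 L L'.
Qed.
Let R21 f i : f \in sF s -> dl2 s lb w f i = dl2 s lb' w' f i -> same f i.
Proof.
move=> Hf E; split=> //; have := relR gd i Hf; have := relR gd' i Hf.
case: ifP => Hv; last by move=> /eqP -> /eqP ->.
by rewrite E Er // => L' L; apply: LatI2 L L'.
Qed.

(** Going outwards in [F], the labels of the two inner sides of a triangle are known. The path is
    followed both ways from [dl1 f f.2], and the given position [bp f f.2] then yields the two
    labels of the outer side. *)
Lemma param_up f : f \in sF s ->
  (forall i, dl1 s lb w f i = dl1 s lb' w' f i /\ dl2 s lb w f i = dl2 s lb' w' f i) /\
  (forall k, bp s lb w f k = bp s lb' w' f k).
Proof.
have [F [EF up _]] := wf_order ws.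
suff H : forall F1 F2, F = F1 ++ F2 -> forall f, f \in F1 ->
    [/\ (forall i, same f i), (forall k, bp s lb w f k = bp s lb' w' f k)
      & lam1 s lb w f = lam1 s lb' w' f /\ lam2 s w f = lam2 s w' f].
  by rewrite -EF => Hf; have [] := H F [::] (esym (cats0 F)) f Hf.
elim/last_ind => [|F1 g IH] // F2; rewrite -cats1 -catA => EF12 f'.
rewrite mem_cat inE => /orP[|/eqP->]; first exact: (IH _ EF12).
have Hg : g \in sF s by rewrite -EF EF12 mem_cat mem_head orbT.
have lamE e : e \in soth s g -> lam1 s lb w e = lam1 s lb' w' e /\ lam2 s w e = lam2 s w' e.
  case/(up _ _ _ EF12) => [|/(IH _ EF12)[]] //; exact: Ee.
have [l1 l2] := lamE _ (mem_head _ _).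
have [l3 l4] : lam1 s lb w (sedge s g (pv g.2)) = lam1 s lb' w' (sedge s g (pv g.2)) /\
    lam2 s w (sedge s g (pv g.2)) = lam2 s w' (sedge s g (pv g.2)).
  by apply: lamE; rewrite !inE eqxx orbT.
set i := g.2 in l1 l2 l3 l4 *.
have [Ed Eb] := Ef Hg; rewrite -/i in Ed Eb.
have si := R12 Hg Ed.
have b2 : bp s lb w g (pv i) = bp s lb' w' g (pv i).
  have := relA gd ws i Hg; have := relA gd' ws i Hg; rewrite -l3 -Ed.
  by case: ifP => _ L' L; [apply: LatI3 L L'|apply: LatI2 L L'].
have b1 : bp s lb w g (nx i) = bp s lb' w' g (nx i).
  have := relB gd ws i Hg; have := relB gd' ws i Hg; rewrite -l2 -si.2.
  by case: ifP => _ L' L; [apply: LatI2 L L'|apply: LatI3 L L'].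
have s1 : same g (nx i).
  apply: R21 => //; have := relB gd ws (nx i) Hg; have := relB gd' ws (nx i) Hg.
  rewrite !I3E -l4 -b2.
  by case: ifP => _ L' L; [apply: LatI3 L L'|apply: LatI2 L L'].
have s2 : same g (pv i).
  apply: R12 => //; have := relA gd ws (pv i) Hg; have := relA gd' ws (pv i) Hg.
  rewrite !I3E -l1 -b1.
  by case: ifP => _ L' L; [apply: LatI2 L L'|apply: LatI3 L L'].
have Egi : sedge s g i = g by case: (wf_edge ws Hg).
split; [exact: (I3_cases (i := i))|exact: (I3_cases (i := i))|split].
  have := relA gd ws (nx i) Hg; have := relA gd' ws (nx i) Hg.
  rewrite !I3E Egi -Eb -s1.1.
  by case: ifP => _ L' L; apply: LatI1 L L'.
have := relB gd ws (pv i) Hg; have := relB gd' ws (pv i) Hg.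
rewrite !I3E Egi -Eb -s2.2.
by case: ifP => _ L' L; apply: LatI1 L L'.
Qed.

Lemma param_lam e : e \in sM s \/ e \in sF s ->
  lam1 s lb w e = lam1 s lb' w' e /\ lam2 s w e = lam2 s w' e.
Proof.
case=> [/Ee //|He]; have [H1 H2] := param_up He; have [Ee' _] := wf_edge ws He.
set i := e.2 in Ee'; split.
  have := relA gd ws (nx i) He; have := relA gd' ws (nx i) He.
  rewrite !I3E Ee' (H1 _).1 H2.
  by case: ifP => _ L' L; apply: LatI1 L L'.
have := relB gd ws (pv i) He; have := relB gd' ws (pv i) He.
rewrite !I3E Ee' (H1 _).2 H2.
by case: ifP => _ L' L; apply: LatI1 L L'.
Qed.

(** The ends of a boundary edge are outside [sU], so [lam1] and [lam2] are two actual sides of the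
    triangle over it and determine the third, its label. *)
Lemma param_bnd e : e \in bnd s -> lb e = lb' e /\ w.1.2 e = w'.1.2 e.
Proof.
move=> He; have [MF [f Hf Efe] n1 n2] := wf_bnd ws He.
have [l1 l2] := param_lam MF; move: l1 l2.
rewrite /lam1 /lam2 (negPf n1) (negPf n2) => l1 l2; split=> //.
have [F1 A1 B1 _ _] := edge_facts gd e.2 Hf; have [F2 A2 B2 _ _] := edge_facts gd' e.2 Hf.
rewrite Efe in F1 A1 B1 F2 A2 B2.
suff E : elab lb w e = elab lb' w' e by rewrite -A1 -A2 E.
by apply: (@FcI _ S e.2) => //; rewrite B1 B2.
Qed.
End Inj.

Section InjDown.
Variables (s : shape) (lb : EV -> X) (w w' : config).
Hypotheses (gd : goodc s lb w) (gd' : goodc s lb w') (ws : wfshape s).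
Hypothesis Ep : param s lb w = param s lb w'.

Let known e := w.1.2 e = w'.1.2 e /\
  (let v := ((sep s e).1, nx e.2) in v \in sU s -> w.2 v = w'.2 v) /\
  (let v := ((sep s e).2, pv e.2) in v \in sU s -> w.2 v = w'.2 v).

Let step f : f \in sF s -> known f ->
  [/\ w.1.1 f = w'.1.1 f, (svert s f f.2 \in sU s -> w.2 (svert s f f.2) = w'.2 (svert s f f.2))
    & forall e, e \in soth s f -> known e].
Proof.
move=> Hf [_ [k1 k2]]; set i := f.2.
have [Efi Eep] := wf_edge ws Hf.
have [Ed Eb] := param_up gd gd' ws Ep Hf.
have [T1 Z1] := good_face gd Hf; have [T2 Z2] := good_face gd' Hf.
have E1 : sep s f = (sfv s f (nx i), sfv s f (pv i)) by rewrite -Eep -/i -{1}Efi.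
rewrite E1 /= in k1 k2.
have Ea : spos s lb w f = spos s lb w' f.
  apply: (tet_inj_pos (i := nx i) T1 T2).
  have := (Ed (nx i)).1; case: (boolP (svert s f (nx i) \in sU s)) => Hv; last by rewrite /dl1 (negPf Hv).
  have [L1 _ _] := vert_facts gd Hf Hv; have [L2 _ _] := vert_facts gd' Hf Hv.
  move=> Ed1; rewrite -Ed1 -(k1 Hv) in L2; exact: LatI2 L1 L2.
have Ew : w.1.1 f = w'.1.1 f by rewrite -Z1 -Z2 Ea.
have Ec j : svert s f j \in sU s -> w.2 (svert s f j) = w'.2 (svert s f j).
  move=> Hv; have [L1 M1 _] := vert_facts gd Hf Hv; have [L2 M2 _] := vert_facts gd' Hf Hv.
  rewrite -(Ed j).1 -(Ed j).2 -Ea in L2 M2.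
  have := LatI1 L1 L2; have := LatI1 M1 M2.
  by case: (w.2 _) (w'.2 _) => [a b] [a' b'] /= -> ->.
have Eg k : w.1.2 (sedge s f k) = w'.1.2 (sedge s f k).
  have [_ _ _ L1 _] := edge_facts gd k Hf; have [_ _ _ L2 _] := edge_facts gd' k Hf.
  by rewrite -Eb -Ea in L2; apply: LatI1 L1 L2.
split=> //; first exact: Ec.
have kk k : known (sedge s f k).
  by split; [exact: Eg|rewrite Eep /=; split; apply: (Ec (_ k))].
by move=> e; rewrite !inE => /orP[]/eqP->; apply: kk.
Qed.

(** Descent from the boundary: once the decoration is known at the edge naming a triangle and at its
    ends, the position over the triangle follows, and then its other edges and vertex. By [wf_order]
    every triangle is reached from the boundary or a later triangle. *)
Lemma param_inj : w = w'.
Proof.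
have [F [EF _ down]] := wf_order ws.
have kb e : e \in bnd s -> known e.
  move=> He; have [_ Eg] := param_bnd gd gd' ws Ep He; have [_ _ n1 n2] := wf_bnd ws He.
  by split=> //; split; rewrite /= ?(negPf n1) ?(negPf n2).
have kF : forall F2 F1, F = F1 ++ F2 -> forall f, f \in F2 -> known f.
  elim=> [|g F2 IH] // F1 EF12 f.
  have IH' := IH (rcons F1 g) _; rewrite cat_rcons in IH'; have {IH'} IH' := IH' EF12.
  rewrite inE => /orP[/eqP->|]; last exact: IH'.
  have := down _ _ _ EF12; rewrite mem_cat => /orP[/kb //|/flatten_mapP[h Hh]].
  have HhF : h \in sF s by rewrite -EF EF12 mem_cat inE Hh !orbT.
  by have [_ _] := step HhF (IH' _ Hh); apply.
have kF' f : f \in sF s -> known f by rewrite -EF; apply: (kF F [::]).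
have kM e : e \in sM s -> known e.
  case/(wf_M ws) => [/kb //|[f Hf He]].
  by have [_ _] := step Hf (kF' _ Hf); apply.
have E1 : w.1.1 = w'.1.1.
  apply/ffunP => f; case: (boolP (f \in sF s)) => Hf; first by have [] := step Hf (kF' _ Hf).
  have := congr1 (fun q : params => q.1.1 f) Ep; rewrite !ffunE (negPf Hf); by case.
have E2 : w.1.2 = w'.1.2.
  apply/ffunP => e; case: (boolP (e \in sM s)) => HM; first by have [] := kM _ HM.
  case: (boolP (e \in sF s)) => HF; first by have [] := kF' _ HF.
  have := congr1 (fun q : params => q.1.2 e) Ep; rewrite !ffunE (negPf HM) (negPf HF); by case.
have E3 : w.2 = w'.2.
  apply/ffunP => v; case: (boolP (v \in sU s)) => HU.
    have [f Hf Ev] := wf_U ws HU; have [_ + _] := step Hf (kF' _ Hf).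
    by rewrite -Ev; apply.
  have := congr1 (fun q : params => q.2 v) Ep; rewrite !ffunE (negPf HU); by [].
by case: w w' E1 E2 E3 => [[? ?] ?] [[? ?] ?] /= -> -> ->.
Qed.
End InjDown.

End Shape.

(** * Counting decorations over all pairs of boundary labels *)

Lemma card_family_prod (I T : finType) (B : I -> {set T}) :
  #|family B| = \prod_i #|B i|.
Proof. by rewrite card_family foldrE big_map enumT. Qed.

Lemma card_sigma (A B : finType) (P : pred A) (R : A -> {set B}) :
  #|[set z : A * B | P z.1 && (z.2 \in R z.1)]| = \sum_(a | P a) #|R a|.
Proof.
rewrite -sum1dep_card -(pair_big_dep P (fun a b => b \in R a) (fun _ _ => 1%N)) /=.
by apply: eq_bigr => a _; rewrite sum1_card.
Qed.

Section Count.
Variables (X : finType) (S : latin X) (I : finType) (x0 : X).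
Notation EV := (I * 'I_3)%type.
Notation shape := (shape I).
Let n := #|X|.
Let Q := #|{: EV}|.

Lemma card_fst_set : #|[set (x, x0) | x : X]| = n.
Proof. by rewrite card_imset // => x y []. Qed.

Definition psetf (s : shape) (f : EV) : {set X * X} :=
  if f \in sF s then setT else [set (x, x0) | x : X].
Definition psete (s : shape) (e : EV) : {set X * X} :=
  if e \in sM s then setT else if e \in sF s then [set (x0, x0)] else [set (x, x0) | x : X].
Definition psetv (s : shape) (v : EV) : {set X * X} :=
  if v \in sU s then [set (x, x0) | x : X] else setT.

Definition pset (s : shape) : {set params X I} :=
  setX (setX [set q in family (psetf s)] [set q in family (psete s)]) [set q in family (psetv s)].

Lemma param_in s lb w : param S x0 s lb w \in pset s.
Proof.
rewrite !in_setX !in_set /=; apply/andP; split; [apply/andP; split|]; apply/familyP => e; rewrite ffunE.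
- by rewrite /psetf; case: ifP => _; rewrite ?inE // imset_f.
- by rewrite /psete; case: ifP => _; [rewrite inE|case: ifP => _; rewrite ?inE // imset_f].
- by rewrite /psetv; case: ifP => _; rewrite ?inE // imset_f.
Qed.

Lemma sum_ind (P : {set EV}) : \sum_(e : EV) (e \in P : nat) = #|P|.
Proof. by rewrite -sum1_card [RHS]big_mkcond /=; apply: eq_bigr => e _; case: (e \in P). Qed.

(** The exponents add up to [4 * Q + #|sM s| - #|sU s|], the contributions of [sF s] from triangles
    and from edges cancelling; [wf_euler] bounds the difference by 1. *)
Lemma card_pset s : wfshape s -> #|pset s| <= n ^ (4 * Q).+1.
Proof.
move=> ws; rewrite !cardsX !cardsE !card_family_prod.
have n2 : #|[set: X * X]| = n ^ 2 by rewrite cardsT card_prod mulnn.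
have -> : \prod_f #|psetf s f| = n ^ (\sum_f (1 + (f \in sF s))).
  rewrite expn_sum; apply: eq_bigr => f _; rewrite /psetf.
  by case: ifP => _; rewrite ?n2 // card_fst_set.
have -> : \prod_e #|psete s e| =
    n ^ (\sum_e (if e \in sM s then 2 else if e \in sF s then 0 else 1)).
  rewrite expn_sum; apply: eq_bigr => e _; rewrite /psete.
  by case: ifP => _; [rewrite n2|case: ifP => _; rewrite ?cards1 // card_fst_set].
have -> : \prod_v #|psetv s v| = n ^ (\sum_v (if v \in sU s then 1 else 2)).
  rewrite expn_sum; apply: eq_bigr => e _; rewrite /psetv.
  by case: ifP => _; rewrite ?n2 // card_fst_set.
have E1 : \sum_f (1 + (f \in sF s)) = Q + #|sF s| by rewrite big_split /= sum_ind sum1_card.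
have E2 : \sum_e (if e \in sM s then 2 else if e \in sF s then 0 else 1) + #|sF s| = Q + #|sM s|.
  rewrite -!sum_ind /Q -sum1_card -!big_split /=; apply: eq_bigr => e _.
  case: (boolP (e \in sM s)) => HM; case: (boolP (e \in sF s)) => HF //.
  by case: (wf_disj ws HF HM).
have E3 : \sum_v (if v \in sU s then 1 else 2) + #|sU s| = 2 * Q.
  rewrite -!sum_ind /Q -sum1_card big_distrr /= -!big_split /=; apply: eq_bigr => e _.
  by case: ifP.
rewrite -!expnD; have := wf_euler ws; move: E1 E2 E3.
case: (posnP n) => [n0 E1 E2 E3 _|n0 E1 E2 E3 We].
  by have := fintype0 x0 n0.
by apply: leq_pexp2l => //; lia.
Qed.

Variables (Pr : {set X * X}) (sh : X * X -> shape) (lb : X * X -> EV -> X)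
  (Wg : X * X -> {set config X I}).
Hypothesis Pr_wf : forall p, p \in Pr -> wfshape (sh p).
Hypothesis Pr_lb : forall p, p \in Pr -> lb p (sb (sh p)).1 = p.1 /\ lb p (sb (sh p)).2 = p.2.
Hypothesis Pr_good : forall p w, p \in Pr -> w \in Wg p -> goodc S (sh p) (lb p) w.

(** A shape and its parameters determine the boundary labels, that is the pair; this fixes the
    labelling [lb p], and then [param_inj] gives the decoration. *)
Lemma pairs_bound : \sum_(p in Pr) #|Wg p| <= #|{: shape}| * n ^ (4 * Q).+1.
Proof.
pose Z := [set z : (X * X) * config X I | (z.1 \in Pr) && (z.2 \in Wg z.1)].
have -> : \sum_(p in Pr) #|Wg p| = #|Z|.
  by rewrite /Z (card_sigma (mem Pr)).
pose fn (z : (X * X) * config X I) := (sh z.1, param S x0 (sh z.1) (lb z.1) z.2).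
pose T := [set y : shape * params X I | `[< wfshape y.1 >] && (y.2 \in pset y.1)].
have fT : fn @: Z \subset T.
  apply/subsetP => _ /imsetP[[p w] + ->]; rewrite !inE /= => /andP[Hp _].
  apply/andP; split; [by apply/asboolP; apply: Pr_wf|].
  by have := param_in (sh p) (lb p) w; rewrite !inE.
rewrite -(card_in_imset (f := fn)); last first.
  move=> [p w] [p' w']; rewrite !inE /= => /andP[Hp Hw] /andP[Hp' Hw'] Efn.
  have Es : sh p = sh p' := congr1 fst Efn.
  have Ep : param S x0 (sh p) (lb p) w = param S x0 (sh p') (lb p') w' := congr1 snd Efn.
  have ws := Pr_wf Hp; have g := Pr_good Hp Hw; have g' := Pr_good Hp' Hw'.
  rewrite -Es in g' Ep.
  have b1 : (sb (sh p)).1 \in bnd (sh p) by rewrite mem_head.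
  have b2 : (sb (sh p)).2 \in bnd (sh p) by rewrite !inE eqxx orbT.
  have Epp : p = p'.
    have [E1 _] := param_bnd g g' ws Ep b1; have [E2 _] := param_bnd g g' ws Ep b2.
    move: (Pr_lb Hp) (Pr_lb Hp') E1 E2; rewrite -Es => -[-> ->] [-> ->].
    by case: p p' {Hp Hw Hp' Hw' Es ws g g' Ep b1 b2 Efn} => [? ?] [? ?] /= -> ->.
  by subst p'; rewrite (param_inj g g' ws Ep).
apply: leq_trans (subset_leq_card fT) _.
have -> : #|T| = \sum_(s : shape | `[< wfshape s >]) #|pset s|.
  by rewrite /T (card_sigma (fun s : shape => `[< wfshape s >]) pset).
rewrite -sum_nat_const; apply: leq_trans (_ : \sum_(s : shape | `[< wfshape s >]) n ^ (4 * Q).+1 <= _).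
  by apply: leq_sum => s /asboolP; apply: card_pset.
by rewrite big_mkcond; apply: leq_sum => s _; case: ifP.
Qed.
End Count.

(** * From a diagram between two labels to its shape *)

(** One identifier serves as the base point [v0], and [null_diag] needs [2 * k + 2] others. *)
Lemma null_shape (X I : finType) (A : {set {ffun 'I_3 -> X}}) k i l l' :
  2 * k + 3 <= #|I| -> l <> l' ->
  lnull A k [:: (i, l, true); (i, l', false)] ->
  exists (s : shape I) (lb : I * 'I_3 -> X), [/\ wfshape s,
    forall f, f \in sF s -> slab s lb f \in A,
    lb (sb s).1 = l /\ lb (sb s).2 = l' & (sb s).1.2 = i].
Proof.
move=> cI nll H.
have : 2 * k + 3 <= size (enum I) by rewrite -cardE.
have := enum_uniq I; case: (enum I) => [|v0 fr] /=; first by rewrite addnS.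
move=> /andP[nv0 ufr] sfr.
have ty : typed (nx i) (nx i) [:: (i, l, true); (i, l', false)] by rewrite /= /src /tgt /= !eqxx.
have sz : 2 * k + size [:: (i, l, true); (i, l', false)] <= size fr by move: sfr => /=; clear; lia.
pose D0 (e : I * 'I_3) := EInfo l v0 v0 [ffun _ => v0] [ffun _ => v0].
have [D [P [F [M [U [EP dg]]]]]] := null_diag D0 H ty ufr nv0 sz.
case: P EP dg => [|[[a1 e1] u0] [|[[a2 e2] v1] [|? ?]]] // [E1 E2] dg; subst a1 a2.
have Eu0 : u0 = v0 by have := dg_head dg.
subst u0.
have [[/= lab1 [p1 q1] [lab2 [q2 p2] _]]] := dg_tok dg; rewrite /tedge /= in lab1 lab2 p1 q1 p2 q2.
have edges : [seq tedge s | s <- [:: ((i, l, true), e1, v0); ((i, l', false), e2, v1)]] = [:: (e1, i); (e2, i)] by [].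
have nU u j : (u, j) \in U -> u \in fr by move=> Hu; apply: (dg_Uids dg); apply: (map_f fst Hu).
(* The second boundary vertex is taken out of [U]; the first one, [v0], was never in the pool. *)
pose s : shape I := ([set x in F], [set x in M], [set x in U] :\ (v1, pv i),
   [ffun f => fe (D f)], [ffun f => fv (D f)], [ffun e => (ep1 (D e), ep2 (D e))],
   ((e1, i), (e2, i))).
have sE f k' : sedge s f k' = fedge D f k' by rewrite /sedge /sfe /= ffunE.
have pE e : sep s e = (ep1 (D e), ep2 (D e)) by rewrite /sep /= ffunE.
have oE f : soth s f = oth D f by rewrite /soth !sE.
have ooE (G : seq (I * 'I_3)) : [seq soth s f | f <- G] = [seq oth D f | f <- G].
  by apply: eq_map => f; rewrite oE.
exists s, (fun e => lab (D e)); split=> //; last first.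
  move=> f; rewrite inE => /(dg_face dg) [_ _ Hf].
  by have -> : slab s (fun e => lab (D e)) f = flab D f by apply/ffunP => j; rewrite !ffunE sE.
have uMF := dg_uniq dg; rewrite cat_uniq in uMF; case/and3P: uMF => uM dMF uF.
split.
- rewrite /sM /sU /=.
  have cM : #|[set x in M]| = size M by rewrite cardsE; apply/card_uniqP.
  have cU : #|[set x in U]| = size U by rewrite cardsE; apply/card_uniqP/(dg_Uuniq dg).
  move: cU; rewrite (cardsD1 (v1, pv i)) cM -(dg_Usize dg) => <-.
  by case: (_ \in _).
- by move=> e; rewrite !inE => He; apply/negP; move/hasPn: dMF => /(_ _ He).
- exists F; split=> [f|F1 f F2 EF e|F1 f F2 EF]; first by rewrite inE.
    by rewrite oE => /(dg_up dg EF); rewrite mem_cat inE => /orP[->|->]; [left|right].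
  by have := dg_down dg EF; rewrite edges ooE.
- move=> e; rewrite inE => /(dg_twice dg); rewrite edges count_cat => c2.
  have : e \in [:: (e1, i); (e2, i)] ++ flatten [seq oth D f | f <- F].
    by rewrite -has_pred1 has_count count_cat; apply: leq_trans c2.
  rewrite mem_cat => /orP[He|/flatten_mapP[f Hf He]]; [by left|right].
  by exists f; [rewrite inE|rewrite oE].
- move=> [u j]; rewrite !inE => /andP[ne /[dup] Hu /(dg_Ureach dg)].
  case=> [|[f Hf ->]]; last by exists f; [rewrite inE|rewrite /svert /sfv /= ffunE].
  rewrite /= !inE (negPf ne) orbF => /eqP[Eu _].
  by move: nv0; rewrite -Eu (nU _ _ Hu).
- move=> f; rewrite inE => /(dg_face dg) [Ef Eep _]; split.
    by rewrite sE /fedge Ef -surjective_pairing.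
  by move=> j; rewrite sE /sep /sfv /= !ffunE; have [-> ->] := Eep j.
- have nv0U : (v0, nx i) \notin sU s.
    by rewrite !inE negb_and; apply/orP; right; apply: contra nv0; apply: nU.
  have nv1U : (v1, pv i) \notin sU s by rewrite !inE eqxx.
  (* As the boundary edges differ, a closed edge occurs only once on the boundary, and its second
     occurrence required by [dg_twice] is on a triangle. *)
  have ne12 : (e1, i) <> (e2, i) by move=> E; apply: nll; rewrite -lab1 -lab2 E.
  move=> e He; have He' : e \in [:: (e1, i); (e2, i)] by [].
  have eMF : e \in M ++ F by apply: (dg_bound dg); rewrite edges.
  split.
  + by move: eMF; rewrite mem_cat => /orP[H1|H1]; [left|right]; rewrite inE.
  + case: (boolP (e \in F)) => HF.
      exists e; rewrite ?inE // sE /fedge; have [-> _ _] := dg_face dg HF.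
      by rewrite -surjective_pairing.
    have HM : e \in M by move: eMF; rewrite mem_cat (negPf HF) orbF.
    have := dg_twice dg HM; rewrite edges count_cat.
    case: (posnP (count_mem e (flatten [seq oth D f | f <- F]))) => [->|].
      have un : uniq [:: (e1, i); (e2, i)] by rewrite /= inE andbT; apply/eqP.
      by rewrite (count_uniq_mem _ un) He'.
    rewrite -has_count has_pred1 => /flatten_mapP[f Hf Ho] _.
    exists f; rewrite ?inE // sE; move: Ho.
    by rewrite /oth !inE => /orP[]/eqP->.
  + by rewrite pE; move: He'; rewrite mem_seq2 => /orP[]/eqP->; rewrite ?p1 ?p2.
  + by rewrite pE; move: He'; rewrite mem_seq2 => /orP[]/eqP->; rewrite ?q1 ?q2.
Qed.

(** * Abundance of decorations *)

Section FinBounds.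
Variable R : realFieldType.
Local Open Scope ring_scope.

Lemma family_lb (I T : finType) (B : I -> {set T}) (m : R) : 0 <= m ->
  (forall i, m <= #|B i|%:R) -> m ^+ #|I| <= #|[set w in family B]|%:R.
Proof.
move=> m0 H; rewrite cardsE card_family_prod natr_prod -prodr_const.
by apply: ler_prod => i _; rewrite m0 H.
Qed.

Lemma setD_cover_lb (T J : finType) (G : {set T}) (B : J -> {set T}) (a e : R) :
  a <= #|G|%:R -> (forall j, #|B j|%:R <= e) ->
  a - #|J|%:R * e <= #|G :\: \bigcup_j B j|%:R.
Proof.
move=> aG Be; rewrite lerBlDr.
have H : (#|G| <= #|G :\: \bigcup_j B j| + #|\bigcup_j B j|)%N.
  by rewrite -(cardsID (\bigcup_j B j) G) addnC leq_add2l subset_leq_card // subsetIr.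
apply: le_trans aG _; apply: le_trans (_ : (#|G :\: \bigcup_j B j| + #|\bigcup_j B j|)%:R <= _).
  by rewrite ler_nat.
rewrite natrD lerD2l; apply: le_trans (_ : (\sum_j #|B j|)%:R <= _).
  rewrite ler_nat; elim/big_rec2: _ => [|j x y _ H']; first by rewrite cards0.
  by apply: leq_trans (leq_card_setU _ _).1 _; rewrite leq_add2l.
rewrite natr_sum; apply: le_trans (ler_sum _ (fun j _ => Be j)) _.
by rewrite sumr_const mulr_natl.
Qed.

Lemma card_inj_le (T U : finType) (A : {set T}) (B : {set U}) (f : T -> U) :
  {in A &, injective f} -> (forall x, x \in A -> f x \in B) -> (#|A| <= #|B|)%N.
Proof.
move=> fi fB; rewrite -(card_in_imset fi); apply: subset_leq_card.
by apply/subsetP => _ /imsetP[x Hx ->]; apply: fB.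
Qed.
End FinBounds.

Section Sample.
Variables (X : finType) (S : latin X) (I : finType).
Notation EV := (I * 'I_3)%type.
Variables (g : {ffun 'I_3 -> X}) (c : {ffun 'I_3 -> X * X}).

(** [x] can be the second label at an edge [l] of a triangle having [al] as its position of kind
    [nx k], in a way compatible with the sampled pairs [c] at both ends. *)
Definition accE k l al x := [exists t, exists p,
  [&& tet S t p, t k == l, t (nx k) == x, p (nx k) == al,
      cone S (nx k) (p (nx k)) (t (pv k)) (c (nx k)).2
    & cone S (pv k) (p (pv k)) (c (pv k)).1 (t (nx k))]].
Lemma accEP k l al x : reflect (exists t p, [/\ tet S t p, t k = l, t (nx k) = x, p (nx k) = al
    & cone S (nx k) (p (nx k)) (t (pv k)) (c (nx k)).2 /\
      cone S (pv k) (p (pv k)) (c (pv k)).1 (t (nx k))]) (accE k l al x).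
Proof.
apply: (iffP existsP) => [[t /existsP[p /and5P[H /eqP<- /eqP<- /eqP<- /andP[H1 H2]]]]|].
  by exists t, p.
by case=> t [p [H <- <- <- [H1 H2]]]; exists t; apply/existsP; exists p; rewrite H !eqxx H1 H2.
Qed.

(* The sample [g], [c] accepts the tetrahedron [(t, a)] as a part of decorations. *)
Definition wt (t a : {ffun 'I_3 -> X}) := [&& tet S t a,
  [forall k, accE k (t k) (a (nx k)) (g k)] & [forall i, cone S i (a i) (c i).1 (c i).2]].

Definition commE k (Sf : {set EV}) l (al : {ffun EV -> X}) : {set X} :=
  [set x | [forall f in Sf, accE k l (al f) x]].
Definition accV i (P : {set EV * EV * EV}) (al mu : {ffun EV -> X}) (cc : X * X) :=
  [forall z in P, [&& cone S i (al z.1.1) (mu z.1.2) cc.2, cone S i (al z.1.1) cc.1 (mu z.2)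
    & cone S i (al z.1.1) cc.1 cc.2]].
Definition commV i P al mu : {set X * X} := [set cc | accV i P al mu cc].

Variable R : realFieldType.
Local Open Scope ring_scope.
Let n : R := #|X|%:R.
Let Q := #|{: EV}|.

(** The bad event of dependent random choice: the sampled label is accepted by all triangles in
    [Sf], although few labels are. A random sample rarely falls into so small a set. *)
Definition badE (gE : R) k Sf l : {set {ffun EV -> X}} :=
  [set al | (g k \in commE k Sf l al) && (#|commE k Sf l al|%:R < gE * n)].
Definition badV (gV : R) i P : {set {ffun EV -> X} * {ffun EV -> X}} :=
  [set z | (c i \in commV i P z.1 z.2) && (#|commV i P z.1 z.2|%:R < gV * n ^+ 2)].

Variables (s : shape I) (lb : EV -> X) (cF th gE be gV : R).
Hypothesis H1 : forall f, f \in sF s -> cF * n <= #|[set a | wt (slab s lb f) a]|%:R.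
Hypothesis H2 : forall f k Sf, f \in sF s -> #|badE gE k Sf (slab s lb f k)|%:R <= th * n ^+ Q.
Hypothesis H3 : forall i P, #|badV gV i P|%:R <= be * n ^+ (2 * Q).
Hypotheses (cF0 : 0 <= cF) (cF1 : cF <= 1) (gE0 : 0 <= gE) (gE1 : gE <= 1) (gV0 : 0 <= gV)
  (th0 : 0 <= th).
Hypothesis Hth : Q%:R * th <= cF ^+ Q / 2.
Hypothesis Hbe : Q%:R * be <= cF ^+ Q * gE ^+ Q / 4.

Let n0 : 0 <= n. Proof. exact: ler0n. Qed.
Let pos (w : {ffun EV -> X}) f := posn S (slab s lb f) (w f).
Let sposE w ge cv f : spos S s lb (w, ge, cv) f = pos w f. Proof. by []. Qed.

Let B1 f : {set X} := if f \in sF s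
  then [set x | wt (slab s lb f) (posn S (slab s lb f) x) && (posn S (slab s lb f) x ord0 == x)]
  else setT.
Let G1 : {set {ffun EV -> X}} := [set w in family B1].

Let G1P w f : w \in G1 -> f \in sF s -> wt (slab s lb f) (pos w f) /\ pos w f ord0 = w f.
Proof.
rewrite inE => /familyP/(_ f) + Hf; rewrite /B1 Hf inE => /andP[H /eqP E]; by split.
Qed.

Let G1_card : (cF * n) ^+ Q <= #|G1|%:R.
Proof.
apply: family_lb => [|f]; first exact: mulr_ge0.
rewrite /B1; case: ifP => Hf; last by rewrite cardsT -[leRHS]mul1r ler_wpM2r.
apply: le_trans (H1 Hf) _; rewrite ler_nat.
apply: (card_inj_le (f := fun a : {ffun 'I_3 -> X} => a ord0)).
  by move=> a a'; rewrite !inE => /and3P[T _ _] /and3P[T' _ _]; apply: tet_inj_pos T T'.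
move=> a; rewrite !inE => H; have /and3P[T _ _] := H.
by rewrite (posnE T) H eqxx.
Qed.

Let Inc (e : EV) : {set EV} := [set f in sF s | sedge s f e.2 == e].
(** The values of [w] are kept off the shape so that the map is injective on [G1]. *)
Let ale k (w : {ffun EV -> X}) : {ffun EV -> X} := [ffun f => if f \in sF s then pos w f k else w f].

Let ale_inj k : {in G1 &, injective (ale k)}.
Proof.
move=> w w' Hw Hw' /ffunP E; apply/ffunP => f; have := E f; rewrite !ffunE.
case: ifP => // Hf Ep.
have [/and3P[T _ _] <-] := G1P Hw Hf; have [/and3P[T' _ _] <-] := G1P Hw' Hf.
by rewrite (tet_inj_pos T T' Ep).
Qed.

Let B2 w (e : EV) : {set X} := commE e.2 (Inc e) (lb e) (ale (nx e.2) w).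
Let bad1 e : {set {ffun EV -> X}} := [set w in G1 | #|B2 w e|%:R < gE * n].

Let incP e f : f \in Inc e -> f \in sF s /\ lb e = slab s lb f e.2.
Proof. by rewrite inE => /andP[Hf /eqP E]; split=> //; rewrite ffunE E. Qed.

(** Tetrahedra accepted by the sample all accept the label [g e.2], so a shortage of labels at [e]
    is an event counted by [badE]. *)
Let bad1_card e : #|bad1 e|%:R <= th * n ^+ Q.
Proof.
case: (set_0Vmem (Inc e)) => [E0|[f Hf]].
  rewrite (_ : bad1 e = set0) ?cards0 ?mulr_ge0 ?exprn_ge0 //.
  apply/setP => w; rewrite !inE; apply/negbTE; rewrite negb_and -leNgt; apply/orP; right.
  have -> : B2 w e = setT.
    by apply/setP => x; rewrite !inE E0; apply/forall_inP => f; rewrite inE.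
  by rewrite cardsT -[leRHS]mul1r ler_wpM2r.
have [Hf' El] := incP Hf.
apply: le_trans (H2 e.2 (Inc e) Hf'); rewrite ler_nat.
apply: (card_inj_le (f := ale (nx e.2))).
  by move=> w w'; rewrite !inE => /andP[Hw _] /andP[Hw' _]; apply: ale_inj; rewrite inE.
move=> w; rewrite !inE -El => /andP[Hw ->]; rewrite andbT.
apply/forall_inP => f' /incP[Hf2 El2].
have HwG : w \in G1 by rewrite inE.
have [/and3P[_ /forallP/(_ e.2) + _] _] := G1P HwG Hf2.
by rewrite -El2 ffunE Hf2.
Qed.

Let G1' := G1 :\: \bigcup_e bad1 e.
Let G1'_card : cF ^+ Q / 2 * n ^+ Q <= #|G1'|%:R.
Proof.
apply: le_trans (setD_cover_lb G1_card bad1_card).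
rewrite exprMn mulrA -mulrBl ler_wpM2r ?exprn_ge0 //.
by move: Hth; rewrite -/Q; move: (cF ^+ Q) (Q%:R * th) => u v; lra.
Qed.
Let G1'P w : w \in G1' -> w \in G1 /\ forall e, gE * n <= #|B2 w e|%:R.
Proof.
rewrite in_setD => /andP[nb HG]; split=> // e; rewrite leNgt; apply: contra nb => Hb.
by apply/bigcupP; exists e => //; rewrite in_set HG.
Qed.

Let G2 : {set {ffun EV -> X} * {ffun EV -> X}} :=
  [set z | (z.1 \in G1') && (z.2 \in [set ge in family (B2 z.1)])].
Let G2_card : cF ^+ Q / 2 * gE ^+ Q * n ^+ (2 * Q) <= #|G2|%:R.
Proof.
rewrite /G2 (card_sigma (mem G1') (fun w => [set ge in family (B2 w)])) natr_sum.
apply: le_trans (_ : \sum_(w in G1') (gE * n) ^+ Q <= _); last first.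
  by apply: ler_sum => w /G1'P[_ Hw]; apply: family_lb => //; apply: mulr_ge0.
rewrite sumr_const -[leRHS]mulr_natl exprMn mul2n -addnn exprD.
apply: le_trans (ler_wpM2r (mulr_ge0 (exprn_ge0 Q gE0) (exprn_ge0 Q n0)) G1'_card).
by rewrite le_eqVlt; apply/orP; left; apply/eqP; ring.
Qed.

Let elb (ge : {ffun EV -> X}) e := ofedge S e.2 (lb e) (ge e).
(** At a corner of kind [i], the side of kind [pv i] contributes the third label of the triangle
    over it and the side of kind [nx i] the label [ge]. Either one determines [ge], so counts of bad
    values transfer. *)
Let muv i (ge : {ffun EV -> X}) : {ffun EV -> X} :=
  [ffun e : EV => if (Inc e != set0) && (e.2 == pv i) then elb ge e (nx i) else ge e].
Let Inc2 (v : EV) : {set EV} := [set f in sF s | svert s f v.2 == v].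
Let Pv (v : EV) : {set EV * EV * EV} :=
  [set (f, sedge s f (pv v.2), sedge s f (nx v.2)) | f in Inc2 v].

Let G2P z f k : z \in G2 -> f \in sF s -> exists t p, [/\ tet S t p, t k = slab s lb f k,
  t (nx k) = z.2 (sedge s f k), p =1 pos z.1 f \/ (p (nx k) = pos z.1 f (nx k) /\ p (pv k) = pos z.1 f (pv k))
  & [/\ elb z.2 (sedge s f k) = t, cone S (nx k) (pos z.1 f (nx k)) (t (pv k)) (c (nx k)).2 &
      cone S (pv k) (pos z.1 f (pv k)) (c (pv k)).1 (t (nx k))]].
Proof.
rewrite inE => /andP[/G1'P[HG _]]; rewrite inE => /familyP/(_ (sedge s f k)) + Hf.
rewrite inE => /forall_inP/(_ f); rewrite inE Hf eqxx ffunE Hf => /(_ isT).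
case/accEP=> t [p [tp Et1 Et2 Ep [C1 C2]]].
have [/and3P[T _ _] _] := G1P HG Hf.
have Et1' : t k = slab s lb f k by rewrite ffunE.
have Ep2 : p (pv k) = pos z.1 f (pv k).
  have := tetL k tp; rewrite Et1' Ep => L1; exact: LatI3 L1 (tetL k T).
exists t, p; split=> //; first by right.
split; [|by rewrite -Ep|by rewrite -Ep2].
rewrite /elb -[in RHS](ofedgeE k (tetF tp)) Et1' Et2; congr ofedge; by rewrite ffunE.
Qed.

Let inc_ne f k : f \in sF s -> Inc (sedge s f k) != set0.
Proof. by move=> Hf; apply/set0Pn; exists f; rewrite inE Hf eqxx. Qed.

Let pvnx_ne i : (nx i == pv i) = false.
Proof. by case: i => [[|[|[|]]]]. Qed.

Let muE1 i ge f : f \in sF s -> muv i ge (sedge s f (pv i)) = elb ge (sedge s f (pv i)) (nx i).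
Proof. by move=> Hf; rewrite ffunE inc_ne //= eqxx. Qed.
Let muE2 i ge f : muv i ge (sedge s f (nx i)) = ge (sedge s f (nx i)).
Proof. by rewrite ffunE /= pvnx_ne andbF. Qed.

Let B3 (z : {ffun EV -> X} * {ffun EV -> X}) (v : EV) : {set X * X} :=
  commV v.2 (Pv v) (ale v.2 z.1) (muv v.2 z.2).
Let bad2 v := [set z in G2 | #|B3 z v|%:R < gV * n ^+ 2].

Let bad2_card v : #|bad2 v|%:R <= be * n ^+ (2 * Q).
Proof.
apply: le_trans (H3 v.2 (Pv v)); rewrite ler_nat.
apply: (card_inj_le (f := fun z => (ale v.2 z.1, muv v.2 z.2))).
  move=> [w ge] [w' ge']; rewrite inE => /andP[Hz _]; rewrite inE => /andP[Hz' _] [Ea Em].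
  have HG : w \in G1 by move: Hz; rewrite inE => /andP[/G1'P[]].
  have HG' : w' \in G1 by move: Hz'; rewrite inE => /andP[/G1'P[]].
  congr pair; first exact: ale_inj Ea.
  apply/ffunP => e; have /ffunP/(_ e) := Em; rewrite !ffunE.
  case: ifP => // /andP[/set0Pn[f]]; rewrite inE => /andP[Hf /eqP <-] /eqP Ek.
  set k := e.2 in Ek *.
  have [t [p [tp Et1 Et2 _ [-> _ _]]]] := G2P k Hz Hf.
  have [t' [p' [tp' Et1' Et2' _ [-> _ _]]]] := G2P k Hz' Hf.
  rewrite /= in Et2 Et2' => Enx; rewrite -Et2 -Et2'.
  suff -> : t = t' by [].
  apply: (@FcI _ S v.2) => //; rewrite ?(tetF tp) ?(tetF tp') //.
  by rewrite -Ek Et1 Et1'.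
move=> z; rewrite [z \in bad2 v]inE => /andP[Hz few]; rewrite inE /=.
apply/andP; split=> //.
rewrite inE; apply/forall_inP => _ /imsetP[f + ->]; rewrite inE => /andP[Hf _] /=.
have HG : z.1 \in G1 by move: Hz; rewrite inE => /andP[/G1'P[]].
set i := v.2.
rewrite muE1 // muE2 ffunE Hf.
have [t [p [_ _ _ _ [-> C1 _]]]] := G2P (pv i) Hz Hf; rewrite !I3E in C1.
have [t' [p' [_ _ Et' _ [_ _ C2]]]] := G2P (nx i) Hz Hf; rewrite Et' !I3E in C2.
have [/and3P[_ _ /forallP/(_ i) C3] _] := G1P HG Hf.
by rewrite C1 C2 C3.
Qed.

Let G3 := G2 :\: \bigcup_v bad2 v.
Let G3_card : cF ^+ Q * gE ^+ Q / 4 * n ^+ (2 * Q) <= #|G3|%:R.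
Proof.
apply: le_trans (setD_cover_lb G2_card bad2_card).
rewrite -/Q mulrA -mulrBl ler_wpM2r ?exprn_ge0 //.
have -> : cF ^+ Q / 2 * gE ^+ Q = cF ^+ Q * gE ^+ Q / 2 by ring.
by move: Hbe; move: (cF ^+ Q * gE ^+ Q) (Q%:R * be) => u v; lra.
Qed.
Let G3P z : z \in G3 -> z \in G2 /\ forall v, gV * n ^+ 2 <= #|B3 z v|%:R.
Proof.
rewrite in_setD => /andP[nb HG]; split=> // e; rewrite leNgt; apply: contra nb => Hb.
by apply/bigcupP; exists e => //; rewrite in_set HG.
Qed.

(** Positions, edge labels and vertex pairs are chosen in this order. After each of the first two
    layers, the choices leaving too little room for the next one are discarded, at the price of a
    factor 2 each. *)
Lemma good_configs : exists Wg : {set config X I},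
  (forall w, w \in Wg -> goodc S s lb w) /\
  cF ^+ Q * gE ^+ Q * gV ^+ Q / 4 * n ^+ (4 * Q) <= #|Wg|%:R.
Proof.
exists [set w : config X I | (w.1 \in G3) && (w.2 \in [set cv in family (B3 w.1)])]; split; last first.
  rewrite (card_sigma (mem G3) (fun z => [set cv in family (B3 z)])) natr_sum.
  apply: le_trans (_ : \sum_(w in G3) (gV * n ^+ 2) ^+ Q <= _); last first.
    by apply: ler_sum => w /G3P[_ Hw]; apply: family_lb => //; rewrite mulr_ge0 ?exprn_ge0.
  rewrite sumr_const -[leRHS]mulr_natl exprMn -exprM -[4%N]/(2 + 2)%N mulnDl exprD.
  apply: le_trans (ler_wpM2r (mulr_ge0 (exprn_ge0 Q gV0) (exprn_ge0 (2 * Q) n0)) G3_card).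
  by rewrite le_eqVlt; apply/orP; left; apply/eqP; ring.
move=> [[w ge] cv]; rewrite inE /= => /andP[/G3P[Hz _] Hcv].
have HG : w \in G1 by move: Hz; rewrite inE => /andP[/G1'P[]].
split=> /=.
- move=> f Hf; have [/and3P[T _ _] E] := G1P HG Hf; by rewrite sposE.
- move=> f k Hf; have [t [p [tp E1 E2 E3 _]]] := G2P k Hz Hf.
  by exists t, p; split=> //; rewrite sposE; case: E3 => [->|[-> _]].
- move=> f i Hf Hv; rewrite sposE.
  move: Hcv; rewrite inE => /familyP/(_ (svert s f i)); rewrite !inE.
  move=> /forall_inP/(_ (f, sedge s f (pv i), sedge s f (nx i))).
  have -> : (f, sedge s f (pv i), sedge s f (nx i)) \in Pv (svert s f i).
    by apply/imsetP; exists f => //; rewrite inE Hf eqxx.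
  move=> /(_ isT) /=; rewrite muE1 // muE2 ffunE Hf => /and3P[C1 C2 C3].
  by split.
Qed.
End Sample.

(** * Choice of the sample *)

Section Moments.
Variable R : realFieldType.
Local Open Scope ring_scope.

Lemma sum_sqr_le (J : finType) (a : J -> R) :
  (\sum_j a j) ^+ 2 <= #|J|%:R * \sum_j a j ^+ 2.
Proof.
have [J0|J0] := posnP #|J|.
  have no (j : J) : False by move: (fintype0 j J0).
  by rewrite big1 => [|j]; [rewrite expr0n J0 mul0r|case: (no j)].
set s := \sum_j a j; set q := \sum_j a j ^+ 2.
have N0 : (0 : R) < #|J|%:R by rewrite ltr0n.
have : 0 <= \sum_j (a j - s / #|J|%:R) ^+ 2 by apply: sumr_ge0 => j _; apply: sqr_ge0.
have -> : \sum_j (a j - s / #|J|%:R) ^+ 2 = q - s ^+ 2 / #|J|%:R.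
  rewrite (eq_bigr (fun j => a j ^+ 2 + ((- 2 * (s / #|J|%:R)) * a j + (s / #|J|%:R) ^+ 2))); last first.
    by move=> j _; ring.
  rewrite big_split big_split /= -mulr_sumr -/s -/q sumr_const -[X in _ + (_ + X)]mulr_natl.
  by field; rewrite gt_eqF.
by rewrite subr_ge0 ler_pdivrMr // mulrC.
Qed.

(** Cauchy-Schwarz twice; the fourth power of an inner sum expands into a sum over functions on
    ['I_4]. *)
Lemma pow4_le (J X : finType) (f : J -> X -> R) :
  (\sum_j \sum_x f j x) ^+ 4 <=
  #|J|%:R ^+ 3 * \sum_j \sum_(u : {ffun 'I_4 -> X}) \prod_p f j (u p).
Proof.
have -> : \sum_j \sum_(u : {ffun 'I_4 -> X}) \prod_p f j (u p) = \sum_j (\sum_x f j x) ^+ 4.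
  by apply: eq_bigr => j _; rewrite -(bigA_distr_bigA (fun (_ : 'I_4) x => f j x)) /= prodr_const card_ord.
set s := fun j => \sum_x f j x.
have H1 := sum_sqr_le s; have H2 := sum_sqr_le (fun j => s j ^+ 2).
rewrite -[4%N]/(2 * 2)%N exprM.
apply: le_trans (_ : (#|J|%:R * \sum_j s j ^+ 2) ^+ 2 <= _).
  by rewrite ler_sqr ?nnegrE ?sqr_ge0 // (le_trans (sqr_ge0 _) H1).
rewrite exprMn [_ ^+ 3]exprSr -mulrA ler_wpM2l ?sqr_ge0 //.
by under [X in _ <= _ * X]eq_bigr do rewrite exprM.
Qed.

(** [pow4_le] is applied once in each variable. The powers of [n] lost are
    [6 * 16 + 15 * 4 + 24 = 180], out of [3 * 64 = 192]. *)
Lemma count444 (X : finType) (f : X -> X -> X -> R) (e : R) :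
  (forall x y z, 0 <= f x y z) -> 0 <= e -> (0 < #|X|)%N ->
  e * #|X|%:R ^+ 3 <= \sum_x \sum_y \sum_z f x y z ->
  e ^+ 64 * #|X|%:R ^+ 12 <= \sum_(u : {ffun 'I_4 -> X}) \sum_(v : {ffun 'I_4 -> X})
    \sum_(w : {ffun 'I_4 -> X}) \prod_r \prod_q \prod_p f (u p) (v q) (w r).
Proof.
move=> f0 e0 n0 H; set n : R := #|X|%:R.
have np : 0 < n by rewrite ltr0n.
pose F4 := {ffun 'I_4 -> X}.
have c4 : #|{: F4}|%:R = n ^+ 4 by rewrite card_ffun card_ord natrX.
set N := \sum_x _ in H.
pose N1 := \sum_(j : F4 * X) \sum_y \prod_p f (j.1 p) y j.2.
pose N2 := \sum_(j : F4 * F4) \sum_z \prod_q \prod_p f (j.1 p) (j.2 q) z.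
set N3 := \sum_u _.
have N10 : 0 <= N1.
  by apply: sumr_ge0 => j _; apply: sumr_ge0 => y _; apply: prodr_ge0 => p _.
have N20 : 0 <= N2.
  apply: sumr_ge0 => j _; apply: sumr_ge0 => y _; apply: prodr_ge0 => q _.
  by apply: prodr_ge0 => p _.
have S1 : N ^+ 4 <= n ^+ 6 * N1.
  have := pow4_le (fun (j : X * X) x => f x j.1 j.2).
  rewrite card_prod natrM -expr2 -exprM.
  have -> : \sum_(j : X * X) \sum_x f x j.1 j.2 = N.
    rewrite -(pair_bigA _ (fun y z => \sum_x f x y z)) /=.
    rewrite exchange_big /=; under eq_bigr do rewrite exchange_big /=.
    by rewrite exchange_big /=; under eq_bigr do rewrite exchange_big /=.
  have -> // : \sum_(j : X * X) \sum_(u : F4) \prod_p f (u p) j.1 j.2 = N1.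
  rewrite -(pair_bigA _ (fun y z => \sum_(u : F4) \prod_p f (u p) y z)) /=.
  rewrite /N1 -(pair_bigA _ (fun (u : F4) z => \sum_y \prod_p f (u p) y z)) /=.
  rewrite exchange_big /=; under eq_bigr do rewrite exchange_big /=.
  by rewrite exchange_big /=.
have S2 : N1 ^+ 4 <= n ^+ 15 * N2.
  have := pow4_le (fun (j : F4 * X) y => \prod_p f (j.1 p) y j.2).
  rewrite card_prod natrM c4 -exprSr -exprM -/N1.
  have -> // : \sum_(j : F4 * X) \sum_(v : F4) \prod_q \prod_p f (j.1 p) (v q) j.2 = N2.
  rewrite -(pair_bigA _ (fun (u : F4) z => \sum_(v : F4) \prod_q \prod_p f (u p) (v q) z)) /=.
  rewrite /N2 -(pair_bigA _ (fun (u v : F4) => \sum_z \prod_q \prod_p f (u p) (v q) z)) /=.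
  by apply: eq_bigr => u _; rewrite exchange_big.
have S3 : N2 ^+ 4 <= n ^+ 24 * N3.
  have := pow4_le (fun (j : F4 * F4) z => \prod_q \prod_p f (j.1 p) (j.2 q) z).
  rewrite card_prod natrM c4 -exprD -exprM -/N2.
  have -> // : \sum_(j : F4 * F4) \sum_(w : F4) \prod_r \prod_q \prod_p f (j.1 p) (j.2 q) (w r) = N3.
  by rewrite -(pair_bigA _ (fun (u v : F4) => \sum_(w : F4) \prod_r \prod_q \prod_p f (u p) (v q) (w r))).
have en0 : 0 <= e * n ^+ 3 by rewrite mulr_ge0 // exprn_ge0 // ltW.
have N0 : 0 <= N by apply: le_trans en0 H.
have E1 : (e * n ^+ 3) ^+ 64 <= N ^+ 64 by apply: lerXn2r H; rewrite nnegrE.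
have P1 k : 0 <= n ^+ k by rewrite exprn_ge0 // ltW.
have E2 : N ^+ 64 <= n ^+ 96 * N1 ^+ 16.
  rewrite -[64%N]/(4 * 16)%N exprM -[96%N]/(6 * 16)%N [n ^+ (6 * 16)]exprM -exprMn.
  by apply: lerXn2r S1; rewrite ?nnegrE ?exprn_ge0 ?mulr_ge0.
have E3 : N1 ^+ 16 <= n ^+ 60 * N2 ^+ 4.
  rewrite -[16%N]/(4 * 4)%N exprM -[60%N]/(15 * 4)%N [n ^+ (15 * 4)]exprM -exprMn.
  by apply: lerXn2r S2; rewrite ?nnegrE ?exprn_ge0 ?mulr_ge0.
have E4 : (e * n ^+ 3) ^+ 64 <= n ^+ 180 * N3.
  apply: le_trans E1 (le_trans E2 _).
  rewrite -[180%N]/(96 + 84)%N exprD -mulrA ler_wpM2l //.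
  apply: le_trans E3 _; rewrite -[84%N]/(60 + 24)%N exprD -mulrA ler_wpM2l //.
have P180 : 0 < n ^+ 180 by rewrite exprn_gt0.
rewrite -(ler_pM2l P180); apply: le_trans E4.
rewrite exprMn -exprM -[(3 * 64)%N]/(180 + 12)%N exprD.
by rewrite le_eqVlt; apply/orP; left; apply/eqP; ring.
Qed.
End Moments.

(** * Complete tripartite patterns of tetrahedra *)

Section Configurations.
Variables (X : finType) (S : latin X).
Notation cfg := {ffun 'I_3 -> {ffun 'I_4 -> X}}.

Definition hastet (p : {ffun 'I_3 -> X}) := [exists t, tet S t p].

Definition fullcfg : {set cfg} :=
  [set x : cfg | [forall m : {ffun 'I_3 -> 'I_4}, hastet [ffun j => x j (m j)]]].

Let j0 : 'I_4 := inord 0. Let j1 : 'I_4 := inord 1.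
Let j2 : 'I_4 := inord 2. Let j3 : 'I_4 := inord 3.

Let neI i : (nx i == i = false) /\ (pv i == i = false) /\ (pv i == nx i = false).
Proof. by case: i => [[|[|[|]]]]. Qed.

Let cfgT x i q0 q1 q2 : x \in fullcfg -> exists t p,
  [/\ tet S t p, p i = x i q0, p (nx i) = x (nx i) q1 & p (pv i) = x (pv i) q2].
Proof.
rewrite inE => /forallP/(_ [ffun j => if j == i then q0 else if j == nx i then q1 else q2]).
set p := finfun _ => /existsP[t tp]; exists t, p; split=> //; rewrite !ffunE ?eqxx //.
  by rewrite (neI i).1.
by rewrite (neI i).2.1 (neI i).2.2.
Qed.

Definition lab1 i a b := odflt a [pick l | Lat S i l a b].
Lemma lab1E i l a b : Lat S i l a b -> lab1 i a b = l.
Proof.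
rewrite /lab1 => H; case: pickP => [l' H'|/(_ l)]; last by rewrite H.
exact: LatI1 H' H.
Qed.

Notation wtype := (({ffun 'I_3 -> X} * {ffun 'I_3 -> X * X}) * ({ffun 'I_3 -> X} * {ffun 'I_3 -> X}))%type.

(** The index [j0] gives the tetrahedron over the triangle, [j1] the new position over an edge, [j2]
    and [j3] the extra positions in the cones at a vertex; all labels are read off from pairs of
    positions. *)
Let enc (x : cfg) : wtype :=
  let a := [ffun j => x j j0] in
  (([ffun k => lab1 (nx k) (x (pv k) j0) (x k j1)],
    [ffun i => (lab1 (nx i) (x (pv i) j3) (x i j0), lab1 (pv i) (x i j0) (x (nx i) j2))]),
   ([ffun i => lab1 i (x (nx i) j0) (x (pv i) j0)], [ffun j => x j j0])).

Let I4_cases (P : 'I_4 -> Prop) : P j0 -> P j1 -> P j2 -> P j3 -> forall j, P j.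
Proof.
move=> P0 P1 P2 P3 [[|[|[|[|m]]]] Hm] //.
- by rewrite (_ : Ordinal Hm = j0) //; apply/val_inj; rewrite /= inordK.
- by rewrite (_ : Ordinal Hm = j1) //; apply/val_inj; rewrite /= inordK.
- by rewrite (_ : Ordinal Hm = j2) //; apply/val_inj; rewrite /= inordK.
- by rewrite (_ : Ordinal Hm = j3) //; apply/val_inj; rewrite /= inordK.
Qed.

Definition wtset : {set wtype} :=
  [set z | wt S z.1.1 z.1.2 z.2.1 z.2.2].

(** Starting from the positions with index [j0], each label of the code gives back one further
    position. Every tetrahedron required by [wt] sits on a transversal triple of the pattern. *)
Lemma fullcfg_le : #|fullcfg| <= #|wtset|.
Proof.
apply: (card_inj_le (f := enc)).
  move=> x y Hx Hy E.
  have Ea j : x j j0 = y j j0.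
    by have := congr1 (fun z : wtype => z.2.2 j) E; rewrite !ffunE.
  apply/ffunP => j; apply/ffunP; apply: I4_cases => //.
  - have := congr1 (fun z : wtype => z.1.1 j) E; rewrite !ffunE Ea.
    have [t [p [tp E0 E1 E2]]] := cfgT j j1 j0 j0 Hx.
    have [t' [p' [tp' E0' E1' E2']]] := cfgT j j1 j0 j0 Hy.
    have L := tetLnx j tp; have L' := tetLnx j tp'; rewrite E2 E0 Ea in L; rewrite E2' E0' in L'.
    rewrite (lab1E L) (lab1E L') => El; rewrite El in L; exact: LatI3 L L'.
  - have := congr1 (fun z : wtype => (z.1.2 (pv j)).2) E; rewrite !ffunE /= !I3E Ea.
    have [t [p [tp E0 E1 E2]]] := cfgT (pv j) j0 j2 j0 Hx.
    have [t' [p' [tp' E0' E1' E2']]] := cfgT (pv j) j0 j2 j0 Hy.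
    have L := tetLpv (pv j) tp; have L' := tetLpv (pv j) tp'.
    rewrite E0 E1 !I3E Ea in L; rewrite E0' E1' !I3E in L'.
    rewrite (lab1E L) (lab1E L') => El; rewrite El in L; exact: LatI3 L L'.
  - have := congr1 (fun z : wtype => (z.1.2 (nx j)).1) E; rewrite !ffunE /= !I3E Ea.
    have [t [p [tp E0 E1 E2]]] := cfgT (nx j) j0 j0 j3 Hx.
    have [t' [p' [tp' E0' E1' E2']]] := cfgT (nx j) j0 j0 j3 Hy.
    have L := tetLnx (nx j) tp; have L' := tetLnx (nx j) tp'.
    rewrite E0 E2 !I3E Ea in L; rewrite E0' E2' !I3E in L'.
    rewrite (lab1E L) (lab1E L') => El; rewrite El in L; exact: LatI2 L L'.
move=> x Hx; rewrite inE /=.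
have [t [p [tp E0 E1 E2]]] := cfgT ord0 j0 j0 j0 Hx.
have Ep : p = [ffun j => x j j0].
  by apply/ffunP; apply: (I3_cases (i := ord0)); rewrite ffunE.
have Et : [ffun i => lab1 i (x (nx i) j0) (x (pv i) j0)] = t.
  by apply/ffunP => i; rewrite ffunE; apply: lab1E; have := tetL i tp; rewrite Ep !ffunE.
rewrite Et; have tp' := tp; rewrite Ep in tp'.
apply/and3P; split=> //.
- apply/forallP => k; apply/accEP; rewrite !ffunE.
  have [t1 [p1 [tp1 A0 A1 A2]]] := cfgT k j1 j0 j0 Hx.
  exists t1, p1; split=> //.
  + have L := tetL k tp1; rewrite A1 A2 in L; have L' := tetL k tp'; rewrite !ffunE in L'.
    exact: LatI1 L L'.
  + by have L := tetLnx k tp1; rewrite A2 A0 in L; rewrite (lab1E L).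
  split.
  + have [t2 [p2 [tp2 B0 B1 B2]]] := cfgT (nx k) j0 j2 j1 Hx.
    apply/coneP; exists t2, p2; split=> //; first by rewrite A1.
    * have L := tetLnx (nx k) tp2; rewrite B2 B0 !I3E in L.
      have L' := tetLpv k tp1; rewrite A0 A1 in L'; rewrite !I3E; exact: LatI1 L L'.
    * have L := tetLpv (nx k) tp2; rewrite B0 B1 in L; by rewrite ?ffunE /= (lab1E L).
  + have [t2 [p2 [tp2 B0 B1 B2]]] := cfgT (pv k) j0 j1 j3 Hx.
    apply/coneP; exists t2, p2; split=> //; first by rewrite A2.
    * have L := tetLnx (pv k) tp2; rewrite B2 B0 in L; by rewrite ?ffunE /= (lab1E L).
    * have L := tetLpv (pv k) tp2; rewrite B1 B0 !I3E in L.
      have L' := tetLnx k tp1; rewrite A2 A0 in L'; rewrite !I3E; exact: LatI1 L L'.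
- apply/forallP => i; rewrite !ffunE /=.
  have [t2 [p2 [tp2 B0 B1 B2]]] := cfgT i j0 j2 j3 Hx.
  apply/coneP; exists t2, p2; split=> //.
  + by have L := tetLnx i tp2; rewrite B2 B0 in L; rewrite (lab1E L).
  + by have L := tetLpv i tp2; rewrite B0 B1 in L; rewrite (lab1E L).
Qed.

Lemma wtset_lb (R : realFieldType) (e : R) : (0 <= e)%R -> 0 < #|X| ->
  (e * #|X|%:R ^+ 3 <= #|[set p | hastet p]|%:R ->
  e ^+ 64 * #|X|%:R ^+ 12 <= #|wtset|%:R)%R.
Proof.
move=> e0 n0 He.
pose mk3 (T : Type) (a b c : T) : {ffun 'I_3 -> T} := [ffun j : 'I_3 => nth a [:: a; b; c] j].
pose f a b c : R := (hastet (mk3 X a b c))%:R%R.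
have := @count444 R X f e (fun a b c => ler0n _ _) e0 n0.
have mk3b (T : finType) (z : {ffun 'I_3 -> T}) :
    mk3 T (z (inord 0)) (z (inord 1)) (z (inord 2)) = z.
  apply/ffunP => j; rewrite ffunE; case: j => [[|[|[|m]]] Hm] //=; congr (z _); apply/val_inj;
  by rewrite /= inordK.
have mk3i (T : finType) (a b c a' b' c' : T) : mk3 T a b c = mk3 T a' b' c' -> (a, b, c) = (a', b', c').
  move=> /ffunP E; have := (E (inord 0), E (inord 1), E (inord 2)).
  by rewrite !ffunE !inordK //= => -[[-> ->] ->].
have -> : (\sum_x \sum_y \sum_z f x y z = #|[set p | hastet p]|%:R)%R.
  rewrite pair_bigA pair_bigA /= -sum1dep_card natr_sum big_mkcond /= [RHS]big_mkcond /=.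
  rewrite (reindex (fun z : X * X * X => mk3 X z.1.1 z.1.2 z.2)) /=.
    by apply: eq_bigr => -[[a b] c] _ /=; rewrite /f; case: hastet.
  exists (fun z => (z (inord 0), z (inord 1), z (inord 2))) => [[[a b] c]|z] _ /=.
    by rewrite !ffunE !inordK.
  exact: mk3b.
move=> /(_ He) /le_trans; apply.
apply: (@le_trans _ _ #|fullcfg|%:R%R); last by rewrite ler_nat fullcfg_le.
rewrite pair_bigA pair_bigA /= -sum1dep_card natr_sum [leRHS]big_mkcond /=.
rewrite [leRHS](reindex (fun z : {ffun 'I_4 -> X} * {ffun 'I_4 -> X} * {ffun 'I_4 -> X} => mk3 _ z.1.1 z.1.2 z.2)) /=; last first.
  exists (fun z => (z (inord 0), z (inord 1), z (inord 2))) => [[[a b] c]|z] _ /=.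
    by rewrite !ffunE !inordK.
  exact: mk3b.
apply: ler_sum => -[[u v] w] _ /=; case: ifP => H.
  have f01 a b c : (0 <= f a b c <= 1)%R by rewrite /f; case: hastet; rewrite ?lexx ?ler01.
  apply: prodr_ile1 => r _; apply/andP; split.
    by apply: prodr_ge0 => q _; apply: prodr_ge0 => p _; case/andP: (f01 (u p) (v q) (w r)).
  apply: prodr_ile1 => q _; apply/andP; split.
    by apply: prodr_ge0 => p _; case/andP: (f01 (u p) (v q) (w r)).
  by apply: prodr_ile1 => p _; apply: f01.
have [m /negPf nm] : exists m : {ffun 'I_3 -> 'I_4},
    ~~ hastet [ffun j => mk3 _ u v w j (m j)].
  by apply/existsP; rewrite -negb_forall; apply/negbT.
have Em : [ffun j => mk3 _ u v w j (m j)] = mk3 X (u (m (inord 0))) (v (m (inord 1))) (w (m (inord 2))).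
  apply/ffunP => j; rewrite !ffunE; case: j => [[|[|[|q]]] Hq] //=; congr (_ (m _)); apply/val_inj;
  by rewrite /= inordK.
rewrite (bigD1 (m (inord 2))) //= (bigD1 (m (inord 1))) //= (bigD1 (m (inord 0))) //=.
by rewrite /f -Em nm !mul0r.
Qed.
End Configurations.

(** * Averaging over random samples *)

Lemma card_coord (J T : finType) (k : J) (C : {set T}) :
  #|[set g : {ffun J -> T} | g k \in C]| = (#|C| * #|T| ^ #|J|.-1)%N.
Proof.
have -> : [set g : {ffun J -> T} | g k \in C] =
    [set g in family (fun j => if j == k then C else setT)].
  apply/setP => g; rewrite !inE; apply/idP/familyP => [H j|/(_ k)]; last by rewrite eqxx.
  by case: eqP => [->|_]; rewrite ?inE.
rewrite cardsE card_family_prod (bigD1 k) //= eqxx; congr muln.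
rewrite (eq_bigr (fun _ => #|T|)) => [|j /negPf->]; last by rewrite cardsT.
by rewrite prod_nat_const; congr expn; rewrite cardC1.
Qed.

Lemma card_set_type (T : finType) : #|{set T}| = 2 ^ #|T|.
Proof. by rewrite -[LHS]cardsT -powersetT card_powerset cardsT. Qed.

Lemma double_count (A B : finType) (P : A -> B -> bool) :
  \sum_a #|[set b | P a b]| = \sum_b #|[set a | P a b]|.
Proof.
under eq_bigr do rewrite -sum1dep_card big_mkcond.
rewrite exchange_big; apply: eq_bigr => b _.
by rewrite -sum1dep_card [RHS]big_mkcond.
Qed.

Section Select.
Variables (X : finType) (S : latin X) (I : finType) (R : realFieldType).
Notation EV := (I * 'I_3)%type.
Notation samples := ({ffun 'I_3 -> X} * {ffun 'I_3 -> X * X})%type.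
Local Open Scope ring_scope.
Let n : R := #|X|%:R.
Let Q := #|{: EV}|.
Hypothesis X0 : (0 < #|X|)%N.

Lemma exists_ge_avg (T : finType) (h : T -> R) (m : R) : (0 < #|T|)%N ->
  m * #|T|%:R <= \sum_z h z -> exists z, m <= h z.
Proof.
move=> T0 H; apply: contrapT => ne.
have lt z : h z < m by rewrite ltNge; apply/negP => Hz; apply: ne; exists z.
move: H; apply/negP; rewrite -ltNge mulr_natr -sumr_const.
have /card_gt0P[z0 _] := T0.
rewrite (bigD1 z0) //= [ltRHS](bigD1 z0) //=.
by apply: ltr_leD => //; apply: ler_sum => z _; apply: ltW.
Qed.

(** For fixed [al] and [c], a bad event puts [g k] into a set of fewer than [gE * n] labels, while
    the two other coordinates of [g] are free. *)
Lemma sum_badE (gE : R) (c : {ffun 'I_3 -> X * X}) k Sf l : 0 <= gE ->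
  \sum_g #|badE S (I := I) g c gE k Sf l|%:R <= gE * n ^+ 3 * n ^+ Q.
Proof.
move=> gE0; rewrite -natr_sum.
rewrite (double_count (fun (g : {ffun 'I_3 -> X}) (al : {ffun EV -> X}) => (g k \in commE S c k Sf l al) && (#|commE S c k Sf l al|%:R < gE * n))).
rewrite natr_sum; apply: le_trans (_ : \sum_(al : {ffun EV -> X}) gE * n ^+ 3 <= _); last first.
  by rewrite sumr_const card_ffun -[leLHS]mulr_natr natrX.
apply: ler_sum => al _; case: (boolP (#|commE S c k Sf l al|%:R < gE * n)) => Hf.
  have -> : [set g : {ffun 'I_3 -> X} | (g k \in commE S c k Sf l al) && true] =
      [set g : {ffun 'I_3 -> X} | g k \in commE S c k Sf l al].
    by apply/setP => g; rewrite !inE andbT.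
  rewrite card_coord card_ord natrM natrX exprS mulrA ler_wpM2r ?exprn_ge0 ?ler0n //.
  exact: ltW.
have -> : [set g : {ffun 'I_3 -> X} | (g k \in commE S c k Sf l al) && false] = set0.
  by apply/setP => g; rewrite !inE andbF.
by rewrite cards0 mulr_ge0 // exprn_ge0 // ler0n.
Qed.

Lemma sum_badV (gV : R) i P : 0 <= gV ->
  \sum_c #|badV S (I := I) c gV i P|%:R <= gV * n ^+ 6 * n ^+ (2 * Q).
Proof.
move=> gV0; rewrite -natr_sum.
rewrite (double_count (fun (c : {ffun 'I_3 -> X * X}) (z : {ffun EV -> X} * {ffun EV -> X}) =>
  (c i \in commV S i P z.1 z.2) && (#|commV S i P z.1 z.2|%:R < gV * n ^+ 2))).
rewrite natr_sum; apply: le_trans (_ : \sum_(z : {ffun EV -> X} * {ffun EV -> X}) gV * n ^+ 6 <= _); last first.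
  by rewrite sumr_const card_prod !card_ffun -expnD addnn -mul2n -[leLHS]mulr_natr natrX.
apply: ler_sum => z _; case: (boolP (#|commV S i P z.1 z.2|%:R < gV * n ^+ 2)) => Hf.
  have -> : [set c : {ffun 'I_3 -> X * X} | (c i \in commV S i P z.1 z.2) && true] =
      [set c : {ffun 'I_3 -> X * X} | c i \in commV S i P z.1 z.2].
    by apply/setP => g; rewrite !inE andbT.
  rewrite card_coord card_ord natrM natrX card_prod natrM -expr2 -exprM -[6%N]/(2 + 2 * 2)%N exprD mulrA.
  rewrite ler_wpM2r ?exprn_ge0 ?ler0n //; exact: ltW.
have -> : [set c : {ffun 'I_3 -> X * X} | (c i \in commV S i P z.1 z.2) && false] = set0.
  by apply/setP => g; rewrite !inE andbF.
by rewrite cards0 mulr_ge0 // exprn_ge0 // ler0n.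
Qed.

Variables (e0 gE bE gV bV : R).
Hypotheses (e00 : 0 < e0) (gE0 : 0 <= gE) (bE0 : 0 < bE) (gV0 : 0 <= gV) (bV0 : 0 < bV).
Hypothesis HW : e0 * n ^+ 12 <= #|wtset S|%:R.
Hypothesis HE : 3 * 2 ^+ Q * gE <= bE * e0 / 4.
Hypothesis HV : 3 * 2 ^+ (Q ^ 3) * gV <= bV * e0 / 4.

Let np : 0 < n. Proof. by rewrite ltr0n. Qed.

Lemma sample_exists : exists (g : {ffun 'I_3 -> X}) (c : {ffun 'I_3 -> X * X}),
  [/\ e0 / 2 * n ^+ 3 <= #|[set y : {ffun 'I_3 -> X} * {ffun 'I_3 -> X} | wt S g c y.1 y.2]|%:R,
      \sum_k \sum_Sf \sum_l #|badE S (I := I) g c gE k Sf l|%:R <= bE * n ^+ Q.+1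
    & forall i P, #|badV S (I := I) c gV i P|%:R <= bV * n ^+ (2 * Q)].
Proof.
pose Gs (z : samples) : R := #|[set y : {ffun 'I_3 -> X} * {ffun 'I_3 -> X} | wt S z.1 z.2 y.1 y.2]|%:R.
pose BE (z : samples) : R := \sum_k \sum_Sf \sum_l #|badE S (I := I) z.1 z.2 gE k Sf l|%:R.
pose BV (z : samples) : R := \sum_i \sum_P #|badV S (I := I) z.2 gV i P|%:R.
have cS : #|{: samples}|%:R = n ^+ 9.
  by rewrite card_prod !card_ffun !card_ord card_prod natrM !natrX natrM -/n; ring.
have sumrC (T : finType) (x : R) : \sum_(t : T) x = #|{: T}|%:R * x by rewrite sumr_const mulr_natl.
have cset : #|{: {set EV}}|%:R = 2 ^+ Q :> R by rewrite card_set_type natrX.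
have cset3 : #|{: {set EV * EV * EV}}|%:R = 2 ^+ (Q ^ 3) :> R.
  rewrite card_set_type natrX; congr (_ ^+ _); rewrite (card_prod (EV * EV)%type EV) (card_prod EV EV).
  by rewrite -[3%N]/(1 + 1 + 1)%N !expnD !expn1.
have cg : #|{: {ffun 'I_3 -> X}}|%:R = n ^+ 3 by rewrite card_ffun card_ord natrX.
have cC : #|{: {ffun 'I_3 -> X * X}}|%:R = n ^+ 6.
  by rewrite card_ffun card_ord card_prod natrX natrM -/n; ring.
have sG : \sum_z Gs z = #|wtset S|%:R.
  rewrite -natr_sum; congr (_%:R).
  by rewrite -(card_sigma xpredT (fun z : samples => [set y | wt S z.1 z.2 y.1 y.2])); apply: eq_card => z; rewrite !inE.
have sE : \sum_z BE z <= 3 * 2 ^+ Q * gE * n ^+ Q.+1 * n ^+ 9.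
  rewrite /BE exchange_big /=.
  apply: le_trans (_ : \sum_(k : 'I_3) \sum_(Sf : {set EV}) \sum_(l : X) \sum_(c : {ffun 'I_3 -> X * X}) gE * n ^+ 3 * n ^+ Q <= _).
    apply: ler_sum => k _; rewrite exchange_big; apply: ler_sum => Sf _.
    rewrite exchange_big; apply: ler_sum => l _.
    rewrite -(pair_bigA _ (fun g c => #|badE S (I := I) g c gE k Sf l|%:R)) /= exchange_big.
    by apply: ler_sum => c _; apply: sum_badE.
  rewrite !sumrC cset cC card_ord le_eqVlt; apply/orP; left; apply/eqP.
  by rewrite -/n (exprS n Q); ring.
have sV : \sum_z BV z <= 3 * 2 ^+ (Q ^ 3) * gV * n ^+ (2 * Q) * n ^+ 9.
  rewrite /BV exchange_big /=.
  apply: le_trans (_ : \sum_(k : 'I_3) \sum_(P : {set EV * EV * EV}) \sum_(g : {ffun 'I_3 -> X}) gV * n ^+ 6 * n ^+ (2 * Q) <= _).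
    apply: ler_sum => k _; rewrite exchange_big; apply: ler_sum => P _.
    rewrite -(pair_bigA _ (fun g c => #|badV S (I := I) c gV k P|%:R)) /=.
    by apply: ler_sum => g _; apply: sum_badV.
  rewrite !sumrC cset3 cg card_ord le_eqVlt; apply/orP; left; apply/eqP.
  by ring.
(* The normalised gain minus two normalised penalties has mean at least [e0 - e0 / 4 - e0 / 4]. The
   gain is at most 1, since the positions determine the triangle; so a sample reaching the mean has
   gain at least [e0 / 2] and both penalties at most 1. *)
pose h z := Gs z / n ^+ 3 - BE z / (bE * n ^+ Q.+1) - BV z / (bV * n ^+ (2 * Q)).
have pE : 0 < bE * n ^+ Q.+1 by rewrite mulr_gt0 ?exprn_gt0.
have pV : 0 < bV * n ^+ (2 * Q) by rewrite mulr_gt0 ?exprn_gt0.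
have p3 : 0 < n ^+ 3 by rewrite exprn_gt0.
have p9 : 0 < n ^+ 9 by rewrite exprn_gt0.
have [z Hz] : exists z, e0 / 2 <= h z.
  apply: exists_ge_avg; first by rewrite -(ltr0n R) cS.
  rewrite cS /h !sumrB -!mulr_suml sG.
  have a1 : e0 * n ^+ 9 <= #|wtset S|%:R / n ^+ 3.
    by rewrite ler_pdivlMr // -mulrA -exprD.
  have a2 : (\sum_z BE z) / (bE * n ^+ Q.+1) <= e0 / 4 * n ^+ 9.
    rewrite ler_pdivrMr //; apply: le_trans sE _.
    have -> : e0 / 4 * n ^+ 9 * (bE * n ^+ Q.+1) = bE * e0 / 4 * (n ^+ Q.+1 * n ^+ 9) by ring.
    by rewrite -[leLHS]mulrA ler_wpM2r // mulr_ge0 ?exprn_ge0 // ltW.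
  have a3 : (\sum_z BV z) / (bV * n ^+ (2 * Q)) <= e0 / 4 * n ^+ 9.
    rewrite ler_pdivrMr //; apply: le_trans sV _.
    have -> : e0 / 4 * n ^+ 9 * (bV * n ^+ (2 * Q)) = bV * e0 / 4 * (n ^+ (2 * Q) * n ^+ 9) by ring.
    by rewrite -[leLHS]mulrA ler_wpM2r // mulr_ge0 ?exprn_ge0 // ltW.
  move: a1 a2 a3; move: (_ / n ^+ 3) (_ / (bE * _)) (_ / (bV * _)) (n ^+ 9) => ? ? ? ?; lra.
have G0 : Gs z <= n ^+ 3.
  rewrite /Gs -natrX -[X in (_ ^ X)%N]card_ord -card_ffun ler_nat -cardsT.
  apply: (card_inj_le (f := snd)) => [[t a] [t' a']|y _]; last by rewrite inE.
  rewrite !inE /= => /and3P[T _ _] /and3P[T' _ _] E; subst a'.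
  by rewrite (tet_inj_lab T T').
have BE0 : 0 <= BE z by apply: sumr_ge0 => k _; apply: sumr_ge0 => Sf _; apply: sumr_ge0 => l _.
have BV0 : 0 <= BV z by apply: sumr_ge0 => k _; apply: sumr_ge0 => Sf _.
have q1 : Gs z / n ^+ 3 <= 1 by rewrite ler_pdivrMr // mul1r.
have q2 : 0 <= BE z / (bE * n ^+ Q.+1) by rewrite divr_ge0 // ltW.
have q3 : 0 <= BV z / (bV * n ^+ (2 * Q)) by rewrite divr_ge0 // ltW.
rewrite /h in Hz.
have [r1 [r2 r3]] : e0 / 2 <= Gs z / n ^+ 3 /\ (BE z / (bE * n ^+ Q.+1) <= 1 /\
    BV z / (bV * n ^+ (2 * Q)) <= 1).
  move: e00 Hz q1 q2 q3; move: (Gs z / _) (BE z / _) (BV z / _) => a b c.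
  by move=> ? ? ? ? ?; split; [|split]; lra.
exists z.1, z.2; split.
- by rewrite -ler_pdivlMr.
- by move: r2; rewrite ler_pdivrMr // mul1r.
- move=> i P; move: r3; rewrite ler_pdivrMr // mul1r; apply: le_trans.
  rewrite /BV (bigD1 i) //= (bigD1 P) //= -addrA lerDl addr_ge0 //.
    by apply: sumr_ge0.
  by apply: sumr_ge0 => ? _; apply: sumr_ge0.
Qed.
End Select.

(** * Rigid sets of triangles *)

Lemma greedy_coloring (T : finType) (r : rel T) d : symmetric r ->
  (forall x, #|[set y | r x y]| <= d) ->
  exists col : T -> 'I_d.+1, forall x y, r x y -> x != y -> col x != col y.
Proof.
move=> rs rd.
suff H (s : seq T) : exists col : T -> 'I_d.+1, forall x y, x \in s -> y \in s ->
    r x y -> x != y -> col x != col y.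
  have [col Hc] := H (enum T); exists col => x y; apply: Hc; exact: mem_enum.
elim: s => [|z s [col Hc]]; first by exists (fun _ => ord0).
have [c Hcz] : exists c, c \notin [set col y | y in [set y | r z y]].
  apply/existsP; rewrite -negb_forall; apply/negP => /forallP Hall.
  have : #|'I_d.+1| <= #|[set col y | y in [set y | r z y]]|.
    by apply: subset_leq_card; apply/subsetP => c _; apply: Hall.
  by rewrite card_ord leqNgt ltnS (leq_trans (leq_imset_card _ _) (rd z)).
have cz y : r z y -> c != col y.
  by move=> ry; apply: contraNneq Hcz => ->; apply: imset_f; rewrite inE.
exists (fun y => if y == z then c else col y) => x y.
rewrite !inE; case: (eqVneq x z) => [->|xz]; case: (eqVneq y z) => [->|yz] //=; rewrite ?eqxx //.
- by move=> _ _ ry _; apply: cz.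
- by move=> _ _ ry _; rewrite eq_sym; apply: cz; rewrite rs.
- exact: Hc.
Qed.

Lemma lnull_subset (X : finType) (A B : {set {ffun 'I_3 -> X}}) k w :
  A \subset B -> lnull A k w -> lnull B k w.
Proof.
move=> /subsetP sAB; elim=> {k w} [k|k1 k2 a w1 w2 _ H1 _ H2|k a b c w [t At Ht] _ H].
- exact: null_nil.
- exact: null_pair.
- by apply: null_face H; exists t => //; apply: sAB.
Qed.

Section Similar.
Variables (R : realType) (X : finType) (S : latin X) (b : nat).
Local Open Scope ring_scope.
Notation I := 'I_(2 * b).+1.
Notation EV := (I * 'I_3)%type.
Let n : R := #|X|%:R.
Let Q := #|{: EV}|.
Variables (g : {ffun 'I_3 -> X}) (c : {ffun 'I_3 -> X * X}) (cF th gE be gV : R).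
Variable A : {set {ffun 'I_3 -> X}}.
Hypothesis H1 : forall t, t \in A -> cF * n <= #|[set a | wt S g c t a]|%:R.
Hypothesis H2 : forall t k Sf, t \in A -> #|badE S (I := I) g c gE k Sf (t k)|%:R <= th * n ^+ Q.
Hypothesis H3 : forall i P, #|badV S (I := I) c gV i P|%:R <= be * n ^+ (2 * Q).
Hypotheses (cF0 : 0 <= cF) (cF1 : cF <= 1) (gE0 : 0 <= gE) (gE1 : gE <= 1) (gV0 : 0 <= gV)
  (th0 : 0 <= th).
Hypothesis Hth : Q%:R * th <= cF ^+ Q / 2.
Hypothesis Hbe : Q%:R * be <= cF ^+ Q * gE ^+ Q / 4.

Definition sim i : {set X * X} := [set p | (p.1 != p.2) &&
  `[< exists2 k, (k < b)%N & lnull A k [:: (i, p.1, true); (i, p.2, false)] >]].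

Lemma sim_sym i x y : ((x, y) \in sim i) = ((y, x) \in sim i).
Proof.
suff H u v : (u, v) \in sim i -> (v, u) \in sim i by apply/idP/idP; apply: H.
rewrite !inE /= => /andP[ne /asboolP[k kb Hk]]; rewrite eq_sym ne.
by apply/asboolP; exists k => //; apply: (lnull_sym (u := [:: (i, u, true)]) (v := [:: (i, v, true)]) Hk).
Qed.

(** Each similar pair admits a fixed proportion of [n ^+ (4 * Q)] decorations by [good_configs],
    while [pairs_bound] limits the total to order [n ^+ (4 * Q).+1]. *)
Lemma card_sim i : #|sim i|%:R * (cF ^+ Q * gE ^+ Q * gV ^+ Q / 4) <= #|{: shape I}|%:R * n.
Proof.
case: (posnP #|X|) => [n0|n0].
  rewrite (_ : sim i = set0) ?cards0 ?mul0r ?mulr_ge0 ?ler0n //.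
  by apply/setP => -[x y]; have := fintype0 x n0.
have /card_gt0P[x0 _] := n0.
(* A placeholder for pairs outside [sim i], so that [choice] applies to all pairs. *)
pose dflt : shape I := (set0, set0, set0, [ffun _ => [ffun _ => ord0]],
  [ffun _ => [ffun _ => ord0]], [ffun _ => (ord0, ord0)], ((ord0, ord0), (ord0, ord0))).
pose cs := cF ^+ Q * gE ^+ Q * gV ^+ Q / 4 * n ^+ (4 * Q).
have ex (p : X * X) : exists y : shape I * (EV -> X) * {set config X I}, p \in sim i ->
    [/\ wfshape y.1.1, y.1.2 (sb y.1.1).1 = p.1 /\ y.1.2 (sb y.1.1).2 = p.2,
        forall w, w \in y.2 -> goodc S y.1.1 y.1.2 w & cs <= #|y.2|%:R].
  case: (boolP (p \in sim i)) => Hp; last by exists (dflt, fun _ => x0, set0).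
  move: Hp; rewrite inE => /andP[/eqP ne /asboolP[k kb Hk]].
  have cI : (2 * k + 3 <= #|I|)%N by rewrite card_ord; clear -kb; lia.
  have [s [lb [ws sA El _]]] := null_shape cI ne Hk.
  have [Wg [Hg Hc]] := @good_configs X S I g c R s lb cF th gE be gV
    (fun f Hf => H1 (sA f Hf)) (fun f k Sf Hf => H2 k Sf (sA f Hf)) H3
    cF0 cF1 gE0 gE1 gV0 th0 Hth Hbe.
  by exists (s, lb, Wg).
have [y Hy] := choice ex.
have HB' : (\sum_(p in sim i) #|(y p).2| <= #|{: shape I}| * #|X| ^ (4 * Q).+1)%N.
  apply: (@pairs_bound X S I x0 (sim i) (fun p => (y p).1.1) (fun p => (y p).1.2) (fun p => (y p).2)).
  - by move=> p /Hy[].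
  - by move=> p /Hy[].
  - by move=> p w /Hy[_ _ Hg _] /Hg.
have np : 0 < n by rewrite ltr0n.
have pn : 0 < n ^+ (4 * Q) by rewrite exprn_gt0.
rewrite -(ler_pM2r pn) -[leLHS]mulrA -/cs -[leRHS]mulrA -exprS.
apply: le_trans (_ : (\sum_(p in sim i) #|(y p).2|)%:R <= _); last first.
  by rewrite -natrX -natrM ler_nat.
have -> : #|sim i|%:R * cs = \sum_(p in sim i) cs by rewrite sumr_const mulr_natl.
by rewrite natr_sum; apply: ler_sum => p /Hy[].
Qed.

End Similar.

(** * Heavy triangles and rigid colour classes *)

Section Faces.
Variables (R : realFieldType) (X : finType) (S : latin X).
Local Open Scope ring_scope.
Let n : R := #|X|%:R.
Let n0 : 0 <= n. Proof. exact: ler0n. Qed.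

Lemma faces_card i (C : {set X}) : (#|[set t | Fc S t && (t i \in C)]| <= #|C| * #|X|)%N.
Proof.
rewrite -[#|X|]cardsT -cardsX.
apply: (card_inj_le (f := fun t : {ffun 'I_3 -> X} => (t i, t (nx i)))) => [t t'|t].
  rewrite !inE => /andP[Ft _] /andP[Ft' _] [E1 E2].
  by apply: (@FcI _ S (pv i)) => //; rewrite !I3E.
by rewrite !inE => /andP[_ ->].
Qed.

(** A rejected triangle has a deleted label or carries fewer than [cF * n] elements of [W]. A label
    lies on at most [n] triangles of each kind, a triangle carries at most [n] tetrahedra, and there
    are at most [n ^+ 2] triangles. *)
Lemma heavy_faces (W : {set {ffun 'I_3 -> X} * {ffun 'I_3 -> X}}) (del : 'I_3 -> {set X})
    (w d cF : R) : (0 < #|X|)%N -> 0 <= cF ->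
  (forall y, y \in W -> tet S y.1 y.2) -> w * n ^+ 3 <= #|W|%:R ->
  (forall k, #|del k|%:R <= d * n) ->
  (w - 3 * d - cF) * n ^+ 2 <=
    #|[set t | [&& Fc S t, [forall k, t k \notin del k] & cF * n <= #|[set a | (t, a) \in W]|%:R]]|%:R.
Proof.
move=> X0 cF0 WT HW Hd; set A := [set t | _].
have np : 0 < n by rewrite ltr0n.
(* The condition with [setT] always holds; it is written so that [faces_card] also counts all
   triangles. *)
have key (t : {ffun 'I_3 -> X}) : #|[set a | (t, a) \in W]|%:R <= (t \in A)%:R * n +
    \sum_k (Fc S t && (t k \in del k))%:R * n + (Fc S t && (t ord0 \in setT))%:R * (cF * n).
  have s0 : 0 <= \sum_k (Fc S t && (t k \in del k))%:R * n.
    by apply: sumr_ge0 => k _; rewrite mulr_ge0.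
  have le_n : #|[set a | (t, a) \in W]|%:R <= n.
    rewrite ler_nat; apply: leq_trans (tet_card S t); apply: subset_leq_card.
    by apply/subsetP => a; rewrite !inE; apply: WT.
  case: (set_0Vmem [set a | (t, a) \in W]) => [->|[a]].
    by rewrite cards0 !addr_ge0 ?mulr_ge0.
  rewrite inE => /WT /tetF /= Ft; rewrite inE Ft inE /=.
  case: (boolP [forall k, _]) => [_|]; last first.
    rewrite negb_forall => /existsP[k /negPn dk].
    apply: le_trans le_n _; rewrite mul0r add0r (bigD1 k) //= dk !mul1r -addrA lerDl.
    by rewrite addr_ge0 ?mulr_ge0 //; apply: sumr_ge0 => ? _; rewrite mulr_ge0.
  rewrite Ft in s0; case: (leP (cF * n)) => Hc /=.
    apply: le_trans le_n _; rewrite mul1r -addrA lerDl addr_ge0 ?mulr_ge0 //.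
  by rewrite mul0r add0r mul1r; apply: le_trans (ltW Hc) _; rewrite lerDr.
have sW : (#|W| = \sum_t #|[set a | (t, a) \in W]|)%N.
  by rewrite -(card_sigma xpredT); apply: eq_card => -[t a]; rewrite !inE.
have scard (T : finType) (P : pred T) : \sum_t (P t)%:R = #|[set t | P t]|%:R :> R.
  by rewrite -sum1dep_card natr_sum [RHS]big_mkcond; apply: eq_bigr => t _; case: (P t).
have b2 k : \sum_t (Fc S t && (t k \in del k))%:R * n <= d * n * n * n.
  rewrite -mulr_suml scard ler_wpM2r //.
  apply: le_trans (_ : (#|del k| * #|X|)%:R <= _); first by rewrite ler_nat faces_card.
  by rewrite natrM ler_wpM2r.
have b3 : \sum_t (Fc S t && (t ord0 \in [set: X]))%:R * (cF * n) <= n * n * (cF * n).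
  rewrite -mulr_suml scard ler_wpM2r ?mulr_ge0 //.
  apply: le_trans (_ : (#|[set: X]| * #|X|)%:R <= _); first by rewrite ler_nat faces_card.
  by rewrite natrM cardsT.
have tot : w * n ^+ 3 <= #|A|%:R * n + 3 * (d * n * n * n) + n * n * (cF * n).
  apply: le_trans HW _; rewrite sW natr_sum; apply: le_trans (ler_sum _ (fun t _ => key t)) _.
  rewrite !big_split /=; apply: lerD b3; apply: lerD.
    rewrite -mulr_suml scard ler_wpM2r // ler_nat; apply: eq_leq; apply: eq_card => t; by rewrite inE.
  rewrite exchange_big /= (_ : 3 * _ = \sum_(k : 'I_3) d * n * n * n); first exact: ler_sum.
  by rewrite sumr_const card_ord mulr_natl.
rewrite -(ler_pM2r np); have -> : (w - 3 * d - cF) * n ^+ 2 * n =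
   w * n ^+ 3 - 3 * (d * n * n * n) - n * n * (cF * n) by ring.
lra.
Qed.

(** Labels with more than [D] similar ones number at most [a / 6 * n] of each kind, so deleting them
    destroys at most half of the guaranteed triangles. The other labels are coloured with [D.+1]
    colours per kind; triangles with the same colour vector never carry distinct similar labels of
    one kind. *)
Lemma rigid_subset (A : {set {ffun 'I_3 -> X}}) (b D : nat) (a H : R) :
  0 <= a -> (0 < #|X|)%N -> (forall t, t \in A -> Fc S t) -> a * n ^+ 2 <= #|A|%:R ->
  (forall i, #|sim b A i|%:R <= H * n) -> 6 * H <= a * D.+1%:R ->
  exists B : {set {ffun 'I_3 -> X}}, [/\ B \subset A, rigid B b & a / 2 * n ^+ 2 <= D.+1%:R ^+ 3 * #|B|%:R].
Proof.
move=> a0 X0 FA HA HS HD.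
have np : 0 < n by rewrite ltr0n.
pose nb i x := [set y | (x, y) \in sim b A i].
pose hub i := [set x | (D < #|nb i x|)%N].
have hubc i : #|hub i|%:R * D.+1%:R <= H * n.
  apply: le_trans (HS i); rewrite -natrM ler_nat -sum_nat_const.
  apply: leq_trans (_ : \sum_(x in hub i) #|nb i x| <= _)%N.
    by apply: leq_sum => x; rewrite inE.
  rewrite -(card_sigma (fun x => x \in hub i) (nb i)).
  by apply: subset_leq_card; apply/subsetP => -[x y]; rewrite !inE /= => /andP[_ ].
have hubc' i : #|hub i|%:R <= a / 6 * n.
  have Dp : 0 < D.+1%:R :> R by rewrite ltr0n.
  rewrite -(ler_pM2r Dp); apply: le_trans (hubc i) _.
  have -> : a / 6 * n * D.+1%:R = (a * D.+1%:R) / 6 * n by ring.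
  by rewrite ler_wpM2r //; lra.
pose A2 := [set t in A | [forall i, t i \notin hub i]].
have cA2 : a / 2 * n ^+ 2 <= #|A2|%:R.
  have sub : A \subset A2 :|: \bigcup_k [set t | Fc S t && (t k \in hub k)].
    apply/subsetP => t At; rewrite inE [t \in A2]inE At /=.
    case: (boolP [forall i, _]) => //=; rewrite negb_forall => /existsP[k /negPn hk].
    by apply/bigcupP; exists k => //; rewrite inE FA.
  have : #|A|%:R <= #|A2|%:R + \sum_(k : 'I_3) #|[set t | Fc S t && (t k \in hub k)]|%:R :> R.
    rewrite -natr_sum -natrD ler_nat; apply: leq_trans (subset_leq_card sub) _.
    apply: leq_trans (leq_card_setU _ _).1 _; rewrite leq_add2l.
    elim/big_rec2: _ => [|j x y _ H']; first by rewrite cards0.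
    by apply: leq_trans (leq_card_setU _ _).1 _; rewrite leq_add2l.
  have : \sum_(k : 'I_3) #|[set t | Fc S t && (t k \in hub k)]|%:R <= 3 * (a / 6 * n * n) :> R.
    rewrite (_ : 3 * _ = \sum_(k : 'I_3) a / 6 * n * n); last by rewrite sumr_const card_ord mulr_natl.
    apply: ler_sum => k _; apply: le_trans (_ : (#|hub k| * #|X|)%:R <= _).
      by rewrite ler_nat faces_card.
    by rewrite natrM ler_wpM2r.
  have -> : a / 2 * n ^+ 2 = a * n ^+ 2 - 3 * (a / 6 * n * n) by field.
  move: HA; move: (a * n ^+ 2) (a / 6 * n * n) => ? ?; lra.
pose r i x y := [&& (x, y) \in sim b A i, x \notin hub i & y \notin hub i].
have rs i : symmetric (r i).
  by move=> x y; rewrite /r sim_sym andbA andbAC -andbA.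
have rd i x : (#|[set y | r i x y]| <= D)%N.
  case: (boolP (x \in hub i)) => hx.
    rewrite (_ : [set y | _] = set0) ?cards0 //; apply/setP => y.
    by rewrite !inE /r hx andbF.
  move: hx; rewrite inE -leqNgt; apply: leq_trans; apply: subset_leq_card.
  by apply/subsetP => y; rewrite inE => /and3P[H1 _ _]; rewrite /nb in_set.
have [col Hcol] := choice (fun i => greedy_coloring (rs i) (rd i)).
pose kap (t : {ffun 'I_3 -> X}) : {ffun 'I_3 -> 'I_D.+1} := [ffun i => col i (t i)].
pose cls z := [set t in A2 | kap t == z].
have cK : #|{: {ffun 'I_3 -> 'I_D.+1}}|%:R = D.+1%:R ^+ 3 :> R by rewrite card_ffun !card_ord natrX.
have cKp : 0 < D.+1%:R ^+ 3 :> R by rewrite exprn_gt0 // ltr0n.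
have [z Hz] : exists z, a / 2 * n ^+ 2 / D.+1%:R ^+ 3 <= #|cls z|%:R.
  apply: exists_ge_avg; first by rewrite -(ltr0n R) cK.
  rewrite cK divfK ?gt_eqF //; apply: le_trans cA2 _.
  rewrite -natr_sum ler_nat; apply: eq_leq.
  rewrite -sum1_card (partition_big kap xpredT) //=; apply: eq_bigr => z _.
  by rewrite sum1dep_card.
exists (cls z); split.
- by apply/subsetP => t; rewrite !inE => /andP[/andP[]].
- move=> i l l' k kb Hk; case: (lnull_digon Hk) => // -[[t Ht Et] [t' Ht' Et']].
  apply/eqP; apply: contraT => ne.
  move: Ht Ht'; rewrite !inE => /andP[/andP[At /forallP/(_ i) h1] /eqP K1].
  move=> /andP[/andP[At' /forallP/(_ i) h2] /eqP K2].
  have : r i l l'.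
    rewrite /r -Et -Et' h1 h2 !andbT inE /= Et Et' ne; apply/asboolP; exists k => //.
    apply: lnull_subset Hk; apply/subsetP => t0; rewrite !inE => /andP[/andP[]] //.
  move/(Hcol i)/(_ ne); rewrite -Et -Et'.
  by move: K1; rewrite -K2 => /ffunP/(_ i); rewrite !ffunE => ->; rewrite eqxx.
- by move: Hz; rewrite ler_pdivrMr // [leRHS]mulrC.
Qed.
End Faces.

(** * Moderate density: choice of the constants *)

Lemma card_shape N : #|{: shape 'I_N}| <= 2 ^ (5 * (N * 3) + 8 * N * (N * 3)).
Proof.
have N2 m : m <= 2 ^ m by apply: ltnW; apply: ltn_expl.
rewrite !card_prod !card_set_type !card_ffun !card_prod !card_ord.
set Q := (N * 3)%N.
have -> : 2 ^ (5 * Q + 8 * N * Q) = 2 ^ Q * 2 ^ Q * 2 ^ Q * ((2 ^ N) ^ 3) ^ Q * ((2 ^ N) ^ 3) ^ Q *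
    (2 ^ N * 2 ^ N) ^ Q * (2 ^ Q * 2 ^ Q).
  rewrite -!expnD -!expnM -!expnD; congr (2 ^ _).
  lia.
have mono m k e : m <= k -> m ^ e <= k ^ e by case: e => // e H; rewrite leq_exp2r.
by rewrite !leq_mul //; do ?[apply: mono | apply: leq_mul | apply: N2].
Qed.

(* The exponents of [h] in the constants [gE], [gV] and in the bound for [sim]. *)
Definition xgE Q := 69 * Q + 137.
Definition xgV Q := 68 * Q + xgE Q * Q + 2 + 68 + Q ^ 3.
Definition xsim N Q := 67 * Q + xgE Q * Q + xgV Q * Q + 2 + (5 * Q + 8 * N * Q).
Definition density_exponent b := 68 + 3 * (xsim (2 * b).+1 ((2 * b).+1 * 3) + 71).

Section Moderate.
Variables (R : realType) (X : finType) (S : latin X) (b : nat) (h : R).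
Local Open Scope ring_scope.
Hypotheses (h0 : 0 < h) (h2 : h <= 1 / 2).
Let n : R := #|X|%:R.

Let h1 : h <= 1. Proof. by apply: le_trans h2 _; lra. Qed.
Let hx x : 0 < h ^+ x. Proof. exact: exprn_gt0. Qed.
Let hx1 x : h ^+ x <= 1. Proof. by apply: exprn_ile1 => //; apply: ltW. Qed.

Let pow2_le1 x : 2 ^+ x * h ^+ x <= 1.
Proof. by rewrite -exprMn; apply: exprn_ile1; rewrite ?mulr_ge0 ?(ltW h0) //; move: h2; lra. Qed.

Let nat_le1 m x : (m <= 2 ^ x)%N -> m%:R * h ^+ x <= 1.
Proof.
move=> H; apply: le_trans (pow2_le1 x); rewrite ler_wpM2r ?(ltW (hx x)) //.
by rewrite -natrX ler_nat.
Qed.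

Let mul_half (q c y z : R) : 0 <= c -> 0 <= z -> q * y <= 1 -> z <= 1 / 2 -> q * (c * y * z) <= c / 2.
Proof.
move=> c0 z0 qy z2; have -> : q * (c * y * z) = c * (q * y * z) by ring.
rewrite ler_wpM2l //; apply: le_trans (ler_wpM2r z0 qy) _; lra.
Qed.

Let mul_quarter (q c y z : R) : 0 <= c -> 0 <= z -> q * y <= 1 -> 4 * z <= 1 -> q * (c * (z * y)) <= c / 4.
Proof.
move=> c0 z0 qy z2; have -> : q * (c * (z * y)) = c * (q * y * z) by ring.
rewrite ler_wpM2l //; apply: le_trans (ler_wpM2r z0 qy) _; lra.
Qed.

Let three_fourth (m y e f z : R) : 0 <= e -> 0 <= f -> 0 <= z -> 0 <= m * y -> 12 * z <= 1 -> m * y <= 1 ->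
  3 * m * (f * (e * z * y)) <= f * e / 4.
Proof.
move=> e0 f0 z0 my0 z1 my1.
have -> : 3 * m * (f * (e * z * y)) = f * e * (3 * z * (m * y)) by ring.
rewrite -[leRHS]mulrA -[f * e * _]mulrA ler_wpM2l // ler_wpM2l //.
have /le_trans := ler_wpM2l (mulr_ge0 (ler0n R 3) z0) my1; apply; lra.
Qed.

Let five_eighths (e : R) : 0 <= e -> e * h ^+ 3 <= e / 2 - 3 * (e * h ^+ 4) - e * h ^+ 3.
Proof.
have := nat_le1 (m := 8) (x := 3) isT; have := nat_le1 (m := 16) (x := 4) isT.
move: (h ^+ 4) (h ^+ 3) => x y hx4 hy e0.
have -> : e / 2 - 3 * (e * x) - e * y = e * (1 / 2 - 3 * x - y) by ring.
rewrite ler_wpM2l //; lra.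
Qed.

Let half_sum x : x <= 1 -> h + h * x <= 1.
Proof. by move=> x1; have := ler_wpM2l (ltW h0) x1; rewrite mulr1; move: h2; move: (h * x) => y; lra. Qed.

Lemma rigid_moderate : (0 < #|X|)%N -> h * n ^+ 3 <= #|[set p | hastet S p]|%:R ->
  exists A : {set {ffun 'I_3 -> X}}, [/\ forall t, t \in A -> Fc S t, rigid A b
    & h ^+ density_exponent b * n ^+ 2 <= #|A|%:R].
Proof.
move=> X0 Hh.
pose I := 'I_(2 * b).+1; pose Q := #|{: I * 'I_3}|.
have EQ : Q = ((2 * b).+1 * 3)%N by rewrite /Q card_prod !card_ord.
have np : 0 < n by rewrite ltr0n.
have Q2 : (Q <= 2 ^ Q)%N by apply: ltnW; apply: ltn_expl.
have HQ := nat_le1 Q2.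
pose xs := xsim (2 * b).+1 Q.
(* All constants are powers of [h]: [e0 = h ^+ 64] comes from the tripartite count, and [h <= 1 / 2]
   lets extra powers of [h] absorb numerical factors and powers of 2. Only the relations listed here
   are used afterwards. *)
have [e0 [cF [d [th [gE [gV [[e00 cF0 d0 th0] [gE0 gV0 cF1 gE1] [HW cFE dE thE]
    [gEE gVE xsE [cF70 dexpE]]]]]]]]] : exists e0 cF d th gE gV : R,
  [/\ [/\ 0 < e0, 0 < cF, 0 < d & 0 < th], [/\ 0 < gE, 0 < gV, cF <= 1 & gE <= 1],
      [/\ e0 * n ^+ 12 <= #|wtset S|%:R, cF = e0 * h ^+ 3, d = e0 * h ^+ 4
        & th = cF ^+ Q * h ^+ Q * h]
    & [/\ gE = th * d * (e0 * h ^+ 4 * h ^+ Q),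
          gV = cF ^+ Q * gE ^+ Q * (h ^+ 2 * h ^+ Q) * (e0 * h ^+ 4 * h ^+ (Q ^ 3)),
          h ^+ xs = cF ^+ Q * gE ^+ Q * gV ^+ Q * (h ^+ 2 * h ^+ (5 * Q + 8 * (2 * b).+1 * Q))
        & h ^+ 70 = cF * h ^+ 3 /\ h ^+ density_exponent b = cF * h * (h ^+ (xs + 70).+1) ^+ 3]].
  exists (h ^+ 64), (h ^+ 67), (h ^+ 68), (h ^+ (68 * Q + 1)), (h ^+ xgE Q), (h ^+ xgV Q).
  have pw x y z : (x + y)%N = z -> h ^+ x * h ^+ y = h ^+ z by move=> <-; rewrite exprD.
  split=> //; split=> //.
  - by apply: wtset_lb => //; apply: ltW.
  - by rewrite (pw _ _ 67%N).
  - by rewrite (pw _ _ 68%N).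
  - rewrite -exprM -[X in _ * X]expr1 -!exprD; congr (h ^+ _); clear; lia.
  - rewrite -!exprD; congr (h ^+ _); rewrite /xgE; clear; lia.
  - rewrite -!exprM -!exprD; congr (h ^+ _); rewrite /xgV; clear; lia.
  - rewrite -!exprM -!exprD; congr (h ^+ _); rewrite /xs /xsim; clear; lia.
  - split; first by rewrite (pw _ _ 70%N).
    rewrite -[X in _ * X * _]expr1 -!exprM -!exprD; congr (h ^+ _).
    rewrite /density_exponent /xs EQ; move: (xsim _ _) => ?; clear; lia.
pose bE := th * d; pose bV := cF ^+ Q * gE ^+ Q * (h ^+ 2 * h ^+ Q).
have cFQ : 0 < cF ^+ Q * gE ^+ Q by rewrite mulr_gt0 // exprn_gt0.
have bE0 : 0 < bE by exact: mulr_gt0.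
have bV0 : 0 < bV by exact: mulr_gt0 (mulr_gt0 (hx 2) (hx Q)).
have h4 : 12 * h ^+ 4 <= 1 by exact: (nat_le1 (m := 12) (x := 4) isT).
have HE : 3 * 2 ^+ Q * gE <= bE * e0 / 4.
  rewrite gEE; apply: three_fourth; rewrite ?(ltW e00) ?(ltW bE0) ?(ltW (hx _)) ?pow2_le1 //.
  by rewrite mulr_ge0 ?exprn_ge0 ?(ltW h0).
have HV : 3 * 2 ^+ (Q ^ 3) * gV <= bV * e0 / 4.
  rewrite gVE; apply: three_fourth; rewrite ?(ltW e00) ?(ltW bV0) ?(ltW (hx _)) ?pow2_le1 //.
  by rewrite mulr_ge0 ?exprn_ge0 ?(ltW h0).
have Hth : Q%:R * th <= cF ^+ Q / 2.
  by rewrite thE; apply: mul_half; rewrite ?exprn_ge0 ?(ltW cF0) ?(ltW h0).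
have Hbe : Q%:R * bV <= cF ^+ Q * gE ^+ Q / 4.
  by apply: mul_quarter; rewrite ?(ltW cFQ) ?(ltW (hx _)) //; apply: (nat_le1 (m := 4) (x := 2)).
have HaE : cF <= e0 / 2 - 3 * d - cF by rewrite {2}cFE cFE dE; apply: five_eighths; apply: ltW.
have [g [c [HG HBE HBV]]] := @sample_exists X S I R X0 e0 gE bE gV bV e00 (ltW gE0)
  bE0 (ltW gV0) bV0 HW HE HV.
pose sE k l : R := \sum_Sf #|badE S (I := I) g c gE k Sf l|%:R.
(* The labels with too many bad position choices are deleted; by Markov's inequality and
   [bE = th * d] there are at most [d * n] of each kind. *)
pose del k := [set l | th * n ^+ Q < sE k l].
have pQ : 0 < n ^+ Q by rewrite exprn_gt0.
have Hdel k : #|del k|%:R <= d * n.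
  have p : 0 < th * n ^+ Q by exact: mulr_gt0.
  rewrite -(ler_pM2r p) (_ : d * n * (th * n ^+ Q) = bE * n ^+ Q.+1); last first.
    by rewrite /bE (exprS n Q); ring.
  apply: le_trans HBE.
  apply: le_trans (_ : \sum_l sE k l <= _); last first.
    rewrite [leRHS](bigD1 k) // exchange_big lerDl.
    by do 3 (apply: sumr_ge0 => ? _).
  have -> : #|del k|%:R * (th * n ^+ Q) = \sum_(l in del k) th * n ^+ Q.
    by rewrite sumr_const mulr_natl.
  rewrite [leRHS](bigID (mem (del k))) /= -[leLHS]addr0.
  apply: lerD; last by do 2 (apply: sumr_ge0 => ? _).
  by apply: ler_sum => l; rewrite inE => /ltW.
pose W := [set y : {ffun 'I_3 -> X} * {ffun 'I_3 -> X} | wt S g c y.1 y.2].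
have WT y : y \in W -> tet S y.1 y.2 by rewrite inE => /and3P[].
have := @heavy_faces R X S W del (e0 / 2) d cF X0 (ltW cF0) WT HG Hdel.
set A1 := [set t | _] => HA1.
have {}HA1 : cF * n ^+ 2 <= #|A1|%:R.
  by apply: le_trans HA1; rewrite ler_wpM2r ?exprn_ge0 ?(ltW np).
have FA t : t \in A1 -> Fc S t by rewrite inE => /and3P[].
have H1 t : t \in A1 -> cF * n <= #|[set a | wt S g c t a]|%:R.
  rewrite inE => /and3P[_ _ /le_trans]; apply; rewrite ler_nat.
  by apply: subset_leq_card; apply/subsetP => a; rewrite !inE.
have H2 t k Sf : t \in A1 -> #|badE S (I := I) g c gE k Sf (t k)|%:R <= th * n ^+ Q.
  rewrite inE => /and3P[_ /forallP/(_ k) + _]; rewrite inE -leNgt; apply: le_trans.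
  by rewrite /sE (bigD1 Sf) // lerDl; apply: sumr_ge0.
have Hsim i := @card_sim R X S b g c cF th gE bV gV A1 H1 H2 HBV (ltW cF0) cF1
  (ltW gE0) gE1 (ltW gV0) (ltW th0) Hth Hbe i.
have Hs i : #|sim b A1 i|%:R <= (h ^+ xs)^-1 * n.
  rewrite mulrC ler_pdivlMr // xsE.
  have sh := nat_le1 (card_shape (2 * b).+1); rewrite -EQ in sh.
  have f4 : 4 * h ^+ 2 <= 1 by exact: (nat_le1 (m := 4) (x := 2) isT).
  move: (hx 2) (hx (5 * Q + 8 * (2 * b).+1 * Q)) f4 sh (Hsim i).
  move: (h ^+ 2) (h ^+ (5 * Q + _)) (cF ^+ Q * gE ^+ Q * gV ^+ Q) => y z K y0 z0 y1 z1 HK.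
  have -> : #|sim b A1 i|%:R * (K * (y * z)) = #|sim b A1 i|%:R * (K / 4) * (4 * y * z) by field.
  apply: le_trans (ler_wpM2r _ HK) _; first by rewrite !mulr_ge0 ?(ltW y0) ?(ltW z0).
  rewrite -/n (_ : _ * n * _ = #|{: shape 'I_(2 * b).+1}|%:R * z * (4 * y) * n); last by ring.
  apply: ler_piMl; first exact: ltW np.
  by apply: mulr_ile1 => //; rewrite mulr_ge0 ?(ltW z0) ?(ltW y0).
(* The exponent 70 is 67 for [cF] plus 3 to absorb the factor 6 in the degree condition of
   [rigid_subset]. *)
pose p := (xs + 70)%N; pose D := Num.truncn (h ^+ p)^-1.
have /andP[D1 D2] : D%:R <= (h ^+ p)^-1 < D.+1%:R.
  by apply: Num.Theory.truncn_itv; rewrite invr_ge0 ltW.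
have HD : 6 * (h ^+ xs)^-1 <= cF * D.+1%:R.
  apply: le_trans (_ : cF * (h ^+ p)^-1 <= _); last by rewrite ler_wpM2l ?(ltW cF0) // ltW.
  rewrite ler_pdivlMr // /p exprD mulrA -(mulrA 6) (mulVf (lt0r_neq0 (hx xs))) mulr1.
  rewrite cF70 mulrCA; apply: ler_piMr; first exact: ltW.
  exact: (nat_le1 (m := 6) (x := 3) isT).
have [B [sB rB cB]] := rigid_subset (ltW cF0) X0 FA HA1 Hs HD.
exists B; split=> //; first by move=> t /(subsetP sB); apply: FA.
have HD3 : D.+1%:R * h ^+ p.+1 <= 1.
  have le : D.+1%:R <= (h ^+ p)^-1 + 1 by rewrite -[D.+1]addn1 natrD lerD2r.
  apply: le_trans (ler_wpM2r (ltW (hx _)) le) _.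
  rewrite (exprS h p) mulrDl mul1r mulrCA mulVf ?lt0r_neq0 // mulr1.
  exact: half_sum.
(* One factor [h] replaces [1 / 2], and three factors [h ^+ p.+1] pay for the [D.+1 ^ 3] colour
   vectors. *)
rewrite dexpE -/p; apply: le_trans (_ : (cF / 2 * n ^+ 2) * (h ^+ p.+1) ^+ 3 <= _).
  rewrite [leLHS]mulrAC; apply: ler_wpM2r; first by rewrite exprn_ge0 // ltW.
  apply: ler_wpM2r; first by rewrite exprn_ge0 // ltW.
  by apply: ler_wpM2l; rewrite ?(ltW cF0) // -[2^-1]mul1r.
apply: le_trans (ler_wpM2r _ cB) _; first by rewrite exprn_ge0 // ltW.
rewrite mulrAC -exprMn; apply: ler_piMl => //.
by apply: exprn_ile1; rewrite ?mulr_ge0 ?(ltW (hx _)).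
Qed.
End Moderate.

(** Everything is compared with powers of [b], using [b >= 2]: products add exponents and a sum
    costs one more. The result is [b ^ 38], and [38 <= 26 * 2 <= 26 * b]. *)
Lemma density_exponent_le b : 2 <= b -> 8 * b * density_exponent b <= b ^ (26 * b).
Proof.
move=> b2.
have b0 : 0 < b by apply: ltnW.
have up x i j : x <= b ^ i -> i <= j -> x <= b ^ j.
  by move=> H ij; apply: leq_trans H _; rewrite leq_pexp2l.
have cst c i : c <= 2 ^ i -> c <= b ^ i.
  by move=> H; apply: leq_trans H _; case: i => // i; rewrite leq_exp2r.
have mul x y i j : x <= b ^ i -> y <= b ^ j -> x * y <= b ^ (i + j).
  by move=> Hx Hy; rewrite expnD leq_mul.
have add x y i : x <= b ^ i -> y <= b ^ i -> x + y <= b ^ i.+1.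
  move=> Hx Hy; rewrite expnS; apply: leq_trans (leq_add Hx Hy) _.
  by rewrite addnn -mul2n leq_mul2r b2 orbT.
have hb : b <= b ^ 1 by rewrite expn1.
rewrite /density_exponent /xsim; set N := (2 * b).+1; set Q := N * 3.
have hN : N <= b ^ 3.
  by rewrite /N -addn1; apply: (add _ _ _); [exact: (mul _ _ 1 1)|exact: (cst _ _)].
have hQ : Q <= b ^ 5 by apply: (mul _ _ 3 2) => //; exact: (cst _ _).
have hE : xgE Q <= b ^ 13.
  by apply: (add _ _ _); [apply: (mul _ _ 7 5) => //; apply: cst|apply: (up _ 8) => //; apply: cst].
have hEQ : xgE Q * Q <= b ^ 18 by apply: (mul _ _ 13 5).
have hV : xgV Q <= b ^ 22.
  apply: (add _ _ _); last by apply: (up _ 15) => //; rewrite -[15]/(5 * 3) expnM leq_exp2r.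
  apply: (add _ _ _); last by apply: (up _ 7) => //; apply: cst.
  apply: (add _ _ _); last by apply: (up _ 1) => //; apply: cst.
  by apply: (add _ _ _) => //; apply: (up _ 12) => //; apply: (mul _ _ 7 5) => //; apply: cst.
have hS : 67 * Q + xgE Q * Q + xgV Q * Q + 2 + (5 * Q + 8 * N * Q) <= b ^ 30.
  apply: (add _ _ _); last first.
    apply: (up _ 12) => //; apply: add.
      by apply: (up _ 8) => //; apply: (mul _ _ 3 5) => //; apply: cst.
    by apply: (mul _ _ 6 5) => //; apply: (mul _ _ 3 3) => //; apply: cst.
  apply: (add _ _ _); last by apply: (up _ 1) => //; apply: cst.
  apply: (up _ 28) => //; apply: (add _ _ _); last by apply: (mul _ _ 22 5).
  apply: (up _ 19) => //; apply: (add _ _ _) => //.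
  by apply: (up _ 12) => //; apply: (mul _ _ 7 5) => //; apply: cst.
apply: (up _ 38); last by apply: leq_trans (_ : 26 * 2 <= _) => //; rewrite leq_mul2l b2.
apply: (mul _ _ 4 34); first by apply: (mul _ _ 3 1) => //; apply: cst.
apply: (add _ _ _); first by apply: (up _ 7) => //; apply: cst.
apply: (mul _ _ 2 31); first exact: (cst _ _).
by apply: (add _ _ _) => //; apply: (up _ 7) => //; apply: cst.
Qed.

(** * Choosing between the two regimes *)

Lemma rigid_one (X : finType) (A : {set {ffun 'I_3 -> X}}) : rigid A 1.
Proof.
move=> i l l' k k0 H.
have aux m w : lnull A m w -> m < 1 -> w = [:: (i, l, true); (i, l', false)] -> l = l'.
  case=> // k1 k2 a w1 w2 _ _ _ [->].
  by case: w1 => [|x [|y w1]] //= [->].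
exact: aux H k0 erefl.
Qed.

Section Density.
Variables (R : realType) (X : finType) (S : latin X).
Local Open Scope ring_scope.
Let n : R := #|X|%:R.

(** Bernoulli's inequality for [(1 - z) ^- m], cleared of denominators. It serves at [z = 1 - eps]
    in the dense regime and at [z = 1 / (8 * b)] to get [h <= 1 / 2] in the other. *)
Lemma decay (m : nat) (z : R) : 0 <= z -> z <= 1 -> (1 - z) ^+ m * (1 + m%:R * z) <= 1.
Proof.
move=> z0 z1; elim: m => [|m IH]; first by rewrite expr0 mul0r addr0 mulr1.
apply: le_trans IH; rewrite exprSr -mulrA ler_wpM2l ?exprn_ge0 ?subr_ge0 //.
rewrite -natr1; have := mulr_ge0 (ler0n R m) (mulr_ge0 z0 z0); have := mulr_ge0 z0 z0.
move: (m%:R) => y; nra.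
Qed.

Lemma hastet_le : (#|[set p | hastet S p]| <= #|[set y : {ffun 'I_3 -> X} * {ffun 'I_3 -> X} | tet S y.1 y.2]|)%N.
Proof.
apply: (card_inj_le (f := fun p => (odflt p [pick t | tet S t p], p))) => [p p' _ _ [] //|p].
rewrite !inE => /existsP[t Ht]; case: pickP => [t' //|/(_ t)]; by rewrite Ht.
Qed.

(** At most [n ^+ 2] triangles are rejected, each with fewer than [(1 - 1 / (4 * b)) * n]
    tetrahedra, so the number of tetrahedra bounds the size of [A] from below. *)
Lemma exists_dense (b : nat) (eps : R) : (0 < b)%N -> (0 < #|X|)%N ->
  eps * n ^+ 3 <= #|[set p | hastet S p]|%:R ->
  exists A : {set {ffun 'I_3 -> X}}, [/\ forall t, t \in A -> Fc S t, rigid A b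
    & (1 - 4 * b%:R * (1 - eps)) * n ^+ 2 <= #|A|%:R].
Proof.
move=> b0 X0 He; have np : 0 < n by rewrite ltr0n.
have bp : 0 < b%:R :> R by rewrite ltr0n.
pose T t := [set a | tet S t a].
pose A := [set t | Fc S t && (4 * b * (#|X| - #|T t|) <= #|X|)%N].
exists A; split.
- by move=> t; rewrite inE => /andP[].
- apply: (@rigid_dense _ S A b (#|X| %/ (4 * b))) => [t|].
    rewrite inE => /andP[_ H]; rewrite leq_divRL ?muln_gt0 ?b0 //.
    by rewrite mulnC.
  by rewrite mulnC leq_trunc_div.
have sT : #|[set y : {ffun 'I_3 -> X} * {ffun 'I_3 -> X} | tet S y.1 y.2]|%:R =
    \sum_t #|T t|%:R :> R.
  rewrite -natr_sum -(card_sigma xpredT T); congr (_%:R).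
  by apply: eq_card => -[t a]; rewrite !inE.
have scard (P : pred {ffun 'I_3 -> X}) : \sum_t (P t)%:R = #|[set t | P t]|%:R :> R.
  by rewrite -sum1dep_card natr_sum [RHS]big_mkcond; apply: eq_bigr => t _; case: (P t).
have key t : 4 * b%:R * #|T t|%:R <= (t \in A)%:R * n + (Fc S t && (t ord0 \in setT))%:R * ((4 * b%:R - 1) * n).
  have b1 : 0 <= (4 * b%:R - 1) * n :> R.
    by rewrite mulr_ge0 ?(ltW np) // subr_ge0 -natrM -[leLHS]/(1%:R) ler_nat; clear -b0; lia.
  have le_n : #|T t|%:R <= n by rewrite ler_nat tet_card.
  rewrite inE; case: (set_0Vmem (T t)) => [->|[a]].
    by rewrite cards0 mulr0; apply: addr_ge0; apply: mulr_ge0 => //; apply: ltW.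
  rewrite inE => /tetF Ft; rewrite Ft inE /= mul1r.
  case: leqP => H.
    rewrite mul1r (_ : n + _ = 4 * b%:R * n); last by ring.
    by rewrite ler_wpM2l // mulr_ge0 // ltW.
  rewrite mul0r add0r; have : (4 * b * #|T t| + #|X| <= 4 * b * #|X|)%N.
    move: H (tet_card S t); rewrite mulnBr -/(T t) => H H'.
    have H'' := leq_mul (leqnn (4 * b)) H'.
    by rewrite -(leq_add2l (4 * b * #|T t|)) subnKC // in H; apply: leq_trans H; rewrite leq_add2l.
  rewrite -(ler_nat R) natrD !natrM mulrBl -/n mul1r; lra.
have tot : 4 * b%:R * (eps * n ^+ 3) <= #|A|%:R * n + n * n * ((4 * b%:R - 1) * n).
  apply: le_trans (_ : 4 * b%:R * \sum_t #|T t|%:R <= _).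
    rewrite ler_wpM2l ?mulr_ge0 ?(ltW bp) //; apply: le_trans He _.
    by rewrite -sT ler_nat hastet_le.
  rewrite mulr_sumr; apply: le_trans (ler_sum _ (fun t _ => key t)) _.
  rewrite big_split /= -!mulr_suml !scard; apply: lerD.
    by rewrite ler_wpM2r ?(ltW np) // ler_nat; apply: eq_leq; apply: eq_card => t; rewrite inE.
  rewrite ler_wpM2r //.
    by rewrite mulr_ge0 ?(ltW np) // subr_ge0 -natrM -[leLHS]/(1%:R) ler_nat; clear -b0; lia.
  apply: le_trans (_ : (#|[set: X]| * #|X|)%:R <= _); first by rewrite ler_nat faces_card.
  by rewrite natrM cardsT.
rewrite -(ler_pM2r np); have -> : (1 - 4 * b%:R * (1 - eps)) * n ^+ 2 * n =
  4 * b%:R * (eps * n ^+ 3) - n * n * ((4 * b%:R - 1) * n) by ring.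
by rewrite lerBlDr.
Qed.

Lemma exists_rigid (b : nat) (eps : R) : (0 < b)%N -> 0 < eps ->
  eps * n ^+ 3 <= #|[set p | hastet S p]|%:R ->
  exists A : {set {ffun 'I_3 -> X}}, [/\ forall t, t \in A -> Fc S t, rigid A b
    & eps ^+ (b ^ (26 * b)) * n ^+ 2 <= #|A|%:R].
Proof.
move=> b0 e0 He; case: (posnP #|X|) => [X0|X0].
  exists set0; split=> [t|i l|]; first by rewrite inE.
    by have := fintype0 l X0.
  by rewrite cards0 /n X0 expr0n mulr0.
have np : 0 < n by rewrite ltr0n.
have e1 : eps <= 1.
  have p3 : 0 < n ^+ 3 by rewrite exprn_gt0.
  rewrite -(ler_pM2r p3) mul1r; apply: le_trans He _.
  rewrite -natrX ler_nat -[X in (_ ^ X)%N]card_ord -card_ffun; exact: max_card.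
have Hp m m' : (m <= m')%N -> eps ^+ m' <= eps ^+ m by apply: ler_wiXn2l => //; apply: ltW.
have up m (A : {set {ffun 'I_3 -> X}}) : (m <= b ^ (26 * b))%N -> eps ^+ m * n ^+ 2 <= #|A|%:R ->
    eps ^+ (b ^ (26 * b)) * n ^+ 2 <= #|A|%:R.
  by move=> Hm; apply: le_trans; rewrite ler_wpM2r ?exprn_ge0 ?(ltW np) // Hp.
(* For [b = 1] the exponent is 1 and all triangles are kept: [heavy_faces] is used with nothing
   deleted and threshold 0. *)
case: (ltnP 1 b) => [b2|]; last first.
  move=> b1; have -> : b = 1%N by apply/eqP; rewrite eqn_leq b1.
  pose W := [set y : {ffun 'I_3 -> X} * {ffun 'I_3 -> X} | tet S y.1 y.2].
  have WT y : y \in W -> tet S y.1 y.2 by rewrite inE.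
  have HW : eps * n ^+ 3 <= #|W|%:R by apply: le_trans He _; rewrite ler_nat hastet_le.
  have := @heavy_faces R X S W (fun _ => set0) eps 0 0 X0 (lexx 0) WT HW.
  set A := [set t | _] => HA; exists A; split.
  - by move=> t; rewrite inE => /and3P[].
  - exact: rigid_one.
  rewrite exp1n expr1; apply: le_trans (HA _) => [|k]; last by rewrite cards0 mul0r.
  by rewrite mulr0 !subr0.
have M8 : (8 * b <= b ^ (26 * b))%N.
  apply: leq_trans (density_exponent_le b2); rewrite leq_pmulr //.
have bp : 0 < b%:R :> R by rewrite ltr0n.
have B8 : 0 < (8 * b)%:R :> R by rewrite ltr0n muln_gt0 b0.
case: (ltP (1 - (8 * b)%:R^-1) eps) => He8.
  have [A [FA rA cA]] := exists_dense b0 X0 He.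
  exists A; split=> //; apply: (up (8 * b)%N) => //; apply: le_trans cA.
  rewrite ler_wpM2r ?exprn_ge0 ?(ltW np) //.
  have z0 : 0 <= 1 - eps by rewrite subr_ge0.
  have z1 : 1 - eps <= 1 by rewrite gerBl ltW.
  have := decay (8 * b) z0 z1; rewrite subKr.
  set z := 1 - eps in z0 z1 *; set m := eps ^+ _ => Hd.
  have z8 : (8 * b)%:R * z <= 1.
    by rewrite mulrC -ler_pdivlMr // mul1r /z lerBlDl -lerBlDr ltW.
  rewrite natrM in z8 Hd.
  have p1 : 0 < 1 + 8 * b%:R * z by rewrite ltr_pwDl // !mulr_ge0 // ltW.
  rewrite -(ler_pM2r p1); apply: le_trans Hd _.
  (* With [y = b * z], the inequality [1 <= (1 - 4 * y) * (1 + 8 * y)] follows from [0 <= y] and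
     [8 * y <= 1]. *)
  have := mulr_ge0 (ltW bp) z0; move: z8; rewrite -!mulrA; move: (b%:R * z) => y; nra.
have h0 : 0 < eps ^+ (8 * b) by rewrite exprn_gt0.
have h2 : eps ^+ (8 * b) <= 1 / 2.
  have i0 : 0 <= (8 * b)%:R^-1 :> R by rewrite invr_ge0 ltW.
  have i1 : (8 * b)%:R^-1 <= 1 :> R.
    by rewrite invf_le1 // -[leLHS]/(1%:R) ler_nat muln_gt0 b0.
  have := decay (8 * b) i0 i1; rewrite divff ?gt_eqF // => Hd.
  have : eps ^+ (8 * b) <= (1 - (8 * b)%:R^-1) ^+ (8 * b).
    by apply: lerXn2r => //; rewrite nnegrE ?subr_ge0 // ltW.
  move: Hd; move: (_ ^+ _) (_ ^+ _) => ? ?; lra.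
have [|A [FA rA cA]] := @rigid_moderate R X S b _ h0 h2 X0.
  apply: le_trans He; rewrite ler_wpM2r ?exprn_ge0 ?(ltW np) //.
  by rewrite -[leRHS]expr1 Hp // muln_gt0 b0.
exists A; split=> //; rewrite -exprM in cA.
by apply: up cA; apply: density_exponent_le.
Qed.
End Density.

(** * A partial operation as a system of triangles and positions *)

Section Operation.
Variables (X : finType) (op : X -> X -> option X).
Hypothesis op_inj : injective_in_each_variable op.
Let i0 : 'I_3 := inord 0.
Let i1 : 'I_3 := inord 1.
Let i2 : 'I_3 := inord 2.

(* For [x o y = z], [y o w = p] and [x o p = z o w = q]: the triangle has labels
   [y], [z], [x] and the positions are [q], [p], [w], of kinds 0, 1, 2. *)
Definition opF (t : {ffun 'I_3 -> X}) := op (t (inord 2)) (t (inord 0)) == Some (t (inord 1)).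
(** In [z o w = q] the argument [w] has kind 2 and the value [q] kind 0, so the argument comes
    first; in [y o w = p] and [x o p = q] the value comes first. *)
Definition opL (i : 'I_3) (l a b : X) :=
  if i == inord 1 then op l a == Some b else op l b == Some a.

Lemma inord3E : [/\ nx i0 = i1, nx i1 = i2, nx i2 = i0 & [/\ pv i0 = i2, pv i1 = i0 & pv i2 = i1]].
Proof. by repeat split; apply/val_inj; rewrite /= !inordK. Qed.

Lemma opF_inj i t t' : opF t -> opF t' -> t (nx i) = t' (nx i) -> t (pv i) = t' (pv i) -> t = t'.
Proof.
have [n0 n1 n2 [p0 p1 p2]] := inord3E.
rewrite /opF -/i0 -/i1 -/i2 => /eqP F /eqP F' E1 E2; apply/ffunP; apply: (I3_cases (i := i)) => //.
move: E1 E2; move: i; apply: (I3_cases (i := i0)); rewrite ?n0 ?p0 ?n1 ?p1 ?n2 ?p2 => E1 E2.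
- by move: F F'; rewrite E1 E2 => F F'; apply: op_inj.1 F F'.
- by move: F F'; rewrite E1 E2 => -> [].
- by move: F F'; rewrite E1 E2 => F F'; apply: op_inj.2 F F'.
Qed.

Lemma opL_inj1 i l l' a b : opL i l a b -> opL i l' a b -> l = l'.
Proof. by rewrite /opL; case: ifP => _ /eqP H /eqP H'; apply: op_inj.2 H H'. Qed.
Lemma opL_inj2 i l a a' b : opL i l a b -> opL i l a' b -> a = a'.
Proof.
rewrite /opL; case: ifP => _ /eqP H /eqP H'; first exact: op_inj.1 H H'.
by move: H'; rewrite H => -[].
Qed.
Lemma opL_inj3 i l a b b' : opL i l a b -> opL i l a b' -> b = b'.
Proof.
rewrite /opL; case: ifP => _ /eqP H /eqP H'; last exact: op_inj.1 H H'.
by move: H'; rewrite H => -[].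
Qed.

Definition op_latin : latin X := Latin opF_inj opL_inj1 opL_inj2 opL_inj3.

Let mk (a b c : X) : {ffun 'I_3 -> X} := [ffun i : 'I_3 => nth a [:: a; b; c] i].
Let mkE a b c : [/\ mk a b c i0 = a, mk a b c i1 = b & mk a b c i2 = c].
Proof. by rewrite !ffunE !inordK. Qed.

(** The positions [q], [p], [w] determine [y] from [y o w = p] and [x] from [x o p = q]; the labels
    over them are [y], [z], [x]. *)
Lemma associative_hastet : #|associative_triples op| <= #|[set p | hastet op_latin p]|.
Proof.
pose f (z : X * X * X) : {ffun 'I_3 -> X} := let: (x, y, w) := z in
  mk (odflt w (obind (fun p => op x p) (op y w))) (odflt w (op y w)) w.
have ass x y w : (x, y, w) \in associative_triples op -> exists p q z,
    [/\ op y w = Some p, op x p = Some q, op x y = Some z & op z w = Some q].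
  rewrite inE; case Ep: (op y w) => [p|//]; rewrite /=; case Eq: (op x p) => [q|//] /=.
  case Ez: (op x y) => [z|//] /=; case Er: (op z w) => [r|//] /= /eqP[E]; subst r.
  by exists p, q, z.
apply: (card_inj_le (f := f)) => [[[x y] w] [[x' y'] w'] /ass[p [q [z [H1 H2 H3 H4]]]] |[[x y] w]].
  move=> /ass[p' [q' [z' [H1' H2' H3' H4']]]]; rewrite /f H1 /= H2 /= H1' /= H2' /= => E.
  have [A0 A1 A2] := mkE q p w; have [B0 B1 B2] := mkE q' p' w'.
  have Eq : q = q' by rewrite -A0 E B0. have Ep : p = p' by rewrite -A1 E B1.
  have Ew : w = w' by rewrite -A2 E B2.
  subst q' p' w'; have Ex := op_inj.2 _ _ _ _ H2 H2'; have Ey := op_inj.2 _ _ _ _ H1 H1'.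
  by subst x' y'.
move=> /ass[p [q [z [H1 H2 H3 H4]]]]; rewrite inE /f H1 /= H2 /=.
have [A0 A1 A2] := mkE q p w; have [B0 B1 B2] := mkE y z x.
have [n0 n1 n2 [p0 p1 p2]] := inord3E.
apply/existsP; exists (mk y z x); rewrite /tet /= /opF -/i0 -/i1 -/i2 B0 B1 B2 H3 eqxx /=.
apply/forallP; apply: (I3_cases (i := i0)); rewrite ?p0 ?n0 ?n1 ?n2 ?p1 ?p2 ?A0 ?A1 ?A2 ?B0 ?B1 ?B2 /opL.
- by rewrite (_ : (i0 == _) = false) ?H1 // -val_eqE /= !inordK.
- by rewrite eqxx H4.
- by rewrite (_ : (i2 == _) = false) ?H2 // -val_eqE /= !inordK.
Qed.
End Operation.

(** * The metric group attached to a partial operation *)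

Local Open Scope ring_scope.

Theorem theorem1p2 (R : realType) (eps : R) (b : nat) :
  0 < eps -> (0 < b)%N ->
  exists delta : R,
    eps ^+ (b ^ (26 * b))%N <= delta /\
    forall (X : finType) (op : X -> X -> option X),
      injective_in_each_variable op ->
      eps * #|X|%:R ^+ 3 <= #|associative_triples op|%:R ->
      exists (A : {set X * X}) (G : metricGroup R) (phi psi omega : X -> G),
        [/\ A \subset op_domain op,
            delta * #|X|%:R ^+ 2 <= #|A|%:R,
            [/\ one_separated_image phi,
                one_separated_image psi
              & one_separated_image omega]
          & forall x y z : X, (x, y) \in A -> op x y = Some z ->
              (mg_dist (phi x * psi y)%g (omega z) <= (b%:R^-1)%:E)%E].
Proof.
move=> e0 b0; exists (eps ^+ (b ^ (26 * b))); split=> // X op op_inj He.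
have [|A [FA rA cA]] := @exists_rigid R X (op_latin op_inj) b eps b0 e0.
  by apply: le_trans He _; rewrite ler_nat associative_hastet.
pose pr (t : {ffun 'I_3 -> X}) := (t (inord 2), t (inord 0)).
pose G := word_metricGroup A R b0.
(* The sides of kinds 2, 0, 1 are in cyclic order and multiply to 1 up to one triangle, so [z] is
   sent to an inverse letter. *)
exists (pr @: A), G, (fun x => wclass A [:: (inord 2, x, true)] : G),
  (fun y => wclass A [:: (inord 0, y, true)] : G), (fun z => wclass A [:: (inord 1, z, false)] : G).
have [n0 n1 n2 [p0 p1 p2]] := inord3E; split.
- apply/subsetP => _ /imsetP[t /FA /eqP Ft ->]; by rewrite inE /= Ft.
- rewrite card_in_imset // => t t' /FA Ft /FA Ft' [E2 E0].
  by apply: (@FcI _ (op_latin op_inj) (inord 1)) => //; rewrite ?n1 ?p1.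
- by split; apply: rigid_separated.
- move=> x y z /imsetP[t At [-> ->]]; have /eqP Ft := FA _ At; rewrite Ft => -[<-].
  have := word_triangle R b0 (inord 2) At; rewrite n2 p2; exact.
Qed.
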